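(* Let $\alpha\in\mathbb R\setminus\mathbb Q$ with continued-fraction convergents $p_k/q_k$. Suppose that $\psi:\mathbb R_+\to\mathbb R_+$ is continuous, strictly decreasing to zero, and lower quasimultiplicative. For every sufficiently large $k$ let $Y_k$ be the unique solution of $$\frac{Y_k}{\psi(Y_k)}=\frac{q_k}{|q_k\alpha|_{\mathbb Z}}.$$ Then the following statements hold. (i) Suppose that $\limsup_{T\to\infty}\frac{\log\psi(T)^{-1}}{\log T}<1$, and let $\{k_i\}$ be the increasing enumeration of all sufficiently large indices satisfying $\psi\bigl(|q_{k_i}\alpha|_{\mathbb Z}^{-1}\bigr)<q_{k_i}^{-1}$. If this sequence is finite, then $\dim_H D_\alpha(\psi)=1$. If it is infinite, then $$\dim_H D_\alpha(\psi)=\liminf_{i\to\infty}\frac{\log\Bigl(q_{k_i}\prod_{j=1}^{i-1}q_{k_j}\psi(Y_{k_j})\Bigr)}{\log\psi(Y_{k_i})^{-1}}.$$ (ii) Suppose that $\liminf_{T\to\infty}\frac{\log\psi(T)^{-1}}{\log T}>1$, and let $\{k_i\}$ be the increasing enumeration of all sufficiently large indices satisfying $\psi(q_{k_i})>|q_{k_i}\alpha|_{\mathbb Z}$. If this sequence is finite, then $\dim_H D_\alpha(\psi)=0$. If it is infinite, then $$\dim_H D_\alpha(\psi)=\liminf_{i\to\infty}\frac{\log\Bigl(\prod_{j=1}^{i-1}\frac{\psi(Y_{k_j})}{|q_{k_j}\alpha|_{\mathbb Z}}\Bigr)}{\log\psi(Y_{k_i})^{-1}}.$$ In either of the regimes (i),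 (ii), for every fixed $c>0$, $$\dim_H D_\alpha(c\psi)=\dim_H D_\alpha(\widetilde\psi_c)=\dim_H D_\alpha(\psi).$$
   Context: $\mathbb R_+=(0,\infty)$, $\mathbb T=\mathbb R/\mathbb Z$, $|x|_{\mathbb Z}$ is the distance from $x$ to the nearest integer, and $\dim_H$ is Hausdorff dimension. For $\psi:\mathbb R_+\to\mathbb R_+$, $D_\alpha(\psi)$ is the set of $b\in\mathbb T$ such that for every sufficiently large real $T$ there is $q\in\mathbb Z$ with $|q|\le T$ and $|q\alpha-b|_{\mathbb Z}\le\psi(T)$. For $c>0$, $c\psi$ is $T\mapsto c\psi(T)$ and $\widetilde\psi_c(T):=c\,\psi(T/c)$. A decreasing function $\psi$ is lower quasimultiplicative if there exist $0<\tau<\infty$ and $R_0>1$ such that $R^{-\tau}\psi(T)\le\psi(RT)$ for every sufficiently large $T$ and every $R\ge R_0$. Standing normalization: $\psi(T)\to\infty$ as $T\to0$ (so that $T\mapsto T/\psi(T)$ is a bijection of $\mathbb R_+$). ''All sufficiently large indices'' means all indices $k\ge k_0$ for some fixed large $k_0$. *)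

(* Defs.v *)
From HB Require Import structures.
From mathcomp Require Import all_boot all_order all_algebra.
From mathcomp Require Import generic_quotient ring_quotient.
From mathcomp Require Import all_classical all_reals all_analysis.

Set Implicit Arguments.
Unset Strict Implicit.
Unset Printing Implicit Defensive.

Import Order.TTheory GRing.Theory Num.Theory.
Import numFieldNormedType.Exports.

Local Open Scope classical_set_scope.
Local Open Scope ring_scope.
Local Open Scope quotient_scope.

Section DistInt.
Context {R : realType}.
Implicit Types x y : R.

Definition dist_int x : R := inf [set `|x - m%:~R| | m in [set: int]].

Lemma dist_int_le x (m : int) : dist_int x <= `|x - m%:~R|.
Proof. by apply: ge_inf; [exists 0 => _ [k _ <-] | exists m]. Qed.

Lemma dist_int_attained x : exists m : int, dist_int x = `|x - m%:~R|.
Proof.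
pose f := Num.floor x.
have fx : f%:~R <= x by exact: Num.Theory.floor_le.
have xf : x < f%:~R + 1 by rewrite -[1]/(1%:~R) -intrD; exact: floorD1_gt.
suff [n Hn] : exists n : int, forall m : int, `|x - n%:~R| <= `|x - m%:~R|.
  exists n; apply/eqP; rewrite eq_le dist_int_le /=.
  by apply: lb_le_inf; [exists `|x - n%:~R|, n | move=> _ [k _ <-]].
have key (m : int) : x - f%:~R <= `|x - m%:~R| \/ f%:~R + 1 - x <= `|x - m%:~R|.
  have [mf|fm] := leP m f.
    left; apply: le_trans (ler_norm _); apply: lerB => //.
    by rewrite ler_int.
  right; rewrite distrC; apply: le_trans (ler_norm _); apply: lerB => //.
  by rewrite -[1]/(1%:~R) -intrD ler_int lezD1.
have e0 : `|x - f%:~R| = x - f%:~R by rewrite ger0_norm ?subr_ge0.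
have e1 : `|x - (f + 1)%:~R| = f%:~R + 1 - x.
  by rewrite intrD distrC ger0_norm ?subr_ge0 ?ltW.
have [h|h] := leP (x - f%:~R) (f%:~R + 1 - x).
  by exists f => m; rewrite e0; case: (key m) => // /(le_trans h).
by exists (f + 1) => m; rewrite e1; case: (key m) => // /(le_trans (ltW h)).
Qed.

Lemma dist_int_intD x (m : int) : dist_int (x + m%:~R) = dist_int x.
Proof.
apply/eqP; rewrite eq_le; apply/andP; split.
  have [k ->] := dist_int_attained x.
  by rewrite (le_trans (dist_int_le _ (k + m))) // intrD opprD addrACA subrr addr0.
have [k ->] := dist_int_attained (x + m%:~R).
by rewrite (le_trans (dist_int_le _ (k - m))) // intrB opprB addrA.
Qed.

Lemma dist_intN x : dist_int (- x) = dist_int x.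
Proof.
suff le_N y : dist_int (- y) <= dist_int y.
  by apply/eqP; rewrite eq_le le_N -{1}[x]opprK le_N.
have [k ->] := dist_int_attained y.
by rewrite (le_trans (dist_int_le _ (- k))) // intrN -opprD normrN.
Qed.

Lemma dist_intD x y : dist_int (x + y) <= dist_int x + dist_int y.
Proof.
have [k ->] := dist_int_attained x; have [l ->] := dist_int_attained y.
rewrite (le_trans (dist_int_le _ (k + l))) // intrD opprD addrACA.
exact: ler_normD.
Qed.

Lemma dist_int0 : dist_int 0 = 0.
Proof.
have [k k0] := dist_int_attained 0; apply/eqP; rewrite eq_le {2}k0 normr_ge0.
by rewrite (le_trans (dist_int_le _ 0)) // subrr normr0.
Qed.

Lemma dist_int_eq0 x : dist_int x = 0 -> x \is a Num.int.
Proof.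
have [k ->] := dist_int_attained x.
by move/eqP; rewrite normr_eq0 subr_eq0 => /eqP ->; exact: intr_int.
Qed.

End DistInt.

Definition integers (R : realType) : {pred R} := fun x => x \is a Num.int.

Fact integers_zmod_closed (R : realType) : zmod_closed (@integers R).
Proof. by split=> [|x y]; [exact: int_num0 | exact: rpredB]. Qed.

HB.instance Definition _ (R : realType) :=
  GRing.isZmodClosed.Build R (@integers R) (@integers_zmod_closed R).

Definition circle (R : realType) : Type := Quotient.quot (@integers R).

HB.instance Definition _ (R : realType) := Choice.on (circle R).
HB.instance Definition _ (R : realType) := GRing.Zmodule.on (circle R).

Section Circle.
Context {R : realType}.
Implicit Types (x : R) (s t u : circle R).

Definition to_circle x : circle R := \pi x.

Definition circle_norm t : R := dist_int (repr t).

Lemma circle_norm_pi x : circle_norm (to_circle x) = dist_int x.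
Proof.
have : \pi_(circle R) (repr (to_circle x)) = \pi_(circle R) x by rewrite reprK.
move=> /eqP; rewrite -Quotient.idealrBE => /intrP[m xm].
by rewrite /circle_norm -[repr _](subrK x) xm addrC dist_int_intD.
Qed.

Lemma circle_norm0 : circle_norm 0 = 0.
Proof. by rewrite -[0](_ : to_circle 0 = 0) ?circle_norm_pi ?dist_int0 // /to_circle piE. Qed.

Lemma circle_norm_eq0 t : circle_norm t = 0 -> t = 0.
Proof.
move=> /dist_int_eq0 tZ; rewrite -[t]reprK -[RHS](_ : to_circle 0 = 0).
  by apply/eqP; rewrite -Quotient.idealrBE subr0.
by rewrite /to_circle piE.
Qed.

Lemma circle_normN t : circle_norm (- t) = circle_norm t.
Proof.
rewrite -[t in LHS]reprK -[- _](_ : to_circle (- repr t) = _).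
  by rewrite circle_norm_pi dist_intN.
by rewrite /to_circle !piE.
Qed.

Lemma circle_normD s t : circle_norm (s + t) <= circle_norm s + circle_norm t.
Proof.
rewrite -[s in leLHS]reprK -[t in leLHS]reprK.
rewrite -[_ + _ in leLHS](_ : to_circle (repr s + repr t) = _).
  by rewrite circle_norm_pi dist_intD.
by rewrite /to_circle !piE.
Qed.

Let cdist s t := circle_norm (s - t).

Let cdistxx t : cdist t t = 0.
Proof. by rewrite /cdist subrr circle_norm0. Qed.

Let cdist_positivity s t : cdist s t = 0 -> s = t.
Proof. by move/circle_norm_eq0/eqP; rewrite subr_eq0 => /eqP. Qed.

Let cdist_sym s t : cdist s t = cdist t s.
Proof. by rewrite /cdist -opprB circle_normN. Qed.

Let cdist_triangle t s u : cdist s u <= cdist s t + cdist t u.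
Proof. by rewrite /cdist -[s - u](subrKA t) circle_normD. Qed.

HB.instance Definition _ := @isMetric.Build R (circle R)
  cdist cdistxx cdist_positivity cdist_sym cdist_triangle.

Lemma circle_mdistE s t : mdist s t = circle_norm (s - t).
Proof. by []. Qed.

End Circle.

Section HausdorffDimension.
Context {R : realType} {T : metricType R}.
Local Open Scope ereal_scope.

Definition diam (U : set T) : \bar R :=
  ereal_sup [set d | exists x y, [/\ U x, U y & d = (mdist x y)%:E]].

(* The case distinction gives the empty set weight 0 also for s = 0, while a
   point has weight 0 `^ 0 = 1. *)
Definition diam_pow (s : R) (U : set T) : \bar R :=
  if U == set0 then 0 else diam U `^ s.

Definition hausdorff_premeasure (s delta : R) (A : set T) : \bar R :=
  ereal_inf [set \sum_(i <oo) diam_pow s (U i) | U in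
    [set U : nat -> set T |
       A `<=` \bigcup_i U i /\ forall i, diam (U i) <= delta%:E]].

Definition hausdorff_measure (s : R) (A : set T) : \bar R :=
  ereal_sup [set hausdorff_premeasure s delta A | delta in [set d | 0 < d]%R].

Definition hausdorff_dim (A : set T) : \bar R :=
  ereal_inf [set s%:E | s in [set s | (0 <= s)%R /\ hausdorff_measure s A = 0]].

End HausdorffDimension.

Section ContinuedFraction.
Context {R : realType}.
Implicit Types (x : R) (k : nat).

Fixpoint cf_complete_quotient x k : R :=
  if k is j.+1
  then let y := cf_complete_quotient x j in (y - (Num.floor y)%:~R)^-1
  else x.

Definition cf_coef x k : int := Num.floor (cf_complete_quotient x k).

(* q_k, with q_{-1} = 0, q_0 = 1 and q_{k+1} = a_{k+1} q_k + q_{k-1}. *)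
Fixpoint cf_denom x k : int :=
  if k is j.+1
  then cf_coef x k * cf_denom x j + (if j is i.+1 then cf_denom x i else 0)
  else 1.

End ContinuedFraction.

Section Approximation.
Context {R : realType}.
Implicit Types (alpha c : R) (psi : R -> R).

(* Functions from (0, +oo) to (0, +oo) are represented by functions R -> R,
   of which only the values on (0, +oo) matter. *)

Definition approx_set alpha psi : set (circle R) :=
  [set b | \forall T \near +oo, exists q : int,
     `|q|%:~R <= T /\ circle_norm (to_circle (q%:~R * alpha) - b) <= psi T].

Definition lower_quasimultiplicative psi : Prop :=
  exists tau R0 : R, [/\ 0 < tau, 1 < R0 &
    \forall T \near +oo, forall r, R0 <= r -> r `^ (- tau) * psi T <= psi (r * T)].

Definition rescale c psi : R -> R := fun T => c * psi (T / c).

Definition log_order psi : R -> \bar R := fun T => (ln (psi T)^-1 / ln T)%:E.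

End Approximation.

Definition increasing_enumeration (S : set nat) (kappa : nat -> nat) : Prop :=
  {homo kappa : i j / (i < j)%N} /\ range kappa = S.

Lemma ratio_bijective (R : realType) (psi : R -> R)
  (psi_gt0 : forall T : R, 0 < T -> 0 < psi T)
  (psi_cont : forall T : R, 0 < T -> {for T, continuous psi})
  (psi_decr : forall S T : R, 0 < S -> S < T -> psi T < psi S)
  (psi_cvg0 : psi T @[T --> +oo] --> 0)
  (psi_norm : psi T @[T --> 0^'+] --> +oo) (z : R) : 0 < z ->
  exists! y : R, 0 < y /\ y / psi y = z.
Proof.
move=> z0.
have inc s t : 0 < s -> s < t -> s / psi s < t / psi t.
  move=> s0 st; have t0 := lt_trans s0 st.
  rewrite ltr_pdivrMr ?psi_gt0// mulrAC ltr_pdivlMr ?psi_gt0//.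
  by apply: ltr_pM => //; rewrite ?ltW ?psi_gt0 ?psi_decr.
have pn1 : \forall a \near 0^'+, 1 < psi a by exact: (cvgryPgt psi).1 psi_norm 1.
have p01 : \forall b \near +oo, psi b < 1 by apply: (cvgr_lt _ psi_cvg0); exact: ltr01.
have [a [a0 az pa]] : exists a, [/\ 0 < a, a < z & 1 < psi a].
  have : \forall a \near 0^'+, [/\ 0 < a, a < z & 1 < psi a].
    near=> a; split; near: a.
    - exact: nbhs_right_gt.
    - exact: nbhs_right_lt.
    - exact: pn1.
  by move/filter_ex.
have [b [b0 bz pb]] : exists b, [/\ a < b, z < b & psi b < 1].
  have : \forall b \near +oo, [/\ a < b, z < b & psi b < 1].
    near=> b; split; near: b.
    - by apply: nbhs_pinfty_gt; exact: num_real.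
    - by apply: nbhs_pinfty_gt; exact: num_real.
    - exact: p01.
  by move/filter_ex.
have [y yab yz] : exists2 y, y \in `[a, b] & y / psi y = z.
  apply: (@IVT R (fun y => y / psi y)) => //; first exact: ltW.
    apply: continuous_in_subspaceT => x /set_mem /=.
    rewrite in_itv /= => /andP[ax _]; have x0 := lt_le_trans a0 ax.
    apply: cvgM => //; apply: cvgV; last exact: psi_cont.
    by rewrite gt_eqF ?psi_gt0.
  rewrite ge_min le_max; apply/andP; split.
    by rewrite ler_pdivrMr ?psi_gt0// ltW// (lt_trans az)// ltr_pMr.
  have b0' : 0 < b by exact: lt_trans b0.
  by rewrite orbC ler_pdivlMr ?psi_gt0// ltW// (lt_trans _ bz)// gtr_pMr.
exists y; split.
  by split=> //; rewrite (lt_le_trans a0)//; move: yab; rewrite in_itv /= => /andP[].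
move=> y' [y'0 y'z].
have y0 : 0 < y by rewrite (lt_le_trans a0)//; move: yab; rewrite in_itv /= => /andP[].
have [yy'|y'y|//] := ltgtP y y'.
  by have := inc _ _ y0 yy'; rewrite yz y'z ltxx.
by have := inc _ _ y'0 y'y; rewrite yz y'z ltxx.
Unshelve. all: by end_near.
Qed.

(* Main.v *)
(* Call an index k relevant if it belongs to the sequence k_i of the theorem.
   The scale Y_k is the T at which the length T d_k/q_k of a cluster
   {(n + m q_k) alpha : |m q_k| <= T} equals psi T, and there the union of the
   balls B(n alpha, psi T), |n| <= T, is thinnest.
   If T psi T -> oo, the points n alpha with |n| <= Y_k lie within psi (Y_k) of
   the grid (1/q_k)Z; up to constants, D_alpha(psi) is the set of points that are
   psi (Y_k)-close to this grid for all large relevant k.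
   If T psi T -> 0, a point approximated at scale q_k by n alpha is approximated
   at scale q_{k+1} by (n + m q_k) alpha with |m| d_k <= C psi (Y_k), and m = 0
   unless k is relevant; up to constants, D_alpha(psi) is the set of the sums of
   m_k q_k alpha over the relevant k.
   Both sets are homogeneous Cantor sets: counting gives the upper bound, and the
   inverse of a map onto [0, 1) by mixed-radix digits, which is Hoelder, the lower
   one.  The q_k of the relevant k grow superexponentially, so constants, in
   particular a factor c on psi, do not change the dimension. *)

Require Import Defs.
From mathcomp Require Import all_boot all_order all_algebra.
From mathcomp Require Import all_classical all_reals all_analysis.
From mathcomp Require Import zify ring lra.
Set Implicit Arguments.
Unset Strict Implicit.
Unset Printing Implicit Defensive.

Import Order.TTheory GRing.Theory Num.Theory.
Import numFieldNormedType.Exports.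
Local Open Scope classical_set_scope.
Local Open Scope ring_scope.

(** * Hausdorff dimension *)

Section HausdorffDimension.
Context {R : realType} {T : metricType R}.
Implicit Types (A B U : set T) (s : R).

(** Constants shape the proof. A level of either Cantor set costs a fixed factor K, so n relevant
    indices cost K^n; this is traded for psi (Y_k)^eta at the n-th relevant k, with eta > 0
    arbitrarily small, and therefore every bound is proved for exponents strictly on one side of the
    liminf. The trade is available along relevant indices only. When T psi T -> 0 the cover has to
    pass through all indices, and their q_k may grow only exponentially; there the constant of a
    step is absorbed by (q_{k+1}/q_k)^eta, and these factors telescope. The liminf appears because
    an upper bound needs an economical cover at infinitely many levels only, while a Hoelder inverse
    needs enough cylinders at every level. Both formulas are proved for D_alpha(c psi) with the
    relevant indices and the scales Y_k of psi itself. Their right-hand sides are free of c, which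
    yields the invariance for c psi; the function c psi(T/c) lies between two multiples of psi by
    lower quasimultiplicativity. *)

Lemma le_diam U x y : U x -> U y -> ((mdist x y)%:E <= diam U)%E.
Proof. by move=> Ux Uy; apply: ereal_sup_ubound; exists x, y. Qed.

Lemma diam_ge0 U : U !=set0 -> (0 <= diam U)%E.
Proof. by move=> [x Ux]; apply: le_trans (le_diam Ux Ux); rewrite lee_fin mdist_ge0. Qed.

Lemma diam_pow_ge0 s U : (0 <= diam_pow s U)%E.
Proof. by rewrite /diam_pow; case: ifP => // _; exact: poweR_ge0. Qed.

Lemma diam_le U (r : R) : (forall x y, U x -> U y -> mdist x y <= r) ->
  (diam U <= r%:E)%E.
Proof. by move=> h; apply: ge_ereal_sup => _ [x [y [Ux Uy ->]]]; rewrite lee_fin h. Qed.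

Lemma diam_pow_le s U (r : R) : 0 <= s -> 0 <= r -> (diam U <= r%:E)%E ->
  (diam_pow s U <= (r `^ s)%:E)%E.
Proof.
move=> s0 r0 dU; rewrite /diam_pow; case: ifPn => [_|/set0P U0].
  by rewrite lee_fin powR_ge0.
rewrite -poweR_EFin gt0_ler_poweR //.
- by rewrite in_itv /= diam_ge0 //= leey.
- by rewrite in_itv /= lee_fin r0 leey.
Qed.

Lemma hausdorff_dim_mono A B : A `<=` B ->
  (hausdorff_dim A <= hausdorff_dim B)%E.
Proof.
have mon s : A `<=` B -> (hausdorff_measure s A <= hausdorff_measure s B)%E.
  move=> AB; apply: ge_ereal_sup => _ [e e0 <-].
  apply: (@le_trans _ _ (hausdorff_premeasure s e B)).
    apply: le_ereal_inf => _ [U [BU dU] <-].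
    by exists U => //; split=> //; exact: subset_trans BU.
  by apply: ereal_sup_ubound; exists e.
have ge0 s B' : (0 <= hausdorff_measure s B')%E.
  apply: (@le_trans _ _ (hausdorff_premeasure s 1 B')).
    apply: le_ereal_inf_tmp => _ [U _ <-].
    by apply: nneseries_ge0 => *; exact: diam_pow_ge0.
  by apply: ereal_sup_ubound; exists 1 => //=.
move=> AB; apply: le_ereal_inf => _ [s [s0 sB] <-].
exists s => //; split=> //; apply/eqP; rewrite eq_le ge0 andbT -sB.
exact: mon.
Qed.

Lemma hausdorff_dim_ge0 A : (0 <= hausdorff_dim A)%E.
Proof. by apply: le_ereal_inf_tmp => _ [s [s0 _] <-]; rewrite lee_fin. Qed.

Lemma hausdorff_dim_le A s : 0 <= s ->
  (forall e : R, 0 < e -> exists U : nat -> set T,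
     [/\ A `<=` \bigcup_i U i, forall i, (diam (U i) <= e%:E)%E &
         (\sum_(i <oo) diam_pow s (U i) <= e%:E)%E]) ->
  (hausdorff_dim A <= s%:E)%E.
Proof.
move=> s0 h; apply: ereal_inf_lbound; exists s => //; split=> //.
apply/eqP; rewrite eq_le; apply/andP; split; last first.
  apply: (@le_trans _ _ (hausdorff_premeasure s 1 A)).
    apply: le_ereal_inf_tmp => _ [U _ <-].
    by apply: nneseries_ge0 => *; exact: diam_pow_ge0.
  by apply: ereal_sup_ubound; exists 1 => //=.
apply: ge_ereal_sup => _ [e e0 <-]; apply/lee_addgt0Pr => e' e'0.
rewrite add0e; have m0 : 0 < Num.min e e' by rewrite lt_min e'0 andbT.
have [U [AU dU sU]] := h _ m0.
apply: (@le_trans _ _ (\sum_(i <oo) diam_pow s (U i))%E).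
  apply: ereal_inf_lbound; exists U => //; split=> // i.
  by rewrite (le_trans (dU i))// lee_fin ge_min lexx.
by rewrite (le_trans sU)// lee_fin ge_min lexx orbT.
Qed.

(** Countable stability is built into the criterion: the n-th set is covered at cost [en n], and the
    balls of all the covers are enumerated through a bijection of the naturals with their square. It
    fits approximation sets, which are unions over N of the sets where the approximation holds from
    N on. *)
Lemma hausdorff_dim_bigcup_le (x0 : T) (A : nat -> set T) s : 0 < s ->
  (forall n (e : R), 0 < e -> exists (L : seq T) (r : R),
     [/\ 0 <= r <= e, (size L)%:R * (2 * r) `^ s <= e &
         forall b, A n b -> exists2 x, x \in L & mdist b x <= r]) ->
  (hausdorff_dim (\bigcup_n A n) <= s%:E)%E.
Proof.
move=> s0 h; apply: hausdorff_dim_le; first exact: ltW.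
(* The factor 1/2 keeps the diameters 2 r n below e; the powers of 2 make the costs summable. *)
move=> e e0; pose en n := e / 2 / (2 ^ n.+1)%:R.
have en0 n : 0 < en n by rewrite !divr_gt0// ltr0n expn_gt0.
have ene n : en n <= e / 2.
  rewrite ler_pdivrMr ?ltr0n ?expn_gt0//; apply: ler_peMr; first by lra.
  by rewrite ler1n expn_gt0.
have /choice[L /choice[r Lr]] := fun n => h n _ (en0 n).
pose V n p := if (p < size (L n))%N
  then [set b | mdist b (nth x0 (L n) p) <= r n] else set0.
have r0 n : 0 <= r n by have [/andP[]] := Lr n.
have dV n p : (diam (V n p) <= (2 * r n)%:E)%E.
  apply: diam_le => x y; rewrite /V; case: ifP => // _ /= xr yr.
  apply: le_trans (metric_triangle _ (nth x0 (L n) p) _) _.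
  by move: xr yr; rewrite (metric_sym y); lra.
have sV n : (\sum_(p <oo) diam_pow s (V n p) <= (en n)%:E)%E.
  apply: lime_le.
    by apply: is_cvg_nneseries => *; exact: diam_pow_ge0.
  apply: nearW => N.
  have [_ Ln _] := Lr n.
  apply: le_trans (_ : ((size (L n))%:R * (2 * r n) `^ s)%:E <= _)%E; last first.
    by rewrite lee_fin.
  apply: (@le_trans _ _ (\sum_(0 <= p < N | (p < size (L n))%N) ((2 * r n) `^ s)%:E)%E).
    rewrite [leRHS]big_mkcond /=; apply: lee_sum => p _.
    case: ifPn => pL; last by rewrite /V (negPf pL) /diam_pow eqxx.
    by apply: diam_pow_le; [exact: ltW|have := r0 n; lra|exact: dV].
  rewrite sumEFin lee_fin big_const_seq iter_addr_0 -[leLHS]mulr_natl.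
  apply: ler_wpM2r; first exact: powR_ge0.
  rewrite ler_nat -size_filter -[leqRHS](size_iota 0 (size (L n))).
  apply: uniq_leq_size; first by rewrite filter_uniq// iota_uniq.
  by move=> p; rewrite mem_filter mem_iota /= add0n => /andP[->].
have /ppcard_eqP[f] : ([set: nat] #= [set: nat * nat])%card.
  by rewrite card_eq_sym; exact: card_nat2.
exists (fun i => V (f i).1 (f i).2); split.
- move=> b [n _ Anb]; have [_ _ /(_ b Anb)[x xL bx]] := Lr n.
  have [i _ fi] := @surj _ _ _ _ f (n, index x (L n)) I.
  exists i => //; rewrite fi /V /= index_mem xL /=.
  by rewrite nth_index.
- move=> i; apply: (le_trans (dV _ _)); rewrite lee_fin.
  have [/andP[_ re] _ _] := Lr (f i).1.
  have := ene (f i).1; lra.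
- rewrite nneseries_esumT; last by move=> *; exact: diam_pow_ge0.
  rewrite -(reindex_esum [set: nat] [set: nat * nat] f (fun k => diam_pow s (V k.1 k.2))); last first.
    have := @bijTT _ _ f.
    by rewrite -setTT_bijective/= -[in X in set_bij _ X _ -> _](@setXTT nat nat).
  rewrite (_ : [set: nat * nat] = setT `*`` (fun=> setT)); last by apply/seteqP; split.
  rewrite -(@esum_esum _ _ _ _ _ (fun i j => diam_pow s (V i j))); last first.
    by move=> *; exact: diam_pow_ge0.
  rewrite -nneseries_esumT; last first.
    by move=> n; apply: esum_ge0 => *; exact: diam_pow_ge0.
  apply: (@le_trans _ _ (\sum_(n <oo) (en n)%:E)%E).
    apply: lee_nneseries => [n _ _|n _].
      by apply: esum_ge0 => *; exact: diam_pow_ge0.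
    by rewrite -nneseries_esumT// => *; exact: diam_pow_ge0.
  apply: (le_trans (epsilon_trick0 _ _)); first by lra.
  by rewrite lee_fin; lra.
Qed.

(* A cover of the image of G pulls back to a cover of [0, 1) by sets whose
   lengths are at most C times the corresponding powers of the diameters. *)
Lemma hausdorff_dim_ge_holder A s (C : R) (G : R -> T) : 0 < s ->
  (forall t : R, 0 <= t < 1 -> A (G t)) ->
  (forall t u : R, 0 <= t < 1 -> 0 <= u < 1 -> mdist (G t) (G u) <= 1) ->
  (forall t u : R, 0 <= t < 1 -> 0 <= u < 1 ->
     `|t - u| <= C * mdist (G t) (G u) `^ s) ->
  (s%:E <= hausdorff_dim A)%E.
Proof.
move=> s0 GA G1 GC; apply: le_ereal_inf_tmp => _ [s' [s'0 Hs'] <-].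
rewrite lee_fin leNgt; apply/negP => s's.
have C0 : 0 < C.
  have := GC 0 (1/2); rewrite !lexx ltr01 /= => /(_ isT) h.
  have {h}: `|0 - 1/2| <= C * mdist (G 0) (G (1/2)) `^ s by apply: h; lra.
  rewrite sub0r normrN ger0_norm; last by lra.
  have p0 := powR_ge0 (mdist (G 0) (G (1/2))) s.
  by move=> h; rewrite ltNge; apply/negP => Cle; nra.
(* Distances are at most 1, so the exponent may be lowered from s to s'. *)
have GC' (t u : R) : 0 <= t < 1 -> 0 <= u < 1 ->
    `|t - u| <= C * mdist (G t) (G u) `^ s'.
  move=> t1 u1; apply: (le_trans (GC _ _ t1 u1)); rewrite ler_pM2l//.
  have [->|n0] := eqVneq (mdist (G t) (G u)) 0.
    by rewrite powR0 ?gt_eqF// powR_ge0.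
  by rewrite ger_powR ?(ltW s's)// lt_neqAle eq_sym n0 mdist_ge0 G1.
have pre_ge (U : nat -> set T) : A `<=` \bigcup_i U i ->
    (C^-1%:E <= \sum_(i <oo) diam_pow s' (U i))%E.
  move=> AU.
  (* The preimage of [U i] under G need not be measurable; it is replaced by the interval from its
     infimum to its supremum. A set of infinite weight gets the whole line. *)
  have HV i : exists V : set R, [/\ measurable V,
      (forall t : R, 0 <= t < 1 -> U i (G t) -> V t) &
      (lebesgue_measure V <= C%:E * diam_pow s' (U i))%E].
    pose P := [set t : R | 0 <= t < 1 /\ U i (G t)].
    have [P0|/set0P [t0 [t01 Ut0]]] := eqVneq P set0.
      exists set0; split=> //.
      - move=> t t1 Ut; suff : P t by rewrite P0.
        by split.
      - by rewrite measure0 mule_ge0 ?diam_pow_ge0// lee_fin ltW.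
    have U0 : (U i != set0) by apply/set0P; exists (G t0).
    have [dfin|dinf] := boolP (diam_pow s' (U i) \is a fin_num); last first.
      exists setT; split=> //; rewrite (_ : diam_pow s' (U i) = +oo%E).
        by rewrite gt0_muley ?lte_fin// leey.
      move: dinf; rewrite ge0_fin_numE ?diam_pow_ge0//.
      by rewrite ltey negbK => /eqP.
    set D := fine (diam_pow s' (U i)).
    have tu t u : P t -> P u -> `|t - u| <= C * D.
      move=> [t1 Ut] [u1 Uu]; apply: (le_trans (GC' _ _ t1 u1)).
      rewrite ler_pM2l// -lee_fin fineK// -poweR_EFin /diam_pow (negPf U0).
      rewrite gt0_ler_poweR //.
      - by rewrite in_itv /= lee_fin mdist_ge0 leey.
      - by rewrite in_itv /= leey andbT diam_ge0//; exists (G t0).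
      - exact: le_diam.
    have Pt0 : P t0 by split.
    have hs : has_sup P.
      by split; [exists t0 | exists 1 => t [/andP[_ /ltW le1 _]]].
    have hi : has_inf P.
      by split; [exists t0 | exists 0 => t [/andP[ge0 _] _]].
    exists `[inf P, sup P]%classic; split.
    - exact: measurable_itv.
    - move=> t t1 Ut; have Pt : P t by split.
      rewrite /= in_itv /=; apply/andP; split.
        by apply: ge_inf => //; exact: hi.2.
      by apply: ub_le_sup => //; exact: hs.2.
    - rewrite lebesgue_measure_itv /= -(fineK dfin) -/D -EFinM.
      case: ifP => _; last first.
        rewrite lee_fin; apply: le_trans (tu t0 t0 Pt0 Pt0).
        exact: normr_ge0.
      rewrite -EFinB lee_fin lerBlDr; apply: ge_sup; first by exists t0.
      move=> t Pt; rewrite -lerBlDl.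
      apply: lb_le_inf; first by exists t0.
      move=> u Pu; rewrite lerBlDr; have := tu _ _ Pt Pu.
      by have := ler_norm (t - u); lra.
  have /choice[V VP] := HV.
  have: (lebesgue_measure (`[0%R, 1%R[%classic : set R) <=
       \sum_(i <oo) lebesgue_measure (V i))%E.
    apply: measure_sigma_subadditive => //.
      by move=> i; have [] := VP i.
    move=> t /=; rewrite in_itv /= => t1.
    have [i _ Ui] := AU _ (GA _ t1); exists i => //.
    by have [_ + _] := VP i; exact.
  rewrite lebesgue_measure_itv /= lte_fin ltr01 sube0 => h1.
  have {h1} : (1%:E <= C%:E * \sum_(i <oo) diam_pow s' (U i))%E.
    apply: (le_trans h1); rewrite -nneseriesZl; last first.
      by move=> *; exact: diam_pow_ge0.
    by apply: lee_nneseries => // i _; have [] := VP i.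
  by rewrite -lee_pdivrMl// mule1.
have : (C^-1%:E <= hausdorff_measure s' A)%E.
  apply: (@le_trans _ _ (hausdorff_premeasure s' 1 A)).
    by apply: le_ereal_inf_tmp => _ [U [AU _] <-]; exact: pre_ge.
  by apply: ereal_sup_ubound; exists 1 => //=.
by rewrite Hs' lee_fin leNgt invr_gt0 C0.
Qed.

End HausdorffDimension.

(** * The circle *)

Section Circle.
Context {R : realType}.
Implicit Types x y : R.

Lemma dist_int_small (x : R) (m : int) : `|x - m%:~R| <= 1 / 2 -> dist_int x = `|x - m%:~R|.
Proof.
move=> h; have [n xn] := dist_int_attained x.
have [<-//|nm] := eqVneq n m.
have le := dist_int_le x m.
apply/eqP; rewrite eq_le le /= xn.
have : 1 <= `|(n - m)%:~R : R|.
  by rewrite -intr_norm ler1z; lia.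
have -> : (n - m)%:~R = (x - m%:~R) - (x - n%:~R) :> R by rewrite intrB; ring.
have := ler_normB (x - m%:~R) (x - n%:~R); lra.
Qed.

Lemma circle_norm_small (x : R) : `|x| <= 1 / 2 -> circle_norm (to_circle x) = `|x|.
Proof.
by move=> x2; rewrite circle_norm_pi (dist_int_small (m := 0)) subr0.
Qed.

Lemma to_circleB (x y : R) : to_circle (x - y) = to_circle x - to_circle y.
Proof. by rewrite /to_circle !piE. Qed.

Lemma mdist_to_circle_le x y : mdist (to_circle x) (to_circle y) <= `|x - y|.
Proof.
rewrite circle_mdistE -to_circleB circle_norm_pi.
by have := dist_int_le (x - y) 0; rewrite subr0.
Qed.

Lemma to_circle_int (n : int) : to_circle (n%:~R : R) = 0.
Proof. by apply: circle_norm_eq0; rewrite circle_norm_pi -[n%:~R]add0r dist_int_intD dist_int0. Qed.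

Lemma to_circle_surj (b : circle R) : exists2 x, 0 <= x < 1 & to_circle x = b.
Proof.
exists (repr b - (Num.floor (repr b))%:~R).
  have := floor_le (repr b); have := floorD1_gt (repr b); rewrite intrD.
  by move=> h1 h2; apply/andP; split; lra.
by rewrite to_circleB to_circle_int subr0 /to_circle reprK.
Qed.

End Circle.

(** * Counting integers and branches of trees *)

Section IntegerTrees.
Context {R : realType}.

Lemma near_ints (x r : R) : 0 <= r -> exists L : seq int,
  (size L)%:R <= 2 * r + 1 /\ forall z : int, `|z%:~R - x| <= r -> z \in L.
Proof.
move=> r0; pose a := Num.ceil (x - r); pose f := Num.floor (2 * r).
have f0 : 0 <= f by rewrite floor_ge_int /=; lra.
have fle : f%:~R <= 2 * r := floor_le _.
exists [seq a + i%:Z | i <- iota 0 `|f|.+1]; split.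
  rewrite size_map size_iota -natr1 lerD2r.
  by rewrite -[_%:R]/((`|f|%N%:Z)%:~R) gez0_abs.
move=> z; rewrite ler_norml => /andP[zl zu].
have az : a <= z by rewrite /a ceil_le_int; lra.
have xa : x - r <= a%:~R := ceil_ge _.
have zf : z - a <= f by rewrite /f floor_ge_int intrB; lra.
apply/mapP; exists `|z - a|%N; first by rewrite mem_iota; lia.
by rewrite gez0_abs; lia.
Qed.

Variables (children : nat -> int -> seq int) (L0 : seq int).

(** Repetitions are kept: only a bound for the length and the presence of every admissible branch
    matter. *)
Fixpoint tree (n : nat) : seq int :=
  if n is j.+1 then flatten [seq children j u | u <- tree j] else L0.

Lemma size_tree (B : nat -> R) n :
  (forall n u, (size (children n u))%:R <= B n) ->
  (size (tree n))%:R <= (size L0)%:R * \prod_(j < n) B j.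
Proof.
move=> hB; elim: n => [|n IH] /=; first by rewrite big_ord0 mulr1.
rewrite big_ord_recr /= mulrA.
have B0 : 0 <= B n by apply: le_trans (hB n 0).
apply: (@le_trans _ _ ((size (tree n))%:R * B n)); last by rewrite ler_wpM2r.
elim: (tree n) => [|u l IHl] /=; first by rewrite mul0r.
by rewrite size_cat natrD -natr1 mulrDl mul1r addrC lerD.
Qed.

Lemma mem_tree (v : nat -> int) n : v 0%N \in L0 ->
  (forall n, v n.+1 \in children n (v n)) -> v n \in tree n.
Proof.
move=> v0 vS; elim: n => //= n IH; apply/flattenP.
by exists (children n (v n)) => //; apply: map_f.
Qed.

End IntegerTrees.

(** * The whole circle has dimension one *)

Section FullDimension.
Context {R : realType}.

(** The parametrization is by t/2 because on [0, 1/2) the circle distance is the absolute value of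
    the difference. *)
Lemma hausdorff_dim_full (A : set (circle R)) (s : R) : 0 < s -> s <= 1 ->
  (forall x, A (to_circle x)) -> (s%:E <= hausdorff_dim A)%E.
Proof.
move=> s0 s1 HA.
have dE (t u : R) : 0 <= t < 1 -> 0 <= u < 1 ->
    mdist (to_circle (t / 2)) (to_circle (u / 2)) = `|t / 2 - u / 2|.
  move=> /andP[? ?] /andP[? ?]; rewrite circle_mdistE -to_circleB circle_norm_small//.
  by rewrite ler_norml; apply/andP; split; lra.
have d1 (t u : R) : 0 <= t < 1 -> 0 <= u < 1 -> `|t / 2 - u / 2| <= 1.
  by move=> /andP[? ?] /andP[? ?]; rewrite ler_norml; apply/andP; split; lra.
apply: (@hausdorff_dim_ge_holder _ _ A s 2 (fun t => to_circle (t / 2))) => //.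
- by move=> t u t1 u1; rewrite dE// d1.
- move=> t u t1 u1; rewrite dE//.
  have -> : `|t - u| = 2 * `|t / 2 - u / 2|.
    by rewrite -[X in X * _](@ger0_norm R 2)// -normrM; congr (`|_|); field.
  rewrite ler_pM2l//; have [->|n0] := eqVneq `|t / 2 - u / 2| 0.
    exact: powR_ge0.
  by apply: ger1_powR => //; rewrite d1// andbT lt_neqAle eq_sym n0 normr_ge0.
Qed.

Lemma hausdorff_dim_le1 (A : set (circle R)) : (hausdorff_dim A <= 1)%E.
Proof.
apply/lee_addgt0Pr => e e0; rewrite -EFinD.
have -> : A = \bigcup_(n : nat) A.
  by apply/seteqP; split=> [x Ax|x [n _ //]]; exists 0%N.
apply: (hausdorff_dim_bigcup_le (to_circle 0)) => [|_ e' e'0]; first by lra.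
(* At most 2 n points with radius 1/n cost 2 n (2/n)^(1+e) = B e' n^(-e), so n >= B^(1/e) is
   enough. *)
pose B : R := 2 * 2 `^ (1 + e) / e'.
have B0 : 0 < B by rewrite divr_gt0// mulr_gt0// powR_gt0.
pose n := (Num.bound (Num.max (B `^ e^-1) e'^-1)).+1.
have nB : Num.max (B `^ e^-1) e'^-1 <= n%:R.
  apply: (@le_trans _ _ (Num.bound (Num.max (B `^ e^-1) e'^-1))%:R); last by rewrite ler_nat.
  by apply/ltW/archi_boundP; rewrite le_max powR_ge0.
move: nB; rewrite ge_max => /andP[nB ne].
have n1 : 1 <= n%:R :> R by rewrite ler1n.
have n0 : 0 < n%:R :> R by rewrite ltr0n.
have [L [Ls Lm]] := @near_ints R (n%:R / 2) (n%:R / 2) (divr_ge0 (ltW n0) (ler0n _ _)).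
exists [seq to_circle (p%:~R / n%:R) | p <- L], n%:R^-1; split.
- rewrite invr_ge0 ler0n /= -[e']invrK lef_pV2 ?posrE ?invr_gt0//.
- rewrite size_map powRM ?invr_ge0//.
  have pD : n%:R^-1 `^ (1 + e) = n%:R^-1 * n%:R^-1 `^ e.
    rewrite powRD ?powRr1 ?invr_ge0//; apply/implyP => _.
    by rewrite invr_eq0 gt_eqF.
  have Bn : B <= n%:R `^ e.
    have -> : B = (B `^ e^-1) `^ e by rewrite -powRrM mulVf ?powRr1 ?(ltW B0)// gt_eqF.
    by apply: ge0_ler_powR; rewrite ?nnegrE ?powR_ge0 ?(ltW e0).
  have nn : n%:R^-1 `^ e * n%:R `^ e = 1.
    by rewrite -powRM ?invr_ge0// mulVf ?powR1// gt_eqF.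
  rewrite pD; set V := n%:R^-1 `^ e in nn *; have V0 : 0 < V by rewrite powR_gt0 ?invr_gt0.
  have VB : V * B <= 1 by rewrite -nn ler_pM2l.
  have sn : (size L)%:R / n%:R <= 2 :> R by rewrite ler_pdivrMr//; lra.
  rewrite [leLHS](_ : _ = (size L)%:R / n%:R * (2 `^ (1 + e) * V)); last by ring.
  apply: (@le_trans _ _ (2 * (2 `^ (1 + e) * V))).
    by rewrite ler_wpM2r// mulr_ge0 ?powR_ge0 ?(ltW V0).
  have : V * (2 * 2 `^ (1 + e)) <= e'.
    by rewrite -[leRHS]mul1r -ler_pdivrMr// -[leLHS]mulrA.
  lra.
- move=> b _; have [x /andP[x0 x1] <-] := to_circle_surj b.
  have f1 := floor_le (x * n%:R); have f2 := floorD1_gt (x * n%:R).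
  rewrite intrD in f2.
  exists (to_circle ((Num.floor (x * n%:R))%:~R / n%:R)).
    apply: (map_f (fun p : int => to_circle (p%:~R / n%:R))); apply: Lm.
    have g1 : 0 <= (Num.floor (x * n%:R))%:~R :> R by rewrite ler0z floor_ge_int mulr_ge0.
    have g2 : x * n%:R <= n%:R by rewrite ler_piMl// ltW.
    by rewrite ler_norml; apply/andP; split; lra.
  apply: (le_trans (mdist_to_circle_le _ _)).
  rewrite (_ : x - _ = (x * n%:R - (Num.floor (x * n%:R))%:~R) / n%:R); last first.
    by field; rewrite gt_eqF.
  rewrite normrM normfV (gtr0_norm n0) -[leRHS]mul1r ler_pM2r ?invr_gt0//.
  by rewrite ler_norml; apply/andP; split; lra.
Qed.

End FullDimension.

Section Halving.
Context {R : realType}.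

Lemma half_cvg0 (u : nat -> R) (N : nat) (e : R) : 0 < e ->
  (forall n, (N <= n)%N -> u n.+1 <= u n / 2) -> 
  exists M, forall n, (M <= n)%N -> u n <= e.
Proof.
move=> e0 hu.
have hk k : u (N + k)%N <= u N / 2 ^+ k.
  elim: k => [|k IH]; first by rewrite addn0 expr0 divr1.
  rewrite addnS (le_trans (hu _ (leq_addr _ _)))// exprSr invfM mulrA.
  by rewrite ler_pM2r ?invr_gt0.
have [K hK] : exists K : nat, u N / e <= K%:R.
  exists (Num.bound `|u N / e|); apply/ltW; apply: le_lt_trans (ler_norm _) _.
  by apply: archi_boundP; exact: normr_ge0.
exists (N + K)%N => n Kn; rewrite -(subnKC (leq_trans (leq_addr K N) Kn)).
apply: (le_trans (hk _)); rewrite ler_pdivrMr ?exprn_gt0//.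
have Kk : (K <= n - N)%N by rewrite leq_subRL ?(leq_trans (leq_addr K N) Kn).
have : (K%:R : R) <= 2 ^+ (n - N).
  rewrite -natrX ler_nat; apply: leq_trans (_ : (2 ^ K <= _)%N); last by rewrite leq_pexp2l.
  by apply: ltnW; exact: ltn_expl.
move=> h2; rewrite mulrC -ler_pdivrMr//; exact: le_trans h2.
Qed.

End Halving.

(** * Continued fractions *)

Section ContinuedFraction.
Context {R : realType} (alpha : R).
Hypothesis alpha_irr : irrational alpha.

Local Notation cq := (cf_complete_quotient alpha).
Local Notation a := (cf_coef alpha).
Local Notation q := (cf_denom alpha).

(** The numerators p_k; the value 1 in the recursion is p_(-1). *)
Fixpoint cf_num (k : nat) : int :=
  if k is j.+1
  then a k * cf_num j + (if j is i.+1 then cf_num i else 1)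
  else a 0%N.

(* |q_k alpha - p_k|, by the product formula with the complete quotients. *)
Definition cf_error (k : nat) : R := \prod_(j < k.+1) (cq j.+1)^-1.

Local Notation p := cf_num.
Local Notation theta := cf_error.

Lemma cf_complete_quotient_irrational k : irrational (cq k).
Proof.
elim: k => [|k IH] //=.
rewrite /irrational /rational /= => -[r _ h]; apply: IH.
exists (r^-1 + (Num.floor (cq k))%:~R) => //.
by rewrite (rmorphD (@ratr R)) /= (fmorphV (@ratr R)) ratr_int /= h invrK subrK.
Qed.

Lemma cf_fracpart_gt0 k : 0 < cq k - (Num.floor (cq k))%:~R < 1.
Proof.
apply/andP; split; last first.
  by rewrite ltrBlDl -[X in _ < _ + X]/(1%:~R) -intrD floorD1_gt.
rewrite subr_gt0 lt_neqAle floor_le andbT; apply/eqP => h.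
apply: (cf_complete_quotient_irrational (k := k)).
by exists (Num.floor (cq k))%:~R => //; rewrite ratr_int.
Qed.

Lemma cf_complete_quotient_gt1 k : 1 < cq k.+1.
Proof. by have /andP[h0 h1] := cf_fracpart_gt0 k; rewrite /= invf_gt1. Qed.

Lemma cf_coef_ge1 k : 1 <= a k.+1.
Proof. by rewrite /cf_coef floor_ge_int (ltW (cf_complete_quotient_gt1 k)). Qed.

Lemma cf_complete_quotientE k : cq k = (a k)%:~R + (cq k.+1)^-1.
Proof. by rewrite /= invrK addrC subrK. Qed.

Lemma cf_error_gt0 k : 0 < theta k.
Proof.
apply: prodr_gt0 => i _; rewrite invr_gt0.
exact: lt_trans (cf_complete_quotient_gt1 _).
Qed.

Lemma cf_errorS k : theta k.+1 = theta k / cq k.+2.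
Proof. by rewrite /cf_error big_ord_recr. Qed.

Lemma cf_error0 : theta 0 = (cq 1)^-1.
Proof. by rewrite /cf_error big_ord_recl big_ord0 mulr1. Qed.

Lemma cf_error_rec k : theta k = (a k.+2)%:~R * theta k.+1 + theta k.+2.
Proof.
rewrite (cf_errorS k.+1) mulrC -mulrDr -cf_complete_quotientE cf_errorS mulfVK//.
by rewrite gt_eqF// (lt_trans _ (cf_complete_quotient_gt1 _)).
Qed.

Lemma cf_error_lt k : theta k.+1 < theta k.
Proof.
rewrite cf_errorS ltr_pdivrMr; last by rewrite (lt_trans _ (cf_complete_quotient_gt1 _)).
by rewrite ltr_pMr ?cf_error_gt0// cf_complete_quotient_gt1.
Qed.

Lemma cf_denomSS k : q k.+2 = a k.+2 * q k.+1 + q k.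
Proof. by []. Qed.

Lemma cf_numSS k : p k.+2 = a k.+2 * p k.+1 + p k.
Proof. by []. Qed.

Lemma cf_denom1 : q 1 = a 1%N.
Proof. by rewrite /= mulr1 addr0. Qed.

Lemma cf_denom_gt0 k : 0 < q k.
Proof.
suff : 0 < q k /\ 0 < q k.+1 by case.
elim: k => [|k [IH0 IH1]]; split=> //.
  by rewrite cf_denom1 (lt_le_trans _ (cf_coef_ge1 0)).
rewrite cf_denomSS addr_gt0// mulr_gt0// (lt_le_trans _ (cf_coef_ge1 _))//.
Qed.

Lemma cf_denom_le k : q k <= q k.+1.
Proof.
case: k => [|k]; first by rewrite cf_denom1 cf_coef_ge1.
rewrite cf_denomSS; have := cf_denom_gt0 k; have := cf_denom_gt0 k.+1.
by have := cf_coef_ge1 k.+1; nia.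
Qed.

(** Strictness starts at index 1, since q_1 = a_1 may equal q_0 = 1. *)
Lemma cf_denom_lt k : q k.+1 < q k.+2.
Proof.
rewrite cf_denomSS; have := cf_denom_gt0 k; have := cf_denom_gt0 k.+1.
by have := cf_coef_ge1 k.+1; nia.
Qed.

Lemma cf_denom_homo : {homo q : i j / (i <= j)%N >-> i <= j}.
Proof. by apply: homo_leq => //; [exact: le_trans | exact: cf_denom_le]. Qed.

Lemma cf_denom_ge k : (k%:Z <= q k).
Proof.
elim: k => [|[|k] IH] //; first by rewrite cf_denom1 cf_coef_ge1.
by have := cf_denom_lt k; lia.
Qed.

Lemma cf_errorE k : (q k)%:~R * alpha - (p k)%:~R = (-1) ^+ k * theta k.
Proof.
have e1 : 0 < cq 1 by exact: lt_trans (cf_complete_quotient_gt1 0).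
have aE : alpha - (a 0%N)%:~R = (cq 1)^-1.
  by apply/eqP; rewrite subr_eq addrC; apply/eqP; exact: (cf_complete_quotientE 0).
suff : (q k)%:~R * alpha - (p k)%:~R = (-1) ^+ k * theta k /\
  (q k.+1)%:~R * alpha - (p k.+1)%:~R = (-1) ^+ k.+1 * theta k.+1 by case.
elim: k => [|k [IH0 IH1]]; split=> //.
- by rewrite expr0 mul1r cf_error0 -aE -[(q 0)%:~R]/1 mul1r.
- rewrite cf_denom1 expr1 cf_errorS cf_error0 -[p 1]/(a 1%N * a 0%N + 1) intrD intrM.
  have -> : (cq 2)^-1 = cq 1 - (a 1%N)%:~R.
    by rewrite [cq 1]cf_complete_quotientE addrAC subrr add0r.
  transitivity ((a 1%N)%:~R * (alpha - (a 0%N)%:~R) - 1); first by ring.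
  by rewrite aE; field; rewrite gt_eqF.
- rewrite cf_denomSS cf_numSS !intrD !intrM.
  have -> : (-1) ^+ k.+2 * theta k.+2 = (a k.+2)%:~R * ((-1) ^+ k.+1 * theta k.+1) + (-1) ^+ k * theta k.
    by rewrite (cf_error_rec k) !exprS; ring.
  by rewrite -IH0 -IH1; ring.
Qed.

Lemma cf_denom_error k : (q k.+1)%:~R * theta k + (q k)%:~R * theta k.+1 = 1.
Proof.
elim: k => [|k IH].
  have e1 : 0 < cq 1 by exact: lt_trans (cf_complete_quotient_gt1 0).
  rewrite cf_denom1 cf_errorS cf_error0 mul1r -[(cq 1)^-1 / _]mulrC -mulrDl.
  by rewrite -cf_complete_quotientE mulfV// gt_eqF.
by rewrite -[RHS]IH (cf_error_rec k) cf_denomSS intrD intrM; ring.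
Qed.

(** Once theta_k is replaced by (-1)^k (q_k alpha - p_k) in [cf_denom_error], the terms in alpha
    cancel and the determinant remains. *)
Lemma cf_det k : p k.+1 * q k - p k * q k.+1 = (-1) ^+ k.
Proof.
have sE : ((-1) ^+ k)%:~R = (-1) ^+ k :> R by rewrite rmorphXn rmorphN1.
apply: (@intr_inj R); rewrite intrB !intrM sE.
have := cf_denom_error k.
have -> : theta k = (-1) ^+ k * ((q k)%:~R * alpha - (p k)%:~R).
  by rewrite cf_errorE mulrA -exprMn mulrNN mulr1 expr1n mul1r.
have -> : theta k.+1 = (-1) ^+ k.+1 * ((q k.+1)%:~R * alpha - (p k.+1)%:~R).
  by rewrite cf_errorE mulrA -exprMn mulrNN mulr1 expr1n mul1r.
have s2 : (-1) ^+ k * (-1) ^+ k = 1 :> R by rewrite -exprMn mulrNN mulr1 expr1n.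
rewrite exprS; move: s2; move: ((-1) ^+ k) (p k.+1)%:~R (p k)%:~R (q k.+1)%:~R (q k)%:~R.
move=> s P1 P0 Q1 Q0 s2 h.
by rewrite -[LHS]mul1r -s2 -[RHS]mulr1 -[X in _ = _ * X]h; ring.
Qed.

Lemma cf_error_ltV k : theta k < (q k.+1)%:~R^-1.
Proof.
have h := cf_denom_error k.
have q0 : 0 < (q k)%:~R :> R by rewrite ltr0z cf_denom_gt0.
have q1 : 0 < (q k.+1)%:~R :> R by rewrite ltr0z cf_denom_gt0.
rewrite -[_^-1]mul1r ltr_pdivlMr//.
by have := mulr_gt0 q0 (cf_error_gt0 k.+1); lra.
Qed.

Lemma cf_error_gtV k : ((q k.+1)%:~R + (q k)%:~R)^-1 < theta k.
Proof.
have h := cf_denom_error k.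
have q0 : 0 < (q k)%:~R :> R by rewrite ltr0z cf_denom_gt0.
have q1 : 0 < (q k.+1)%:~R :> R by rewrite ltr0z cf_denom_gt0.
rewrite -[_^-1]mul1r ltr_pdivrMr ?addr_gt0//.
have : (q k)%:~R * theta k.+1 < (q k)%:~R * theta k by rewrite ltr_pM2l ?cf_error_lt.
lra.
Qed.

(** Index 0 is excluded: the error there is the fractional part of alpha, which may exceed 1/2 and
    then differs from |q_0 alpha|_Z. *)
Lemma cf_error_half k : theta k.+1 < 1 / 2.
Proof.
apply: lt_le_trans (cf_error_ltV _) _.
rewrite div1r lef_pV2 ?posrE ?ltr0z ?cf_denom_gt0//.
rewrite -[2]/(2%:~R) ler_int.
by have := cf_denom_lt k; have := cf_denom_gt0 k.+1; lia.
Qed.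

Lemma dist_int_denom k : dist_int ((q k.+1)%:~R * alpha) = theta k.+1.
Proof.
have h : `|(q k.+1)%:~R * alpha - (p k.+1)%:~R| = theta k.+1.
  by rewrite cf_errorE normrM normrX normrN1 expr1n mul1r gtr0_norm ?cf_error_gt0.
by rewrite (@dist_int_small _ _ (p k.+1)) h// ltW// cf_error_half.
Qed.

(** In the unimodular basis (q_k, p_k), (q_{k+1}, p_{k+1}) the pair (n, m) has integer coordinates
    x, y. From 0 < |n| < q_{k+1} it follows that x is nonzero and that x and y do not have the same
    sign; as consecutive errors have opposite signs, the two contributions do not cancel and amount
    to at least [theta k]. *)
Lemma best_approximation k (n : int) : n != 0 -> `|n| < q k.+1 ->
  theta k <= dist_int (n%:~R * alpha).
Proof.
move=> n0 nq; have [m ->] := dist_int_attained (n%:~R * alpha).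
have D := cf_det k.
pose s : int := (-1) ^+ k.
have ss : s * s = 1 by rewrite /s -exprMn mulrNN mulr1 expr1n.
pose x := s * (n * p k.+1 - m * q k.+1).
pose y := s * (m * q k - n * p k).
have nE : n = x * q k + y * q k.+1.
  rewrite /x /y -[LHS]mul1r -ss; transitivity (s * n * (p k.+1 * q k - p k * q k.+1)).
    by rewrite D -/s; ring.
  by ring.
have mE : m = x * p k + y * p k.+1.
  rewrite /x /y -[LHS]mul1r -ss; transitivity (s * m * (p k.+1 * q k - p k * q k.+1)).
    by rewrite D -/s; ring.
  by ring.
have q0 := cf_denom_gt0 k; have q1 := cf_denom_gt0 k.+1.
have x0 : x != 0.
  apply/eqP => x0; move: nE; rewrite x0 mul0r add0r => nE.
  have y0 : y != 0 by apply: contraNneq n0 => y0; rewrite nE y0 mul0r.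
  move: nq; rewrite nE normrM (gtr0_norm q1) ltNge => /negP; apply.
  by rewrite -[leLHS]mul1r ler_pM2r//; lia.
have -> : n%:~R * alpha - m%:~R =
    (-1) ^+ k * (x%:~R * theta k - y%:~R * theta k.+1).
  rewrite {1}nE {1}mE !intrD !intrM.
  have := cf_errorE k; have := cf_errorE k.+1.
  rewrite exprS mulN1r mulNr => /(canRL (subrK _)) e1 /(canRL (subrK _)) e0.
  rewrite mulrDl -!mulrA e0 e1; ring.
rewrite normrM normrX normrN1 expr1n mul1r.
have t0 := cf_error_gt0 k; have t1 := cf_error_gt0 k.+1.
have [xpos|xneg|] := ltrgtP x 0; last by move/eqP: x0.
- have y0 : 0 <= y.
    clearbody x y; rewrite leNgt; apply/negP => y0; move: nq; rewrite nE ltr_norml => /andP[+ _].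
    have : x * q k < 0 by rewrite pmulr_llt0.
    have : y * q k.+1 <= - q k.+1 by rewrite -mulN1r ler_pM2r//; lia.
    by lra.
  have : x%:~R <= -1 :> R by rewrite -[-1]/((-1)%:~R) ler_int; lia.
  have : 0 <= y%:~R :> R by rewrite ler0z.
  move=> yr xr; rewrite ler_normr; apply/orP; right; nra.
- have y0 : y <= 0.
    clearbody x y; rewrite leNgt; apply/negP => y0; move: nq; rewrite nE ltr_norml => /andP[_ +].
    have : 0 < x * q k by rewrite pmulr_lgt0.
    have : q k.+1 <= y * q k.+1 by rewrite -[leLHS]mul1r ler_pM2r//; lia.
    by lra.
  have : 1 <= x%:~R :> R by rewrite ler1z; lia.
  have : y%:~R <= 0 :> R by rewrite lerz0.
  move=> yr xr; rewrite ler_normr; apply/orP; left; nra.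
Qed.

End ContinuedFraction.

Lemma centered_rem (x z : int) : 0 < z -> exists j, 2 * `|x - j * z| <= z.
Proof.
move=> z0; pose j := ((2 * x + z) %/ (2 * z))%Z; exists j.
have z2 : 0 < 2 * z by rewrite mulr_gt0.
have h1 := ltz_pmod (2 * x + z) z2.
have h2 := modz_ge0 (2 * x + z) (lt0r_neq0 z2).
have h3 := divz_eq (2 * x + z) (2 * z).
rewrite -/j in h3; rewrite -[2 * `|_|](@normrM _ 2) ler_norml.
by apply/andP; split; lra.
Qed.

(** * Denominators, distances and residues at positive indices *)

Section Approximations.
Context {R : realType} (alpha : R).
Hypothesis alpha_irr : irrational alpha.

Local Notation Q := (cf_denom alpha).
Local Notation q k := ((Q k)%:~R : R).
Local Notation d k := (dist_int (q k * alpha)).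

Lemma cf_denomR_gt0 k : 0 < q k.
Proof. by rewrite ltr0z cf_denom_gt0. Qed.

Lemma cf_denomR_le j k : (j <= k)%N -> q j <= q k.
Proof. by move=> jk; rewrite ler_int; exact: cf_denom_homo. Qed.

Lemma cf_denomR_ge k : k%:R <= q k.
Proof. by rewrite -[k%:R]/(k%:Z%:~R) ler_int cf_denom_ge. Qed.

Lemma cf_denomR_ge1 k : 1 <= q k.
Proof. by rewrite ler1z -gtz0_ge1 cf_denom_gt0. Qed.

Lemma cf_distE k : (0 < k)%N -> d k = cf_error alpha k.
Proof. by case: k => // k _; exact: dist_int_denom. Qed.

Lemma cf_dist_gt0 k : (0 < k)%N -> 0 < d k.
Proof. by move=> k0; rewrite cf_distE// cf_error_gt0. Qed.

Lemma cf_dist_lt k : (0 < k)%N -> d k * q k.+1 < 1.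
Proof.
move=> k0; rewrite cf_distE//; have := cf_error_ltV alpha_irr k.
by rewrite -[_^-1]mul1r ltr_pdivlMr ?cf_denomR_gt0.
Qed.

Lemma cf_dist_gt k : (0 < k)%N -> 1 < 2 * (d k * q k.+1).
Proof.
move=> k0; rewrite cf_distE//; have := cf_error_gtV alpha_irr k.
have q1 := cf_denomR_gt0 k.+1; have q0 := cf_denomR_gt0 k.
rewrite -[_^-1]mul1r ltr_pdivrMr ?addr_gt0// => h.
have := cf_denomR_le (leqnSn k); rewrite -(ler_pM2l (cf_error_gt0 alpha_irr k)).
lra.
Qed.

Lemma cf_denomR_unbounded (B : R) : exists K, forall k, (K <= k)%N -> B <= q k.
Proof.
exists (Num.bound `|B|) => k Kk; apply: le_trans (cf_denomR_ge k).
apply: (@le_trans _ _ (Num.bound `|B|)%:R); last by rewrite ler_nat.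
by apply: le_trans (ler_norm _) _; apply/ltW/archi_boundP.
Qed.

Lemma cf_denomR_between K (T : R) : q K <= T ->
  exists k, [/\ (K <= k)%N, q k <= T & T <= q k.+1].
Proof.
move=> KT; have : exists k, T <= q (K + k).+1.
  have [N hN] := cf_denomR_unbounded T; exists N; apply: hN.
  by rewrite -addnS; apply: leq_trans (leq_addl _ _); exact: leqnSn.
move/ex_minnP => [[|k] kT kmin].
  by exists K; split=> //; rewrite addn0 in kT.
exists (K + k.+1)%N; split=> //; first exact: leq_addr.
rewrite leNgt; apply/negP => h.
by have := kmin k; rewrite addnS in h; move=> /(_ (ltW h)); rewrite ltnn.
Qed.

Lemma cf_best k (n : int) : (0 < k)%N -> n != 0 -> `|n| < Q k.+1 ->
  d k <= dist_int (n%:~R * alpha).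
Proof. by move=> k0 n0 nq; rewrite cf_distE//; exact: best_approximation. Qed.

Lemma cf_offset k : (0 < k)%N -> `|q k * alpha - (cf_num alpha k)%:~R| = d k.
Proof.
move=> k0; rewrite cf_distE// cf_errorE// normrM normrX normrN1 expr1n mul1r.
by rewrite gtr0_norm ?cf_error_gt0.
Qed.

(* p_k is invertible modulo q_k, so each residue p/q_k is close to some n alpha. *)
Lemma residue_approx k (p : int) : (0 < k)%N -> exists n m : int,
  2 * `|n| <= Q k /\ `|n%:~R * alpha - m%:~R - p%:~R / q k| <= d k / 2.
Proof.
move=> k0; have D := cf_det alpha_irr k; have Q0 := cf_denom_gt0 alpha_irr k.
pose s : int := (-1) ^+ k; have ss : s * s = 1 by rewrite /s -exprMn mulrNN mulr1 expr1n.
(* By [cf_det], u is an inverse of p_k modulo q_k. Taking for n a centered remainder of p u makes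
   the error |n| d_k / q_k at most d_k / 2. *)
pose u := - s * Q k.+1; have [j nn] := centered_rem (p * u) Q0.
pose n := p * u - j * Q k; pose m := - (p * s * cf_num alpha k.+1) - j * cf_num alpha k.
have E : n * cf_num alpha k = p + m * Q k.
  rewrite /n /m /u; transitivity (p * (s * (cf_num alpha k.+1 * Q k - cf_num alpha k * Q k.+1)) - p * s * cf_num alpha k.+1 * Q k - j * Q k * cf_num alpha k); first by ring.
  by rewrite D -/s ss; ring.
exists n, m; split=> //.
have q0 := cf_denomR_gt0 k.
have -> : n%:~R * alpha - m%:~R - p%:~R / q k =
   n%:~R * (q k * alpha - (cf_num alpha k)%:~R) / q k.
  have : (n * cf_num alpha k)%:~R = (p + m * Q k)%:~R :> R by rewrite E.
  rewrite intrD !intrM => ER.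
  by rewrite mulrBr ER; field; rewrite gt_eqF.
rewrite normrM normrM cf_offset// normfV (gtr0_norm q0) ler_pdivrMr//.
have : 2 * `|n%:~R| <= q k :> R.
  by rewrite -intr_norm -[2]/(2%:~R) -intrM ler_int.
have := cf_dist_gt0 k0; move: (d k) => e e0 h.
by move: h; rewrite -(ler_pM2r e0); lra.
Qed.

End Approximations.

(** * Cantor schemes and grids *)

Section CantorScheme.
Context {R : realType}.
Implicit Types (t u x : R) (n : nat).
Variables (F : nat -> R -> R) (g h : nat -> R) (m : nat -> nat).

(** The left end of the cylinder of level n with digits e. [F j] moves the previous left end to the
    right (rounding it up to a grid, or leaving it in place), then the digit selects one of [m j]
    points with spacing [g j]. As h bounds the single steps and halves, the cylinder lies in an
    interval of length 2 h n. *)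
Fixpoint scheme_point (e : nat -> int) (n : nat) : R :=
  if n is j.+1 then F j (scheme_point e j) + (e j)%:~R * g j else 0.

Definition scheme_count (n : nat) : nat := (\prod_(j < n) m j)%N.

Local Notation N := scheme_count.

Definition scheme_index (n : nat) (t : R) : int := Num.floor ((N n)%:R * t).

(** Digits in the mixed radix system with bases m 0, m 1, ...: for t in [0, 1), [scheme_index n t]
    is the number formed by the first n of them. *)
Definition scheme_digit (t : R) (n : nat) : int :=
  scheme_index n.+1 t - (m n)%:Z * scheme_index n t.

Hypothesis m_gt0 : forall n, (0 < m n)%N.
Hypothesis g_gt0 : forall n, 0 < g n.
Hypothesis F_ge : forall n x, x <= F n x.
Hypothesis F_le : forall n x, F n x + ((m n)%:R - 1) * g n <= x + h n.
Hypothesis h_half : forall n, h n.+1 <= h n / 2.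
Hypothesis h_gap : forall n, 4 * h n.+1 <= g n.

Lemma scheme_countS n : N n.+1 = (N n * m n)%N.
Proof. by rewrite /N big_ord_recr. Qed.

Lemma scheme_count_gt0 n : (0 < N n)%N.
Proof. by rewrite /N prodn_gt0. Qed.

Lemma scheme_digit_bound t n : 0 <= scheme_digit t n < (m n)%:Z.
Proof.
rewrite /scheme_digit /scheme_index scheme_countS natrM.
have m0 : 0 < (m n)%:R :> R by rewrite ltr0n.
set v := (N n)%:R * t.
have -> : (N n)%:R * (m n)%:R * t = (m n)%:R * v by rewrite /v; ring.
have fl := floor_le v; have fg := floorD1_gt v.
apply/andP; split.
  rewrite subr_ge0 floor_ge_int intrM ler_pM2l//.
rewrite ltrBlDl -[X in _ + X]mulr1 -mulrDr floor_lt_int intrM ltr_pM2l//.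
Qed.

Lemma scheme_step e n : (forall n, 0 <= e n < (m n)%:Z) ->
  scheme_point e n <= scheme_point e n.+1 <= scheme_point e n + h n.
Proof.
move=> eb; have /andP[e0 em] := eb n.
have g0 := g_gt0 n; have := F_ge n (scheme_point e n).
have := F_le n (scheme_point e n); rewrite /=.
have : 0 <= (e n)%:~R :> R by rewrite ler0z.
have : (e n)%:~R <= (m n)%:R - 1 :> R.
  have : (e n + 1)%:~R <= (m n)%:Z%:~R :> R by rewrite ler_int; lia.
  by rewrite intrD; lra.
move=> h1 h2 h3 h4.
have : 0 <= (e n)%:~R * g n by rewrite mulr_ge0// ltW.
have : (e n)%:~R * g n <= ((m n)%:R - 1) * g n by rewrite ler_pM2r.
by move=> h5 h6; apply/andP; split; lra.
Qed.

Lemma scheme_h_ge0 n : 0 <= h n.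
Proof.
have e0 k : 0 <= (fun=> 0 : int) k < (m k)%:Z by rewrite lexx ltz_nat m_gt0.
by have /andP[h1 h2] := scheme_step n e0; have := le_trans h1 h2; lra.
Qed.

(** The term - 2 h (n + k) closes the induction: a step costs at most h (n + k), which by halving is
    at most 2 h (n + k) - 2 h (n + k + 1). *)
Lemma scheme_tail e n k : (forall n, 0 <= e n < (m n)%:Z) ->
  scheme_point e n <= scheme_point e (n + k) <= scheme_point e n + 2 * h n - 2 * h (n + k).
Proof.
move=> eb; elim: k => [|k /andP[IH1 IH2]]; first by rewrite addn0; lra.
have /andP[s1 s2] := scheme_step (n + k) eb.
have := h_half (n + k); rewrite addnS; lra.
Qed.

Definition scheme_limit (e : nat -> int) : R := sup (range (scheme_point e)).

Lemma scheme_limit_bound e n : (forall n, 0 <= e n < (m n)%:Z) ->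
  scheme_point e n <= scheme_limit e <= scheme_point e n + 2 * h n.
Proof.
move=> eb.
have ub : ubound (range (scheme_point e)) (scheme_point e n + 2 * h n).
  move=> _ [k _ <-]; have [nk|kn] := leqP n k.
    have /andP[_] := scheme_tail n (k - n) eb; rewrite subnKC//.
    by have := scheme_h_ge0 k; lra.
  have /andP[+ _] := scheme_tail k (n - k) eb; rewrite subnKC ?(ltnW kn)//.
  by have := scheme_h_ge0 n; lra.
apply/andP; split; last by apply: ge_sup => //; exists (scheme_point e 0), 0%N.
by apply: ub_le_sup; [exists (scheme_point e n + 2 * h n) | exists n].
Qed.

Lemma scheme_point_ext e e' n : (forall j, (j < n)%N -> e j = e' j) ->
  scheme_point e n = scheme_point e' n.
Proof.
elim: n => //= n IH ee; rewrite ee// IH// => j jn; apply: ee.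
exact: ltnW.
Qed.

Variables (s C : R).
Hypothesis s_gt0 : 0 < s.
Hypothesis s_le1 : s <= 1.
Hypothesis C_gt0 : 0 < C.
Hypothesis width_small : forall e : R, 0 < e -> exists n, (m n)%:R * g n <= e.
Hypothesis count_ge : forall n, 1 <= C * ((N n)%:R * ((m n)%:R * g n) `^ s).

Local Notation X t := (scheme_limit (scheme_digit t)).

Lemma scheme_index0 t : 0 <= t < 1 -> scheme_index 0 t = 0.
Proof.
by move=> t1; rewrite /scheme_index /N big_ord0 mul1r; apply: floor_def; rewrite add0r.
Qed.

Lemma scheme_index_near n t u : scheme_index n t = scheme_index n u ->
  `|t - u| * (N n)%:R <= 1.
Proof.
rewrite /scheme_index => tu.
have N0 : 0 < (N n)%:R :> R by rewrite ltr0n scheme_count_gt0.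
have := floor_le ((N n)%:R * t); have := floorD1_gt ((N n)%:R * t).
have := floor_le ((N n)%:R * u); have := floorD1_gt ((N n)%:R * u).
rewrite tu intrD => h1 h2 h3 h4.
rewrite -(gtr0_norm N0) -normrM ler_norml mulrBl mulrC [u * _]mulrC.
by apply/andP; split; lra.
Qed.

(** Let n.+1 be the first level where the indices of t and u differ, by D say. Then u - t <= 2 D /
    N_{n+1}, and the limits are D spacings apart up to an overhang 2 h n.+1 of at most half a
    spacing, so 2 (X u - X t) >= D g_n. Since D <= m_n and s <= 1, (D g_n)^s >= (D / m_n) (m_n
    g_n)^s, and [count_ge] concludes. *)
Lemma scheme_holder_lt t u : 0 <= t -> t < u -> u < 1 ->
  0 <= X u - X t /\ u - t <= 2 * C * (2 * (X u - X t)) `^ s.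
Proof.
have C0 := C_gt0; have s0 := ltW s_gt0; move=> t0 tu u1.
have : exists n, scheme_index n.+1 t != scheme_index n.+1 u.
  (* If the indices agreed at all levels, u - t <= 1 / N_n <= C (m_n g_n)^s would hold for every n;
     the n chosen below makes this at most (u - t) / 2. *)
  apply: contrapT => nex.
  have same n : scheme_index n t = scheme_index n u.
    case: n => [|n]; last first.
      by apply: contrapT => tun; apply: nex; exists n; apply/eqP.
    by rewrite !scheme_index0//; lra.
  have c0 : 0 < (u - t) / (2 * C).
    by rewrite divr_gt0 ?mulr_gt0 ?subr_gt0.
  have [n nw] := width_small (powR_gt0 s^-1 c0).
  have := scheme_index_near (same n); have := count_ge n.
  have N0 : 0 < (N n)%:R :> R by rewrite ltr0n scheme_count_gt0.
  have : ((m n)%:R * g n) `^ s <= (u - t) / (2 * C).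
    have -> : (u - t) / (2 * C) = (((u - t) / (2 * C)) `^ s^-1) `^ s.
      by rewrite -powRrM mulVf ?lt0r_neq0// powRr1// ltW.
    apply: ge0_ler_powR; rewrite ?nnegrE ?powR_ge0 ?(ltW s_gt0)//.
    by rewrite mulr_ge0// ?ler0n// ltW.
  rewrite ler_pdivlMr; last by lra.
  rewrite distrC gtr0_norm ?subr_gt0//.
  move: ((N n)%:R) N0 (_ `^ _) (powR_ge0 ((m n)%:R * g n) s) => M M0 W W0 h1 h2 h3.
  have : W * (2 * C) * M <= (u - t) * M by rewrite ler_pM2r.
  lra.
move/ex_minnP => [n nd nmin].
have same j : (j <= n)%N -> scheme_index j t = scheme_index j u.
  case: j => [_|j jn]; first by rewrite !scheme_index0//; lra.
  by apply: contrapT => /eqP /nmin; rewrite leqNgt jn.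
have xn : scheme_point (scheme_digit t) n = scheme_point (scheme_digit u) n.
  by apply: scheme_point_ext => j jn; rewrite /scheme_digit !same// ltnW.
pose D : int := scheme_index n.+1 u - scheme_index n.+1 t.
have N1 : 0 < (N n.+1)%:R :> R by rewrite ltr0n scheme_count_gt0.
have N0 : 0 < (N n)%:R :> R by rewrite ltr0n scheme_count_gt0.
have m0 : 0 < (m n)%:R :> R by rewrite ltr0n.
have D1 : 1 <= D.
  have : scheme_index n.+1 t <= scheme_index n.+1 u.
    by apply: le_floor; rewrite ler_pM2l// ltW.
  by move: nd; rewrite /D; lia.
have DE : D = scheme_digit u n - scheme_digit t n.
  by rewrite /D /scheme_digit (same n)//; ring.
have Dm : D <= (m n)%:Z.
  have := scheme_digit_bound t n; have := scheme_digit_bound u n.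
  by rewrite DE; lia.
have Dr1 : 1 <= D%:~R :> R by rewrite ler1z.
have Drm : D%:~R <= (m n)%:R :> R by rewrite -[(m n)%:R]/((m n)%:Z%:~R) ler_int.
have ut : (u - t) * (N n.+1)%:R <= 2 * D%:~R.
  have := floor_le ((N n.+1)%:R * t); have := floorD1_gt ((N n.+1)%:R * u).
  rewrite -/(scheme_index n.+1 u) -/(scheme_index n.+1 t) intrD.
  by rewrite mulrBl !(mulrC _ (N n.+1)%:R) => h1 h2; move: Dr1; rewrite /D intrB; lra.
have g0 := g_gt0 n.
have Xge : D%:~R * g n <= 2 * (X u - X t).
  have /andP[a1 _] := scheme_limit_bound n.+1 (scheme_digit_bound u).
  have /andP[_ a2] := scheme_limit_bound n.+1 (scheme_digit_bound t).
  have hg := h_gap n.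
  have gD : g n <= D%:~R * g n by rewrite ler_peMl// ltW.
  have : scheme_point (scheme_digit u) n.+1 - scheme_point (scheme_digit t) n.+1 = D%:~R * g n.
    by rewrite /= xn DE intrB; ring.
  lra.
have DX : 0 < D%:~R * g n by rewrite mulr_gt0//; lra.
split; first by lra.
have DW : D%:~R / (m n)%:R * ((m n)%:R * g n) `^ s <= (2 * (X u - X t)) `^ s.
  apply: (@le_trans _ _ ((D%:~R * g n) `^ s)); last first.
    by apply: ge0_ler_powR => //; rewrite ?nnegrE; lra.
  have -> : D%:~R * g n = D%:~R / (m n)%:R * ((m n)%:R * g n) by field; rewrite gt_eqF.
  rewrite (@powRM _ (D%:~R / _)); last 2 first.
    by rewrite divr_ge0//; lra.
    by rewrite mulr_ge0// ltW.
  apply: ler_wpM2r; first exact: powR_ge0.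
  apply: ger1_powR => //; rewrite divr_gt0//=; last by lra.
  by rewrite ler_pdivrMr// mul1r.
have := count_ge n; move: DW ut; rewrite scheme_countS natrM.
move: (_ `^ s) (powR_ge0 (2 * (X u - X t)) s) => Z Z0.
move: (_ `^ s) (powR_ge0 ((m n)%:R * g n) s) => W W0.
move: (N n)%:R N0 (m n)%:R m0 => M M0 k k0 DW ut cW.
rewrite -(ler_pM2r (mulr_gt0 M0 k0)); apply: (le_trans ut).
have : D%:~R * W <= Z * k by rewrite -ler_pdivrMr// mulrAC.
move=> DW'.
have : D%:~R <= C * M * (D%:~R * W).
  have : D%:~R * 1 <= D%:~R * (C * (M * W)) by rewrite ler_pM2l//; lra.
  by rewrite mulr1 => /le_trans; apply; rewrite le_eqVlt; apply/orP; left; apply/eqP; ring.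
have : C * M * (D%:~R * W) <= C * M * (Z * k) by rewrite ler_pM2l// mulr_gt0.
lra.
Qed.

Lemma scheme_dim (A : set (circle R)) :
  2 * h 0 <= 1 / 2 ->
  (forall e : nat -> int, (forall n, 0 <= e n < (m n)%:Z) ->
     forall x, (forall n, scheme_point e n <= x <= scheme_point e n + 2 * h n) ->
     A (to_circle x)) ->
  (s%:E <= hausdorff_dim A)%E.
Proof.
have C0 := C_gt0; have s0 := ltW s_gt0; move=> h0 HA.
have Xb t : 0 <= X t <= 1 / 2.
  have /andP[] := scheme_limit_bound 0 (scheme_digit_bound t).
  by rewrite /= => h1 h2; apply/andP; split; lra.
have dE t u : mdist (to_circle (X t)) (to_circle (X u)) = `|X t - X u|.
  rewrite circle_mdistE -to_circleB circle_norm_small//.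
  have := Xb t; have := Xb u; rewrite ler_norml.
  by move=> /andP[? ?] /andP[? ?]; apply/andP; split; lra.
apply: (@hausdorff_dim_ge_holder _ _ A s (2 * C * 2 `^ s) (fun t => to_circle (X t))) => //.
- move=> t t1; apply: (HA (scheme_digit t)); first exact: scheme_digit_bound.
  by move=> n; apply: scheme_limit_bound; exact: scheme_digit_bound.
- move=> t u _ _; rewrite dE; have := Xb t; have := Xb u; rewrite ler_norml.
  by move=> /andP[? ?] /andP[? ?]; apply/andP; split; lra.
- have key t u : 0 <= t -> t < u -> u < 1 ->
      u - t <= 2 * C * 2 `^ s * `|X u - X t| `^ s.
    move=> t0 tu u1; have [X0 le] := scheme_holder_lt t0 tu u1.
    by apply: (le_trans le); rewrite powRM// ger0_norm// mulrA.
  move=> t u /andP[t0 t1] /andP[u0 u1]; rewrite dE.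
  have [tu|ut|->] := ltrgtP t u.
  + by rewrite (distrC (X t)); exact: key.
  + exact: key.
  + by rewrite !mulr_ge0 ?powR_ge0 ?(ltW C0).
Qed.

End CantorScheme.

(** * Points close to the grids (1/Q_n)Z *)

Section Grids.
Context {R : realType}.
Variables (Q : nat -> int) (r : nat -> R).
Hypothesis Q_gt0 : forall n, 0 < Q n.
Hypothesis r_gt0 : forall n, 0 < r n.

Local Notation Qr n := ((Q n)%:~R : R).

Let Qr_gt0 n : 0 < Qr n. Proof. by rewrite ltr0z. Qed.

(** If p/Q_n and p'/Q_{n+1} are both close to x, they differ by at most r_n + r_{n+1} <= 2 r_n, so p
    has at most 4 r_n Q_{n+1} + 1 <= 5 r_n Q_{n+1} successors. The product of these numbers, up to
    the constant 1/Q_0, is 5^n Q_n times the product of the r_j Q_j. *)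
Lemma grid_dim_le (A : nat -> set (circle R)) (s : R) : 0 < s ->
  (forall n, r n.+1 <= r n) -> (forall n, 1 <= r n * Qr n.+1) ->
  (forall N b, A N b -> exists x, [/\ to_circle x = b, 0 <= x < 1 &
     forall n, (N <= n)%N -> exists p : int, `|x - p%:~R / Qr n| <= r n]) ->
  (forall N (e : R), 0 < e -> exists n, [/\ (N <= n)%N, r n <= e &
     5 ^+ n * Qr n * (\prod_(j < n) (r j * Qr j)) * (2 * r n) `^ s <= e]) ->
  (hausdorff_dim (\bigcup_N A N) <= s%:E)%E.
Proof.
move=> s0 r_decr rQ HA Hn; apply: (hausdorff_dim_bigcup_le (to_circle 0)) => // N e e0.
pose W n := 5 ^+ n * Qr n * (\prod_(j < n) (r j * Qr j)).
have WS n : W n.+1 = W n * (5 * (r n * Qr n.+1)).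
  by rewrite /W big_ord_recr exprS /=; ring.
have W0 n : 0 < W n.
  by rewrite /W !mulr_gt0// ?exprn_gt0// prodr_gt0// => i _; rewrite mulr_gt0.
have WN i : W (N + i)%N = W N * \prod_(j < i) (5 * (r (N + j)%N * Qr (N + j).+1)).
  elim: i => [|i IH]; first by rewrite addn0 big_ord0 mulr1.
  by rewrite addnS WS IH big_ord_recr /= [RHS]mulrA.
have [L0 [L0s L0m]] : exists L : seq int,
  (size L)%:R <= 2 * ((1 + r N) * Qr N) + 1 /\
    forall z : int, `|z%:~R - 0| <= (1 + r N) * Qr N -> z \in L.
  by apply: near_ints; rewrite mulr_ge0//; have := r_gt0 N; have := Qr_gt0 N; lra.
have /choice[ch0 ch0P] : forall np : nat * int, exists L : seq int,
   (size L)%:R <= 2 * (2 * (r (N + np.1)%N * Qr (N + np.1).+1)) + 1 /\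
   forall z : int, `|z%:~R - np.2%:~R * Qr (N + np.1).+1 / Qr (N + np.1)%N| <=
     2 * (r (N + np.1)%N * Qr (N + np.1).+1) -> z \in L.
  by move=> [n p] /=; apply: near_ints; have := rQ (N + n)%N; lra.
pose ch n p := ch0 (n, p).
(* The tree starts at level N; K bounds the ratio of its size to [W n], and in return the level n is
   taken with cost below e / K. *)
pose K := (size L0)%:R / W N + 1.
have K1 : 1 <= K by rewrite /K lerDr divr_ge0// ltW.
have [n [Nn rne Wne]] := Hn N (e / K) (divr_gt0 e0 (lt_le_trans ltr01 K1)).
have eK : e / K <= e by rewrite ler_pdivrMr ?(lt_le_trans ltr01 K1)// ler_peMr// ltW.
pose i := (n - N)%N; have nE : n = (N + i)%N by rewrite subnKC.
exists [seq to_circle (p%:~R / Qr n) | p <- tree ch L0 i], (r n); split.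
- by rewrite ltW//= (le_trans rne).
- rewrite size_map.
  have sz : (size (tree ch L0 i))%:R <= (size L0)%:R / W N * W n.
    rewrite nE WN mulrA mulfVK ?gt_eqF//.
    apply: (@size_tree _ ch L0 (fun j => 5 * (r (N + j)%N * Qr (N + j).+1))) => j p.
    have [+ _] := ch0P (j, p).
    by move=> /le_trans; apply; rewrite /=; have := rQ (N + j)%N; lra.
  have {}sz : (size (tree ch L0 i))%:R <= K * W n.
    by apply: (le_trans sz); rewrite ler_pM2r// lerDl.
  apply: (@le_trans _ _ (K * W n * (2 * r n) `^ s)).
    by rewrite ler_wpM2r// powR_ge0.
  move: Wne; rewrite -/(W n) ler_pdivlMr ?(lt_le_trans ltr01 K1)// => Wne.
  by rewrite -mulrA mulrC.
- move=> b /HA[x [<- x01 xp]].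
  have /choice[v vP] : forall j, exists p : int, `|x - p%:~R / Qr (N + j)%N| <= r (N + j)%N.
    by move=> j; apply: xp; exact: leq_addr.
  exists (to_circle ((v i)%:~R / Qr n)); last first.
    by apply: (le_trans (mdist_to_circle_le _ _)); rewrite {1}nE; have := vP i; rewrite -nE.
  apply: (map_f (fun p : int => to_circle (p%:~R / Qr n))); apply: mem_tree.
  + apply: L0m; rewrite subr0; have := vP 0%N; rewrite addn0 => v0.
    have -> : (v 0%N)%:~R = (v 0%N)%:~R / Qr N * Qr N by rewrite mulfVK// gt_eqF.
    rewrite normrM (gtr0_norm (Qr_gt0 N)) ler_pM2r//.
    move: v0; rewrite !ler_norml => /andP[? ?]; case/andP: x01 => ? ?.
    by apply/andP; split; lra.
  + move=> j; rewrite /ch; have [_] := ch0P (j, v j); apply => /=.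
    have := vP j; have := vP j.+1; rewrite addnS => v1 v0.
    have -> : (v j.+1)%:~R - (v j)%:~R * Qr (N + j).+1 / Qr (N + j)%N =
       ((v j.+1)%:~R / Qr (N + j).+1 - (v j)%:~R / Qr (N + j)%N) * Qr (N + j).+1.
      by field; rewrite !gt_eqF.
    rewrite normrM (gtr0_norm (Qr_gt0 _)) mulrA ler_pM2r//.
    have := r_decr (N + j)%N => rd.
    move: v0 v1; rewrite !ler_norml => /andP[? ?] /andP[? ?].
    by apply/andP; split; lra.
Qed.

(** To the right of p/Q_n about r_n Q_{n+1} / 2 points of the next grid are used. Half of the radius
    is left free because a limit point may lie up to 2 h_{n+1} <= r_n beyond p/Q_n. Level n of the
    grids is level n.+1 of the scheme, whose first digit is always 0 as m 0 = 1. *)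
Lemma grid_dim_ge (A : set (circle R)) (s C : R) : 0 < s -> s <= 1 -> 0 < C ->
  4 <= Q 0%N ->
  (forall n, r n * Qr n <= 1 / 2) -> (forall n, 4 <= r n * Qr n.+1) ->
  (forall x, (forall n, exists p : int, `|x - p%:~R / Qr n| <= r n) ->
     A (to_circle x)) ->
  (forall n, 1 <= C * (Qr n * (\prod_(j < n) (r j * Qr j / 4)) * r n `^ s)) ->
  (s%:E <= hausdorff_dim A)%E.
Proof.
move=> s0 s1 C0 Q4 rQ rQS HA Hc.
pose m n := if n is j.+1 then `|Num.floor (r j * Qr j.+1 / 2)|%N else 1%N.
pose g n := (Qr n)^-1.
(* Rounding up moves the left end by at most one spacing; the points themselves span m n - 1
   spacings, which together fit in h n = m n g n. *)
pose F n (x : R) := (Num.ceil (Qr n * x))%:~R / Qr n.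
pose h n := (m n)%:R * g n.
have mE j : (m j.+1)%:R = (Num.floor (r j * Qr j.+1 / 2))%:~R :> R.
  rewrite /m -[_%:R]/((`|_|%N%:Z)%:~R) gez0_abs// floor_ge_int.
  by have := rQS j; lra.
have m_le j : (m j.+1)%:R <= r j * Qr j.+1 / 2 by rewrite mE; exact: floor_le.
have m_ge j : r j * Qr j.+1 / 4 <= (m j.+1)%:R.
  rewrite mE; have := floorD1_gt (r j * Qr j.+1 / 2); rewrite intrD.
  by have := rQS j; lra.
have m0 n : (0 < m n)%N.
  case: n => // j; rewrite -(ltr_nat R); apply: lt_le_trans (m_ge j).
  by have := rQS j; lra.
have m00 : m 0%N = 1%N by [].
clearbody m.
have g0 n : 0 < g n by rewrite invr_gt0.
have hS n : h n.+1 <= r n / 2.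
  rewrite /h ler_pdivrMr//; apply: (le_trans (m_le n)); lra.
have rg n : r n <= g n / 2.
  have := rQ n; rewrite /g -ler_pdivlMr// => /le_trans; apply; lra.
have gh n : g n <= h n by rewrite /h ler_peMl ?(ltW (g0 n))// ler1n.
have F_ge n x : x <= F n x.
  by rewrite /F ler_pdivlMr// mulrC; exact: ceil_ge.
have F_le n x : F n x + ((m n)%:R - 1) * g n <= x + h n.
  have : F n x <= x + g n.
    rewrite /F ler_pdivrMr// mulrDl mulVf ?gt_eqF// mulrC.
    by have := ceilB1_lt (x * Qr n); rewrite intrB; lra.
  by rewrite /h; lra.
have h_half n : h n.+1 <= h n / 2.
  by have := hS n; have := rg n; have := gh n; have := g0 n; lra.
have h_gap n : 4 * h n.+1 <= g n by have := hS n; have := rg n; lra.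
have W n : \prod_(j < n) (m j.+1)%:R >= Qr n / Qr 0%N * \prod_(j < n) (r j * Qr j / 4).
  elim: n => [|n IH]; first by rewrite !big_ord0 divff ?gt_eqF// mulr1.
  rewrite !big_ord_recr /=.
  set P := \prod_(j < n) (m j.+1)%:R in IH *.
  set P' := \prod_(j < n) (r j * Qr j / 4) in IH *.
  have P0 : 0 <= P by apply: prodr_ge0 => j _; rewrite ler0n.
  apply: (@le_trans _ _ (P * (r n * Qr n.+1 / 4))); last by rewrite ler_wpM2l.
  have -> : Qr n.+1 / Qr 0%N * (P' * (r n * Qr n / 4)) =
     (Qr n / Qr 0%N * P') * (r n * Qr n.+1 / 4) by ring.
  by rewrite ler_wpM2r//; have := rQS n; lra.
(* The second summand serves level 0, with count 1 and width 1/Q_0. The first one pays for Q_0 in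
   [W] and for the factor 4 in r_n / 4 <= m_{n+1} g_{n+1}. *)
pose C' := C * Qr 0%N * 4 `^ s + Qr 0%N `^ s.
have C'0 : 0 < C' by rewrite addr_gt0 ?powR_gt0// !mulr_gt0 ?powR_gt0.
apply: (@scheme_dim _ F g h m m0 g0 F_ge F_le h_half h_gap s C' s0 s1 C'0).
- move=> e e0; have [M hM] := half_cvg0 (N := 0) e0 (fun n _ => h_half n).
  by exists M; exact: hM.
- case=> [|n].
    rewrite /scheme_count big_ord0 m00 !mul1r /g.
    rewrite (_ : _ `^ s = (Qr 0%N `^ s)^-1); last first.
      by rewrite -powRN -powR_inv1 ?ltW// -powRrM mulN1r.
    by rewrite /C' mulrDl mulfV ?gt_eqF ?powR_gt0// lerDr !mulr_ge0 ?invr_ge0 ?powR_ge0 ?ltW.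
  have -> : (scheme_count m n.+1)%:R = \prod_(j < n) (m j.+1)%:R :> R.
    by rewrite /scheme_count natr_prod big_ord_recl m00 mul1r.
  apply: (le_trans (Hc n)).
  have cW := W n.
  have rm : r n `^ s <= 4 `^ s * ((m n.+1)%:R * g n.+1) `^ s.
    rewrite -powRM //; last by rewrite mulr_ge0// ltW.
    apply: ge0_ler_powR.
    - exact: ltW.
    - by rewrite nnegrE ltW.
    - by rewrite nnegrE !mulr_ge0 ?ler0n ?ltW.
    - rewrite /g mulrA ler_pdivlMr//; have := m_ge n; lra.
  set M := \prod_(j < n) (m j.+1)%:R in cW *.
  set P := \prod_(j < n) (r j * Qr j / 4) in cW *.
  have M0 : 0 <= M by apply: prodr_ge0 => j _; rewrite ler0n.
  set V := (_ * g _) `^ s in rm *; have V0 : 0 <= V by exact: powR_ge0.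
  have QM : Qr n * P <= Qr 0%N * M.
    by rewrite -ler_pdivrMl//; move: cW; rewrite -mulrA mulrCA.
  apply: (@le_trans _ _ (C * (Qr 0%N * M * (4 `^ s * V)))).
    rewrite ler_pM2l//; apply: ler_pM => //; last exact: powR_ge0.
    apply: mulr_ge0; first exact: ltW.
    apply: prodr_ge0 => j _; rewrite divr_ge0// mulr_ge0//; exact: ltW.
  rewrite /C' mulrDl (_ : _ * (M * V) = C * (Qr 0%N * M * (4 `^ s * V))); last by ring.
  by rewrite lerDl; apply: mulr_ge0; [exact: powR_ge0|exact: mulr_ge0].
- rewrite /h m00 mul1r; have : 4 <= Qr 0%N by rewrite -[4]/(4%:~R) ler_int.
  move=> q4; have : g 0%N <= 1 / 4.
    by rewrite /g -[_^-1]mul1r ler_pdivrMr//; lra.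
  by lra.
- move=> e eb x xe; apply: HA => n.
  have /andP[x1 x2] := xe n.+1.
  exists (Num.ceil (Qr n * scheme_point F g e n) + e n).
  have pE : scheme_point F g e n.+1 = (Num.ceil (Qr n * scheme_point F g e n) + e n)%:~R / Qr n.
    by rewrite /= /F intrD mulrDl.
  rewrite -pE ger0_norm ?subr_ge0//; have := hS n; lra.
Qed.

End Grids.

(** * Increasing enumerations of sets of indices *)

Section Enumerations.

Lemma infinite_nat_unbounded (S : set nat) : ~ finite_set S ->
  forall n, exists2 k, S k & (n <= k)%N.
Proof.
move=> Sinf n; apply: contrapT => h; apply: Sinf.
apply: (@sub_finite_set _ _ `I_n); last exact: finite_II.
by move=> k Sk /=; rewrite ltnNge; apply/negP => nk; apply: h; exists k.
Qed.

Lemma finite_nat_bounded (S : set nat) : finite_set S ->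
  exists N, forall k, S k -> (k < N)%N.
Proof.
move=> /finite_seqP[s ->]; exists (\max_(k <- s) k).+1 => k /= ks.
by rewrite ltnS; exact: leq_bigmax_seq.
Qed.

Lemma increasing_enumeration_exists (S : set nat) :
  (forall n, exists2 k, S k & (n <= k)%N) ->
  exists kappa, increasing_enumeration S kappa.
Proof.
move=> Sinf.
have ex n : exists k, `[< S k >] && (n <= k)%N.
  by have [k Sk nk] := Sinf n; exists k; rewrite nk andbT; apply/asboolP.
pose next n := ex_minn (ex n).
have nextP n : [/\ S (next n), (n <= next n)%N & forall k, S k -> (n <= k)%N -> (next n <= k)%N].
  rewrite /next; case: ex_minnP => k /andP[/asboolP Sk nk] kmin; split=> // j Sj nj.
  by apply: kmin; rewrite nj andbT; apply/asboolP.
pose kappa := fix kappa n := if n is j.+1 then next (kappa j).+1 else next 0%N.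
have kS n : (kappa n < kappa n.+1)%N by have [] := nextP (kappa n).+1.
have kmono : {homo kappa : i j / (i < j)%N} by exact: homo_ltn ltn_trans kS.
have kge n : (n <= kappa n)%N.
  by elim: n => // n IH; exact: leq_ltn_trans IH (kS n).
exists kappa; split=> //; apply/seteqP; split=> [_ [n _ <-]|k Sk].
  by case: n => [|n] /=; [have [] := nextP 0%N | have [] := nextP (kappa n).+1].
have : exists n, (k <= kappa n)%N by exists k.
move/ex_minnP => [n kn nmin]; exists n => //; apply/eqP; rewrite eqn_leq kn andbT.
case: n kn nmin => [|n] kn nmin; first by have [_ _] := nextP 0%N; apply.
have [_ _] := nextP (kappa n).+1; apply=> //; rewrite ltnNge; apply/negP => /nmin.
by rewrite ltnn.
Qed.

Variables (S : set nat) (kappa : nat -> nat).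
Hypothesis kappaS : increasing_enumeration S kappa.

Lemma enum_in n : S (kappa n).
Proof. by case: kappaS => _ <-; exists n. Qed.

Lemma enum_surj k : S k -> exists n, kappa n = k.
Proof. by case: kappaS => _ <- [n _ <-]; exists n. Qed.

Lemma enum_lt i j : (i < j)%N -> (kappa i < kappa j)%N.
Proof. by case: kappaS => h _; exact: h. Qed.

Lemma enum_le i j : (i <= j)%N -> (kappa i <= kappa j)%N.
Proof. by rewrite leq_eqVlt => /predU1P[->//|/enum_lt/ltnW]. Qed.

Lemma enum_ge n : (n <= kappa n)%N.
Proof. by elim: n => // n IH; apply: leq_ltn_trans IH (enum_lt _). Qed.

Lemma enum_gap n k : (kappa n < k < kappa n.+1)%N -> ~ S k.
Proof.
move=> /andP[nk kn] /enum_surj[j jk]; move: nk kn; rewrite -jk.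
have [jn|nj] := leqP j n; first by rewrite ltnNge (enum_le jn).
by move=> _; rewrite ltnNge (enum_le nj).
Qed.

Lemma enum_before k : (k < kappa 0)%N -> ~ S k.
Proof. by move=> k0 /enum_surj[j jk]; move: k0; rewrite -jk ltnNge enum_le. Qed.

(** Products over an index set become products over intervals of indices, with factor 1 outside the
    set; in this form products that belong to different index sets can be compared. *)
Lemma enum_prod (R : comNzRingType) (f : nat -> R) k0 n :
  (forall k, S k -> (k0 <= k)%N) ->
  (forall k, (k0 <= k)%N -> ~ S k -> f k = 1) ->
  \prod_(j < n) f (kappa j) = \prod_(k0 <= k < kappa n) f k.
Proof.
move=> Sk0 f1; elim: n => [|n IH].
  rewrite big_ord0 big_nat big1// => k /andP[k0k kk].
  by apply: f1 => //; exact: enum_before.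
have k0n : (k0 <= kappa n)%N by apply: Sk0; exact: enum_in.
rewrite big_ord_recr /= IH (@big_cat_nat _ _ _ (kappa n) k0 (kappa n.+1))//=; last first.
  by apply: ltnW; exact: enum_lt.
rewrite (big_ltn (enum_lt (ltnSn n))) [X in _ = _ * (_ * X)](_ : _ = 1) ?mulr1//.
rewrite big_nat big1// => k kk; apply: f1; last exact: enum_gap kk.
by case/andP: kk => kk _; rewrite (leq_trans k0n)// ltnW.
Qed.

End Enumerations.

Lemma seq_between (R : realDomainType) (u : nat -> R) (T : R) : u 0%N <= T ->
  (exists n, T < u n) -> exists n, u n <= T /\ T <= u n.+1.
Proof.
move=> uT /ex_minnP[[|n] Tu umin]; first by move: Tu; rewrite ltNge uT.
exists n; split; last exact: ltW.
by rewrite leNgt; apply/negP => /umin; rewrite ltnn.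
Qed.

(** * Absorbing constants by a change of exponent *)

Section Slack.
Context {R : realType}.

Lemma prod_scale n (x : R) (f : 'I_n -> R) :
  \prod_(j < n) (x * f j) = x ^+ n * \prod_(j < n) f j.
Proof. by rewrite big_split /= prodr_const card_ord. Qed.

(** With C = (2 K)^(1/eta), the inequality C u_{n+1} <= u_n makes K^n u_n^eta at least halve at each
    step. *)
Lemma geometric_slack (u : nat -> R) (K eta e : R) : (forall n, 0 < u n) ->
  0 < K -> 0 < eta -> 0 < e ->
  (forall C : R, exists N, forall n, (N <= n)%N -> C * u n.+1 <= u n) ->
  exists M, forall n, (M <= n)%N -> K ^+ n * u n `^ eta <= e.
Proof.
move=> u0 K0 eta0 e0 hu; pose C := (2 * K) `^ eta^-1.
have C0 : 0 < C by rewrite powR_gt0 ?mulr_gt0.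
have [N hN] := hu C.
apply: (@half_cvg0 _ (fun n => K ^+ n * u n `^ eta) N) => // n Nn.
have := hN n Nn => h.
have : (C * u n.+1) `^ eta <= u n `^ eta.
  by apply: ge0_ler_powR; rewrite ?nnegrE ?mulr_ge0 ?(ltW C0) ?(ltW (u0 _)) ?(ltW eta0).
rewrite powRM ?(ltW C0) ?(ltW (u0 _))// /C -powRrM mulVf ?lt0r_neq0// powRr1; last first.
  by rewrite mulr_ge0// ltW.
move=> {}h; rewrite exprS.
have Kn : 0 < K ^+ n by rewrite exprn_gt0.
move: h; rewrite -(ler_pM2l Kn); lra.
Qed.

(** Serves sequences that are known to be large at some indices and merely not to drop at the
    others; the indices up to M contribute a minimum. *)
Lemma positive_lower_bound (w : nat -> R) (M : nat) : (forall n, 0 < w n) ->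
  (forall n, (M <= n)%N -> 1 <= w n.+1 \/ w n <= w n.+1) ->
  exists2 e, 0 < e & forall n, e <= w n.
Proof.
move=> w0 hw.
have [e e0 he] : exists2 e, 0 < e & forall n, (n <= M)%N -> e <= w n.
  elim: M {hw} => [|M [e e0 he]]; first by exists (w 0%N) => // n; rewrite leqn0 => /eqP ->.
  exists (Num.min e (w M.+1)); first by rewrite lt_min e0 w0.
  move=> n; rewrite leq_eqVlt => /predU1P[->|nM]; first by rewrite ge_min lexx orbT.
  by rewrite ge_min he.
exists (Num.min e 1); first by rewrite lt_min e0 ltr01.
elim=> [|n IH]; first by rewrite ge_min he.
have [nM|Mn] := leqP n.+1 M; first by rewrite ge_min he.
have [h|h] := hw n Mn; first by rewrite ge_min h orbT.
exact: le_trans h.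
Qed.

End Slack.

(** * The approximation set *)

Section Dimension.
Context {R : realType} (alpha : R) (psi : R -> R) (Y : nat -> R) (K0 : nat).
Hypothesis alpha_irr : irrational alpha.
Hypothesis psi_gt0 : forall T : R, 0 < T -> 0 < psi T.
Hypothesis psi_decr : forall S T : R, 0 < S -> S < T -> psi T < psi S.

Local Notation q k := ((cf_denom alpha k)%:~R : R).
Local Notation d k := (dist_int (q k * alpha)).

Hypothesis K0_gt0 : (0 < K0)%N.
Hypothesis YP : forall k, (K0 <= k)%N -> 0 < Y k /\ Y k / psi (Y k) = q k / d k.

Lemma psi_le (S T : R) : 0 < S -> S <= T -> psi T <= psi S.
Proof. by move=> S0; rewrite le_eqVlt => /predU1P[->//|/(psi_decr S0)/ltW]. Qed.

Lemma index_gt0 k : (K0 <= k)%N -> (0 < k)%N.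
Proof. exact: leq_trans. Qed.

Lemma Y_gt0 k : (K0 <= k)%N -> 0 < Y k.
Proof. by move=> /YP[]. Qed.

Lemma YE k : (K0 <= k)%N -> Y k * d k = q k * psi (Y k).
Proof.
move=> kK; have [Y0 YE] := YP kK.
have p0 := psi_gt0 Y0; have d0 := cf_dist_gt0 alpha_irr (index_gt0 kK).
have -> : Y k = Y k / psi (Y k) * psi (Y k) by rewrite mulfVK// gt_eqF.
rewrite {1}YE (_ : Y k / psi (Y k) * psi (Y k) = Y k); last by rewrite mulfVK// gt_eqF.
by rewrite mulrAC mulfVK// gt_eqF.
Qed.

(** By [YE], psi (Y k) < 1/q_k means Y k < 1/d_k. As psi decreases, the comparison with 1/q_k then
    has the same outcome at both points. *)
Lemma index_equiv k : (K0 <= k)%N ->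
  (psi (d k)^-1 < (q k)^-1) <-> (psi (Y k) < (q k)^-1).
Proof.
move=> kK; have E := YE kK; have Y0 := Y_gt0 kK.
have d0 := cf_dist_gt0 alpha_irr (index_gt0 kK); have q0 := cf_denomR_gt0 alpha_irr k.
have dV0 : 0 < (d k)^-1 by rewrite invr_gt0.
have key : (psi (Y k) < (q k)^-1) = (Y k < (d k)^-1).
  by rewrite -[X in _ < X]mul1r ltr_pdivlMr// mulrC -E -[(d k)^-1]mul1r ltr_pdivlMr.
split=> [h|h]; last first.
  by apply: lt_trans (h); apply: psi_decr => //; rewrite -key.
rewrite key ltNge; apply/negP => dY; have := psi_le dV0 dY => le.
have : Y k < (d k)^-1 by rewrite -key (le_lt_trans le).
by rewrite ltNge dY.
Qed.

Lemma cf_denom_le_distV k T : (0 < k)%N -> T <= q k.+1 -> T <= (d k)^-1.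
Proof.
move=> k0 Tq; have d0 := cf_dist_gt0 alpha_irr k0.
apply: (le_trans Tq); rewrite -[leRHS]mul1r ler_pdivlMr// mulrC.
exact: ltW (cf_dist_lt alpha_irr k0).
Qed.

Lemma circle_norm_shift (n m : int) (x : R) :
  circle_norm (to_circle (n%:~R * alpha) - to_circle x) <= `|n%:~R * alpha - m%:~R - x|.
Proof.
rewrite -to_circleB circle_norm_pi -(dist_int_intD _ (- m)) intrN.
rewrite (_ : _ - x - _ = n%:~R * alpha - m%:~R - x); last by ring.
by have := dist_int_le (n%:~R * alpha - m%:~R - x) 0; rewrite subr0.
Qed.

(** Every x is within 1/(2 q_k) of some p/q_k, and p/q_k within d_k/2 <= 1/(2 q_k) of some n alpha
    modulo 1; the sum 1/q_k is allowed up to T = 1/d_k, hence up to q_{k+1}. *)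
Lemma approx_free k (c x T : R) : (0 < k)%N -> 0 < c ->
  (q k)^-1 <= c * psi (d k)^-1 -> q k <= T -> T <= q k.+1 ->
  exists n : int, `|n|%:~R <= T /\
    circle_norm (to_circle (n%:~R * alpha) - to_circle x) <= c * psi T.
Proof.
move=> k0 c0 free qT Tq; have q0 := cf_denomR_gt0 alpha_irr k.
have T0 : 0 < T by exact: lt_le_trans qT.
have d0 := cf_dist_gt0 alpha_irr k0.
pose p := Num.floor (x * q k + 1 / 2).
have [n [m [nq h]]] := residue_approx alpha_irr p k0.
exists n; split.
  apply: le_trans qT; have := nq; rewrite -(ler_int R) intrM -[2%:~R]/2.
  have : 0 <= `|n|%:~R :> R by rewrite ler0z.
  by lra.
apply: (le_trans (circle_norm_shift n m x)).
have xp : `|p%:~R / q k - x| <= (q k)^-1 / 2.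
  have -> : p%:~R / q k - x = (p%:~R - x * q k) / q k by field; rewrite gt_eqF.
  rewrite normrM normfV (gtr0_norm q0) mulrC ler_pM2l ?invr_gt0//.
  have := floor_le (x * q k + 1 / 2); have := floorD1_gt (x * q k + 1 / 2).
  by rewrite intrD -/p ler_norml => h1 h2; apply/andP; split; lra.
have dq : d k <= (q k)^-1.
  rewrite -[leRHS]mul1r ler_pdivlMr//; apply: le_trans (ltW (cf_dist_lt alpha_irr k0)).
  by rewrite ler_pM2l// cf_denomR_le.
apply: (@le_trans _ _ (c * psi (d k)^-1)).
  apply: le_trans free.
  rewrite (_ : _ - x = (n%:~R * alpha - m%:~R - p%:~R / q k) + (p%:~R / q k - x)); last by ring.
  by apply: (le_trans (ler_normD _ _)); lra.
rewrite ler_pM2l//; apply: psi_le => //; exact: cf_denom_le_distV.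
Qed.

(* For T <= Y_k the ball of radius psi (Y_k) around p/q_k is used as it is; for
   T >= Y_k it is covered by the progression of step d_k through its centre. *)
Lemma approx_ball k (c x T sigma : R) (p : int) : (K0 <= k)%N -> 0 < c -> c <= 1 ->
  0 < sigma -> sigma <= psi (Y k) -> d k <= c * sigma -> d k <= c * psi (d k)^-1 ->
  8 * q k <= Y k -> q k <= T -> T <= q k.+1 ->
  `|x - p%:~R / q k| <= c / 2 * sigma ->
  exists n : int, `|n|%:~R <= T /\
    circle_norm (to_circle (n%:~R * alpha) - to_circle x) <= c * psi T.
Proof.
move=> kK c0 c1 s0 sY ds dpsi qY qT Tq xp; have k0 := index_gt0 kK.
have q0 := cf_denomR_gt0 alpha_irr k; have T0 : 0 < T by exact: lt_le_trans qT.
have d0 := cf_dist_gt0 alpha_irr k0; have Y0 := Y_gt0 kK; have E := YE kK.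
have [n [m [nq h]]] := residue_approx alpha_irr p k0.
have nR : 2 * `|n|%:~R <= q k :> R by have := nq; rewrite -(ler_int R) intrM.
have n0 : 0 <= `|n|%:~R :> R by rewrite ler0z.
have yx : `|n%:~R * alpha - m%:~R - x| <= d k / 2 + c / 2 * sigma.
  rewrite (_ : _ - x = (n%:~R * alpha - m%:~R - p%:~R / q k) + (p%:~R / q k - x)); last by ring.
  by apply: (le_trans (ler_normD _ _)); rewrite lerD// distrC.
have [TY|YT] := leP T (Y k).
  exists n; split; first by lra.
  apply: (le_trans (circle_norm_shift n m x)); apply: (le_trans yx).
  have : c * psi (Y k) <= c * psi T by rewrite ler_pM2l// psi_le.
  have : c * sigma <= c * psi (Y k) by rewrite ler_pM2l.
  lra.
pose y := n%:~R * alpha - m%:~R - x.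
pose t := q k * alpha - (cf_num alpha k)%:~R.
have td : `|t| = d k by exact: cf_offset.
have tn0 : t != 0 by rewrite -normr_gt0 td.
(* t is the signed error of q_k, so j multiples of q_k bring the centre within one step d_k of x
   whatever the sign of t. *)
pose j := Num.floor (y / t).
have jy : `|y - j%:~R * t| <= d k.
  rewrite (_ : y - _ = (y / t - j%:~R) * t); last by rewrite mulrBl mulfVK.
  rewrite normrM td -[leRHS]mul1r ler_pM2r//.
  have := floor_le (y / t); have := floorD1_gt (y / t).
  by rewrite intrD -/j ler_norml => h1 h2; apply/andP; split; lra.
have jd : `|j|%:~R * d k <= `|y| + d k.
  rewrite intr_norm -td -normrM td.
  rewrite (_ : j%:~R * t = y - (y - j%:~R * t)); last by ring.
  by apply: (le_trans (ler_normB _ _)); rewrite lerD2l.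
exists (n - j * cf_denom alpha k); split.
  have : `|n - j * cf_denom alpha k|%:~R <= `|n|%:~R + `|j|%:~R * q k :> R.
    rewrite -intrM -intrD ler_int; apply: (le_trans (ler_normB _ _)).
    by rewrite normrM (gtr0_norm (cf_denom_gt0 alpha_irr k)).
  move=> /le_trans; apply.
  (* By [YE], psi (Y k) / d_k = Y k / q_k, so crossing half of the ball costs a multiplier Y k / 2;
     the assumption 8 q_k <= Y k leaves room for n and the rounding. *)
  suff : `|j|%:~R * q k <= 2 * q k + Y k / 2 by lra.
  have jd2 : `|j|%:~R * d k <= 2 * d k + psi (Y k) / 2.
    have : c * sigma <= psi (Y k) by apply: le_trans sY; apply: ler_piMl => //; exact: ltW.
    by move: yx; rewrite -/y; lra.
  rewrite -(ler_pM2r d0) mulrDl [Y k / 2 * _]mulrAC E.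
  by rewrite -(ler_pM2r q0) in jd2; lra.
apply: (le_trans (circle_norm_shift _ (m - j * cf_num alpha k) x)).
rewrite (_ : _ - x = y - j%:~R * t); last by rewrite /y /t !intrB !intrM; ring.
apply: (le_trans jy); apply: (le_trans dpsi).
by rewrite ler_pM2l//; apply: psi_le => //; exact: cf_denom_le_distV.
Qed.

Local Notation scaled c := (fun T : R => (c * psi T)%R).

Lemma approx_setP (c x : R) k1 :
  (forall k T, (k1 <= k)%N -> q k <= T -> T <= q k.+1 -> exists n : int,
     `|n|%:~R <= T /\ circle_norm (to_circle (n%:~R * alpha) - to_circle x) <= c * psi T) ->
  approx_set alpha (scaled c) (to_circle x).
Proof.
move=> h; exists (q k1); split; first exact: num_real.
move=> T /ltW /(cf_denomR_between alpha_irr)[k [k1k qT Tq]]; exact: h qT Tq.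
Qed.

(** * Decay of the radii along a sequence of levels *)

Section LevelSequence.
Variables (kappa : nat -> nat) (sigma : nat -> R).
Hypothesis kappa_lt : forall n, (kappa n < kappa n.+1)%N.
Hypothesis kappa_gt0 : forall n, (0 < kappa n)%N.
Hypothesis sigma_ge : forall n, 2 * d (kappa n) <= sigma n.
Hypothesis sigma_le : forall n, sigma n <= (q (kappa n))^-1.

(** With k = kappa n, the next denominator of the sequence is at least q_{k+1} > 1 / (2 d_k). *)
Lemma level_step (C : R) n : 0 <= C -> 2 * C * d (kappa n) <= sigma n ->
  C <= sigma n * q (kappa n.+1).
Proof.
move=> C0 h; have q0 := cf_denomR_gt0 alpha_irr.
have d0 := cf_dist_gt0 alpha_irr (kappa_gt0 n).
have := cf_dist_gt alpha_irr (kappa_gt0 n).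
have qq : q (kappa n).+1 <= q (kappa n.+1) by apply: cf_denomR_le.
move=> dq; apply: (@le_trans _ _ (2 * C * d (kappa n) * q (kappa n).+1)).
  have : C * 1 <= C * (2 * (d (kappa n) * q (kappa n).+1)) by rewrite ler_wpM2l// ltW.
  lra.
apply: ler_pM => //; first by rewrite !mulr_ge0// ltW.
exact: ltW.
Qed.

Lemma level_ge1 n : 1 <= sigma n * q (kappa n.+1).
Proof. by apply: level_step; rewrite ?mulr1//; exact: sigma_ge. Qed.

(** The radius [sigma n.+1] is at most the inverse of the next denominator, and [level_step] makes
    that denominator at least C / sigma n. *)
Lemma level_sparse : (forall C : R, exists N, forall n, (N <= n)%N ->
    C * d (kappa n) <= sigma n) ->
  forall C : R, exists N, forall n, (N <= n)%N -> C * sigma n.+1 <= sigma n.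
Proof.
move=> h C; have [N hN] := h (2 * `|C|); exists N => n Nn.
have q0 := cf_denomR_gt0 alpha_irr (kappa n.+1).
have := level_step (normr_ge0 C) (hN n Nn).
rewrite -ler_pdivrMr//; apply: le_trans.
have s0 : 0 <= sigma n.+1.
  apply: le_trans (sigma_ge _); rewrite mulr_ge0//.
  exact: ltW (cf_dist_gt0 alpha_irr (kappa_gt0 _)).
apply: (@le_trans _ _ (`|C| * sigma n.+1)); first by rewrite ler_wpM2r// ler_norm.
by rewrite ler_wpM2l.
Qed.

End LevelSequence.

(** * Slowly decaying psi *)

Section Slow.

Hypothesis psi_slow : forall C : R, exists T1 : R, 0 < T1 /\ forall T : R, T1 <= T -> C <= T * psi T.

(** If Y_k < C q_k, then psi (Y_k) >= psi (C q_k) >= C / q_k, by the hypothesis with C * C at T = C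
    q_k; but q_k psi (Y_k) = Y_k d_k < C q_k d_k <= C. The second bound is the first one read
    through [YE], the third is the hypothesis at T = 1/d_k. *)
Lemma slow_large (C : R) : exists K, (K0 <= K)%N /\ forall k, (K <= k)%N ->
  [/\ C * q k <= Y k, C * d k <= psi (Y k) & C * d k <= psi (d k)^-1].
Proof.
wlog C1 : C / 1 <= C.
  move=> hw; have [|K [KK0 hK]] := hw (Num.max C 1); first by rewrite le_max lexx orbT.
  exists K; split=> // k Kk; have [h1 h2 h3] := hK k Kk.
  have q0 := ltW (cf_denomR_gt0 alpha_irr k).
  have d0 := ltW (cf_dist_gt0 alpha_irr (index_gt0 (leq_trans KK0 Kk))).
  have Cm : C <= Num.max C 1 by rewrite le_max lexx.
  split.
  - by apply: le_trans h1; rewrite ler_wpM2r.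
  - by apply: le_trans h2; rewrite ler_wpM2r.
  - by apply: le_trans h3; rewrite ler_wpM2r.
have C0 : 0 < C by exact: lt_le_trans C1.
have [T1 [T10 hT1]] := psi_slow (C * C).
have [K hK] := cf_denomR_unbounded alpha_irr T1.
exists (maxn K0 K); split; first exact: leq_maxl.
move=> k; rewrite geq_max => /andP[kK0 kK].
have k0 := index_gt0 kK0; have q0 := cf_denomR_gt0 alpha_irr k.
have d0 := cf_dist_gt0 alpha_irr k0; have Y0 := Y_gt0 kK0; have E := YE kK0.
have qY : C * q k <= Y k.
  rewrite leNgt; apply/negP => YC.
  have Cq0 : 0 < C * q k by rewrite mulr_gt0.
  have := hT1 (C * q k); rewrite (le_trans (hK _ kK)); last first.
    by apply: ler_peMl => //; exact: ltW.
  move=> /(_ isT); rewrite -!mulrA ler_pM2l// => h1.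
  have := psi_le Y0 (ltW YC); rewrite -(ler_pM2l q0) -E => h2.
  have : Y k * d k < C * q k * d k by rewrite ltr_pM2r.
  have : C * (d k * q k) <= C * 1.
    rewrite ler_pM2l//; apply: le_trans (ltW (cf_dist_lt alpha_irr k0)).
    by rewrite ler_pM2l// cf_denomR_le.
  lra.
split=> //.
  rewrite -(ler_pM2l q0) -E; have h := qY; rewrite -(ler_pM2r d0) in h; lra.
have := hT1 (d k)^-1; rewrite (le_trans (hK _ kK)); last first.
  by apply: cf_denom_le_distV => //; exact: cf_denomR_le.
move=> /(_ isT) h; have : C * C * d k <= psi (d k)^-1.
  by rewrite [leRHS]mulrC ler_pdivlMr in h.
apply: le_trans; rewrite ler_pM2r//; exact: ler_peMl (ltW C0) C1.
Qed.

Lemma slow_dim_le (k0 : nat) (kappa : nat -> nat) (c s s1 : R) :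
  0 < c -> s1 < s -> 0 < s ->
  increasing_enumeration [set k | (k0 <= k)%N /\ psi (d k)^-1 < (q k)^-1] kappa ->
  (K0 <= k0)%N ->
  (forall k, (k0 <= k)%N -> 2 * q k <= Y k /\ 2 * d k <= psi (Y k)) ->
  (forall N, exists n, (N <= n)%N /\
     q (kappa n) * \prod_(j < n) (q (kappa j) * psi (Y (kappa j))) <=
       psi (Y (kappa n)) `^ (- s1)) ->
  (hausdorff_dim (approx_set alpha (scaled c)) <= s%:E)%E.
Proof.
move=> c0 s1s s0 kS k0K large small.
have c1 : 0 < 1 + c by lra.
have c2 : 0 < 2 * (1 + c) by lra.
have c5 : 0 < 5 * (1 + c) by lra.
have kin n := enum_in kS n.
have kK n : (K0 <= kappa n)%N by have [h _] := kin n; exact: leq_trans h.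
have klt n : (kappa n < kappa n.+1)%N by exact: enum_lt kS _ _ (ltnSn n).
have kgt0 n := index_gt0 (kK n).
have kge n := enum_ge kS n.
have q0 n := cf_denomR_gt0 alpha_irr (kappa n).
pose ps n := psi (Y (kappa n)).
have ps0 n : 0 < ps n by apply: psi_gt0; exact: Y_gt0.
have psd n : 2 * d (kappa n) <= ps n by have [h _] := kin n; have [] := large _ h.
have psq n : ps n <= (q (kappa n))^-1.
  by apply/ltW; rewrite -(index_equiv (kK n)); have [] := kin n.
have psQ := level_ge1 klt kgt0 psd.
have psdec n : ps n.+1 <= ps n.
  by apply: (le_trans (psq n.+1)); rewrite -[leLHS]mul1r ler_pdivrMr.
have sparse : forall C : R, exists N, forall n, (N <= n)%N -> C * ps n.+1 <= ps n.
  apply: level_sparse => // C; have [K [_ hK]] := slow_large C.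
  by exists K => n Kn; have [] := hK (kappa n) (leq_trans Kn (kge n)).
(* Of the condition on all large T only the times T = [Y (kappa n)] are kept. *)
pose A N : set (circle R) := [set b | forall n, (N <= n)%N -> exists u : int,
  `|u|%:~R <= Y (kappa n) /\ circle_norm (to_circle (u%:~R * alpha) - b) <= c * ps n].
apply: (@le_trans _ _ (hausdorff_dim (\bigcup_N A N))).
  apply: hausdorff_dim_mono => b [T0 [_ hT]].
  have [N hN] := cf_denomR_unbounded alpha_irr (T0 + 1).
  exists N => // n Nn; apply: hT.
  have [h _] := kin n; have [h2 _] := large _ h.
  have := hN (kappa n) (leq_trans Nn (kge n)); have := q0 n; lra.
apply: (@grid_dim_le _ (fun n => cf_denom alpha (kappa n)) (fun n => (1 + c) * ps n)) => //.
- by move=> n; exact: cf_denom_gt0.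
- by move=> n; rewrite mulr_gt0.
- by move=> n; rewrite ler_pM2l.
- move=> n; rewrite -mulrA; apply: (le_trans (psQ n)).
  by apply: ler_peMl; [exact: le_trans (psQ n)|lra].
- move=> N b Ab; have [x x01 xb] := to_circle_surj b; exists x; split=> // n Nn.
  have [u [uY]] := Ab n Nn; rewrite -xb -to_circleB circle_norm_pi.
  have [m ->] := dist_int_attained (u%:~R * alpha - x) => um.
  pose k := kappa n; pose p := u * cf_num alpha k - m * cf_denom alpha k.
  exists p; have qn0 := q0 n.
  have -> : x - p%:~R / q k = u%:~R * (q k * alpha - (cf_num alpha k)%:~R) / q k -
      (u%:~R * alpha - x - m%:~R).
    by rewrite /p intrB !intrM; field; rewrite gt_eqF.
  apply: (le_trans (ler_normB _ _)); rewrite mulrDl mul1r; apply: lerD => //.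
  rewrite normrM normrM (cf_offset alpha_irr (kgt0 n)) normfV (gtr0_norm qn0).
  rewrite ler_pdivrMr// mulrC -intr_norm -[leRHS]mulrC -(YE (kK n)) mulrC.
  by rewrite ler_wpM2r// ltW// cf_dist_gt0.
(* The counting loses (5 (1 + c))^n; the difference s - s1 pays for it. *)
- move=> N e e0; have eta0 : 0 < s - s1 by rewrite subr_gt0.
    have B0 : 0 < (2 * (1 + c)) `^ s by rewrite powR_gt0.
  have [M1 hM1] := geometric_slack ps0 c5 eta0 (divr_gt0 e0 B0) sparse.
  have e1 : 0 < e / (1 + c) by rewrite divr_gt0.
  have [M2 hM2] := geometric_slack ps0 ltr01 ltr01 e1 sparse.
  have [n [Nn hn]] := small (maxn N (maxn M1 M2)).
  move: Nn; rewrite !geq_max => /andP[Nn /andP[M1n M2n]].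
  exists n; split=> //.
    have := hM2 n M2n; rewrite expr1n mul1r powRr1; last exact: ltW.
    by rewrite ler_pdivlMr// mulrC.
  have -> : \prod_(j < n) ((1 + c) * ps j * q (kappa j)) =
     (1 + c) ^+ n * \prod_(j < n) (q (kappa j) * ps j).
    by rewrite -prod_scale; apply: eq_bigr => j _; ring.
  have := hM1 n M1n; rewrite ler_pdivlMr// => h1.
  apply: le_trans h1; rewrite exprMn.
  have -> : 2 * ((1 + c) * ps n) = 2 * (1 + c) * ps n by ring.
  rewrite powRM ?(ltW (ps0 n)) ?(ltW c2) ?(ltW c5)//.
  have sE : ps n `^ (s - s1) = ps n `^ (- s1) * ps n `^ s.
    by rewrite addrC powRD//; apply/implyP => _; rewrite gt_eqF.
  rewrite sE; set V := _ `^ (- s1) in hn *; set W := ps n `^ s.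
  set P := \prod_(j < n) _ in hn *.
  have W0 : 0 < W by exact: powR_gt0.
  have -> : 5 ^+ n * q (kappa n) * ((1 + c) ^+ n * P) * ((2 * (1 + c)) `^ s * W) =
    (5 ^+ n * (1 + c) ^+ n * W * (2 * (1 + c)) `^ s) * (q (kappa n) * P) by ring.
  have -> : 5 ^+ n * (1 + c) ^+ n * (V * W) * (2 * (1 + c)) `^ s =
    (5 ^+ n * (1 + c) ^+ n * W * (2 * (1 + c)) `^ s) * V by ring.
  by rewrite ler_pM2l// !mulr_gt0// exprn_gt0.
Qed.

(** The hypothesis uses a product over all indices, hence no enumeration: it concerns the indices
    relevant for psi, whereas the construction has to enumerate those relevant for c psi. *)
Lemma slow_dim_ge (k0 K2 : nat) (c s s2 : R) :
  0 < c -> c <= 1 -> 0 < s -> s < s2 -> s2 <= 1 -> (K0 <= k0)%N ->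
  (forall k, (K2 <= k)%N -> psi (Y k) < (q k)^-1 ->
     psi (Y k) `^ (- s2) <= q k * \prod_(k0 <= j < k) Num.min 1 (q j * psi (Y j))) ->
  (s%:E <= hausdorff_dim (approx_set alpha (scaled c)))%E.
Proof.
move=> c0 c1 s0 ss2 s21 k0K big.
have s1 : s < 1 by lra.
(* c/8 is the product of the factor c/2 in the radius allowed by [approx_ball] and the loss 1/4 per
   level in [grid_dim_ge]. In C, the term 16/c provides the 4 successors per level, and the other
   one makes gam (sn n q)^(1-s) >= 1, with q the next denominator, at indices relevant for c psi
   only. *)
pose gam := c / 8; have gam0 : 0 < gam by rewrite /gam; lra.
pose C := Num.max (16 / c) (2 * (gam^-1 `^ (1 - s)^-1)).
have Cc : 16 / c <= C by rewrite le_max lexx.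
have Cg : 2 * (gam^-1 `^ (1 - s)^-1) <= C by rewrite le_max lexx orbT.
have c16 : 16 <= 16 / c by rewrite ler_pdivlMr//; lra.
have C0 : 0 < C by lra.
have [K [KK0 hK]] := slow_large (C / c).
have CCc : C <= C / c by rewrite ler_pdivlMr// ler_piMr// ltW.
pose k1 := maxn (maxn K K2) (maxn k0 4).
have k1P k : (k1 <= k)%N -> [/\ (K <= k)%N, (K2 <= k)%N, (k0 <= k)%N & (4 <= k)%N].
  by rewrite /k1 !geq_max => /andP[/andP[? ?] /andP[? ?]].
have kK0 k : (k1 <= k)%N -> (K0 <= k)%N by move=> /k1P[h _ _ _]; exact: leq_trans h.
have q0 k := cf_denomR_gt0 alpha_irr k.
have large k : (k1 <= k)%N ->
    [/\ C * q k <= Y k, C * d k <= psi (Y k) & C / c * d k <= psi (d k)^-1].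
  move=> kk; have [Kk _ _ _] := k1P k kk; have [h1 h2 h3] := hK k Kk.
  have d0 := ltW (cf_dist_gt0 alpha_irr (index_gt0 (kK0 k kk))).
  split=> //; first by apply: le_trans h1; rewrite ler_pM2r.
  by apply: le_trans h2; rewrite ler_wpM2r.
pose sg k := Num.min (psi (Y k)) (q k)^-1.
have sg0 k : (k1 <= k)%N -> 0 < sg k.
  by move=> kk; rewrite lt_min invr_gt0 q0 andbT; apply: psi_gt0; apply: Y_gt0; exact: kK0.
(* For c < 1 the indices relevant for c psi may exceed those for psi; at the
   additional ones sg k = 1/q_k, so that they do not change P, and w grows there. *)
pose S' := [set k | (k1 <= k)%N /\ c * psi (d k)^-1 < (q k)^-1].
have free k (x T : R) : (k1 <= k)%N -> ~ S' k -> q k <= T -> T <= q k.+1 ->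
  exists n : int, `|n|%:~R <= T /\
    circle_norm (to_circle (n%:~R * alpha) - to_circle x) <= c * psi T.
  move=> kk Sk; apply: approx_free => //; first exact: index_gt0 (kK0 k kk).
  by rewrite leNgt; apply/negP => h; apply: Sk.
(* If only finitely many indices are relevant for c psi, every point of the circle belongs to the
   set. *)
have [unb|bdd] := pselect (forall n, exists2 k, S' k & (n <= k)%N); last first.
  have {bdd} [N hN] : exists N, forall k, (N <= k)%N -> ~ S' k.
    apply: contrapT => nex; apply: bdd => n; apply: contrapT => h; apply: nex.
    by exists n => k nk Sk; apply: h; exists k.
  apply: hausdorff_dim_full; first exact: s0.
    by lra.
  move=> x; apply: (@approx_setP _ _ (maxn k1 N)) => k T; rewrite geq_max => /andP[kk Nk].
  by apply: free => //; exact: hN.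
have [kappa kS] := increasing_enumeration_exists unb.
have kk1 n : (k1 <= kappa n)%N by have [] := enum_in kS n.
have klt n : (kappa n < kappa n.+1)%N by exact: enum_lt kS _ _ (ltnSn n).
have kgt0 n := index_gt0 (kK0 _ (kk1 n)).
have d0 n := cf_dist_gt0 alpha_irr (kgt0 n).
have sgd (C' : R) k : S' k -> 0 <= C' -> C' * d k <= psi (Y k) ->
    C' / c * d k <= psi (d k)^-1 -> C' * d k <= sg k.
  move=> [kk Sk] C'0 h1 h2; rewrite le_min h1 /=; apply: le_trans (ltW Sk).
  by rewrite -ler_pdivrMl// mulrC mulrAC.
have sgdC k : S' k -> C * d k <= sg k.
  by move=> Sk; have [kk _] := Sk; have [_ h1 h2] := large k kk; apply: sgd => //; exact: ltW.
have sgq k : sg k <= (q k)^-1 by rewrite ge_min lexx orbT.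
have sgY k : sg k <= psi (Y k) by rewrite ge_min lexx.
pose sn n := sg (kappa n).
have sn0 n : 0 < sn n by exact: sg0.
have sn2d n : 2 * d (kappa n) <= sn n.
  apply: le_trans (sgdC _ (enum_in kS n)); rewrite ler_pM2r//; lra.
have snq n : sn n <= (q (kappa n))^-1 by exact: sgq.
have sparse : forall C : R, exists N, forall n, (N <= n)%N -> C * sn n.+1 <= sn n.
  apply: level_sparse => // C'; have [K' [_ hK']] := slow_large (Num.max C' 0 / c).
  have [K'' [_ hK'']] := slow_large (Num.max C' 0).
  exists (maxn K' K'') => n; rewrite geq_max => /andP[Kn Kn''].
  have [_ _ h3] := hK' (kappa n) (leq_trans Kn (enum_ge kS n)).
  have [_ h2 _] := hK'' (kappa n) (leq_trans Kn'' (enum_ge kS n)).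
  apply: (@le_trans _ _ (Num.max C' 0 * d (kappa n))).
    by rewrite ler_pM2r// le_max lexx.
  by apply: sgd => //; [exact: enum_in|rewrite le_max lexx orbT].
have step n : C / 2 <= sn n * q (kappa n.+1).
  apply: level_step => //; first by lra.
  rewrite (_ : 2 * (C / 2) = C); last by field.
  exact: sgdC (enum_in kS n).
pose P n := \prod_(j < n) (q (kappa j) * sn j).
pose w n := gam ^+ n * (q (kappa n) * P n * sn n `^ s).
have P0 n : 0 < P n by apply: prodr_gt0 => j _; rewrite mulr_gt0.
have w0 n : 0 < w n by rewrite /w !mulr_gt0// ?exprn_gt0// powR_gt0.
have qsg k : q k * sg k = Num.min 1 (q k * psi (Y k)).
  by rewrite /sg minr_pMr ?(ltW (q0 k))// mulfV ?gt_eqF// minC.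
have PE n : P n = \prod_(k1 <= k < kappa n) Num.min 1 (q k * psi (Y k)).
  rewrite -(@enum_prod _ _ kS _ (fun k => Num.min 1 (q k * psi (Y k)))) //.
  - by apply: eq_bigr => j _; rewrite -qsg.
  - by move=> k [].
  - move=> k kk Sk; apply/min_idPl; rewrite -ler_pdivrMl// mulr1 leNgt; apply/negP.
    rewrite -(index_equiv (kK0 k kk)) => h; apply: Sk; split=> //.
    apply: le_lt_trans h; rewrite ler_piMl// ltW// psi_gt0// invr_gt0.
    exact: (cf_dist_gt0 alpha_irr (index_gt0 (kK0 k kk))).
have Pbig n : \prod_(k0 <= j < kappa n) Num.min 1 (q j * psi (Y j)) <= P n.
  have [_ _ k0k1 _] := k1P k1 (leqnn _).
  rewrite (@big_cat_nat _ _ _ k1)//= -PE ler_piMl ?(ltW (P0 n))//.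
  rewrite big_nat; apply: prodr_ile1 => j /andP[k0j _].
  rewrite ge_min lexx andbT le_min ler01 mulr_ge0 ?(ltW (q0 j))// ltW// psi_gt0// Y_gt0//.
  exact: leq_trans k0j.
(* A positive lower bound for w is, up to (c/2)^s, the counting condition of [grid_dim_ge]. At an
   index relevant for psi, [big] gives w >= 1, the difference s2 - s paying for gam^n; elsewhere w
   does not drop. *)
have [e e0 he] : exists2 e, 0 < e & forall n, e <= w n.
  have eta0 : 0 < s2 - s by lra.
  have gV0 : 0 < gam^-1 by rewrite invr_gt0.
  have [M hM] := geometric_slack sn0 gV0 eta0 ltr01 sparse.
  apply: (@positive_lower_bound _ w M) => // n Mn.
  have [kn|kn] := boolP (psi (Y (kappa n.+1)) < (q (kappa n.+1))^-1); [left|right].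
    have [_ K2k _ _] := k1P _ (kk1 n.+1).
    have snE : sn n.+1 = psi (Y (kappa n.+1)) by apply/min_idPl; exact: ltW.
    have h1 := big _ K2k kn; rewrite -snE in h1.
    have h2 : sn n.+1 `^ (- s2) <= q (kappa n.+1) * P n.+1.
      by apply: (le_trans h1); rewrite ler_pM2l.
    have h3 := hM n.+1 (leqW Mn).
    have E : sn n.+1 `^ (- s2) * sn n.+1 `^ s = (sn n.+1 `^ (s2 - s))^-1.
      by rewrite -powRN opprB addrC powRD//; apply/implyP => _; rewrite gt_eqF.
    have p0 : 0 < sn n.+1 `^ (s2 - s) by exact: powR_gt0.
    rewrite /w; apply: (@le_trans _ _ (gam ^+ n.+1 * (sn n.+1 `^ (- s2) * sn n.+1 `^ s))).
      rewrite E ler_pdivlMr// mul1r.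
      by move: h3; rewrite exprVn ler_pdivrMl ?exprn_gt0// mulr1.
    by rewrite ler_pM2l ?exprn_gt0// ler_pM2r ?powR_gt0.
  have snE : sn n.+1 = (q (kappa n.+1))^-1 by apply/min_idPr; rewrite leNgt.
  have -> : w n.+1 = w n * (gam * (sn n * q (kappa n.+1)) `^ (1 - s)).
    rewrite /w /P big_ord_recr /= snE exprS.
    rewrite powRM ?(ltW (sn0 n)) ?(ltW (q0 _))// !powRB ?powRr1 ?(ltW (sn0 n)) ?(ltW (q0 _))//.
    + rewrite -powR_inv1 ?(ltW (q0 _))// -powRrM mulN1r powRN.
      by field; rewrite !gt_eqF// powR_gt0.
    + by apply/implyP => _; rewrite gt_eqF.
    + by apply/implyP => _; rewrite gt_eqF.
  apply: ler_peMr; first exact: ltW.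
  rewrite -ler_pdivrMl// mulr1.
  apply: (@le_trans _ _ ((gam^-1 `^ (1 - s)^-1) `^ (1 - s))).
    by rewrite -powRrM mulVf ?powRr1 ?invr_ge0 ?(ltW gam0)// gt_eqF// subr_gt0.
  apply: ge0_ler_powR; rewrite ?nnegrE ?powR_ge0 ?mulr_ge0 ?(ltW (sn0 n)) ?(ltW (q0 _))//; first by lra.
  by apply: le_trans (step n); lra.
have Cg0 : 0 < (e * (c / 2) `^ s)^-1 by rewrite invr_gt0 mulr_gt0// powR_gt0//; lra.
apply: (@grid_dim_ge _ (fun n => cf_denom alpha (kappa n)) (fun n => c / 2 * sn n) _ _ _ s (e * (c / 2) `^ s)^-1) => //.
- by move=> n; exact: cf_denom_gt0.
- by move=> n; rewrite mulr_gt0//; lra.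
- by lra.
- have [_ _ _ k4] := k1P _ (kk1 0%N).
  by apply: le_trans (cf_denom_ge alpha_irr _); rewrite lez_nat.
- move=> n; have : sn n * q (kappa n) <= 1 by rewrite -ler_pdivlMr// mul1r.
  have : 0 <= sn n * q (kappa n) by rewrite mulr_ge0 ?(ltW (sn0 n)) ?(ltW (q0 _)).
  by move=> h1 h2; rewrite -mulrA; nra.
- move=> n; have := step n; rewrite -mulrA => h.
  have : c / 2 * (C / 2) <= c / 2 * (sn n * q (kappa n.+1)) by rewrite ler_pM2l//; lra.
  have : 16 <= C * c by rewrite -ler_pdivrMr.
  by move=> h1; apply: le_trans; lra.
- move=> x hx; apply: (@approx_setP _ _ k1) => k T kk qT Tq.
  have [Sk|Sk] := pselect (S' k); last exact: free qT Tq.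
  have [n nk] := enum_surj kS Sk; have [p hp] := hx n.
  have [h1 h2 h3] := large k kk.
  have dk0 : 0 < d k by rewrite -nk.
  apply: (@approx_ball k c x T (sg k) p) => //; rewrite -?nk//; rewrite ?nk.
  + exact: kK0.
  + exact: sg0.
  + have : 16 / c * d k <= sg k by apply: le_trans (sgdC k Sk); rewrite ler_pM2r.
    by rewrite mulrAC ler_pdivrMr//; lra.
  + have : 16 * d k <= C * d k by rewrite ler_pM2r//; lra.
    by move: h3; rewrite mulrAC ler_pdivrMr//; lra.
  + apply: le_trans h1; rewrite ler_pM2r//; lra.
- move=> n; rewrite mulrC ler_pdivlMr ?mulr_gt0 ?powR_gt0//; last by lra.
  rewrite mul1r.
  have -> : \prod_(j < n) (c / 2 * sn j * q (kappa j) / 4) = gam ^+ n * P n.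
    by rewrite -prod_scale; apply: eq_bigr => j _; rewrite /gam; field.
  rewrite (@powRM _ (c / 2)) ?(ltW (sn0 n))//; last by lra.
  have := he n; rewrite /w => h.
  have -> : q (kappa n) * (gam ^+ n * P n) * ((c / 2) `^ s * sn n `^ s) =
    gam ^+ n * (q (kappa n) * P n * sn n `^ s) * (c / 2) `^ s by ring.
  by rewrite ler_pM2r// powR_gt0//; lra.
Qed.

End Slow.

(** * Rapidly decaying psi *)

Section Fast.

Hypothesis psi_fast : forall C : R, exists T1 : R,
  0 < T1 /\ forall T : R, T1 <= T -> C * (T * psi T) <= 1.
Hypothesis psi_quarter : exists C1 T1 : R,
  0 < C1 /\ forall T : R, T1 <= T -> psi (T / 4) <= C1 * psi T.

Lemma fast_large (C a : R) : 0 < a -> exists K, (K0 <= K)%N /\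
  forall k, (K <= k)%N -> C * (q k * psi (q k / a)) <= 1.
Proof.
move=> a0; have [T1 [_ hT]] := psi_fast (C * a).
have [K hK] := cf_denomR_unbounded alpha_irr (T1 * a).
exists (maxn K0 K); split; first exact: leq_maxl.
move=> k; rewrite geq_max => /andP[_ /hK Kk].
have := hT (q k / a); rewrite ler_pdivlMr// => /(_ Kk).
by rewrite (_ : C * a * _ = C * (q k * psi (q k / a)))//; field; rewrite gt_eqF.
Qed.

(** T / psi T increases, and at q_k it is q_k / psi (q_k) < q_k / d_k, its value at Y_k. *)
Lemma fast_Y_ge k : (K0 <= k)%N -> d k < psi (q k) -> q k <= Y k.
Proof.
move=> kK dk; rewrite leNgt; apply/negP => Yq; have E := YE kK.
have q0 := cf_denomR_gt0 alpha_irr k; have d0 := cf_dist_gt0 alpha_irr (index_gt0 kK).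
have h1 : psi (q k) < psi (Y k) by apply: psi_decr => //; exact: Y_gt0.
have : q k * d k < q k * psi (Y k) by rewrite ltr_pM2l//; lra.
by rewrite -E ltr_pM2r// ltNge (ltW Yq).
Qed.

Lemma fast_psiY_ge k : (K0 <= k)%N -> d k < psi (q k) -> d k <= psi (Y k).
Proof.
move=> kK dk; have q0 := cf_denomR_gt0 alpha_irr k.
rewrite -(ler_pM2l q0) -(YE kK) ler_pM2r ?(cf_dist_gt0 alpha_irr (index_gt0 kK))//.
exact: fast_Y_ge.
Qed.

(** Y_k d_k = q_k psi (Y_k) <= q_k psi (q_k) tends to 0, while d_k q_{k+1} > 1/2. *)
Lemma fast_Y_le (C : R) : 0 < C -> exists K, (K0 <= K)%N /\
  forall k, (K <= k)%N -> d k < psi (q k) -> C * Y k <= q k.+1.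
Proof.
move=> C0; have [K [KK0 hK]] := fast_large (2 * C) ltr01.
exists K; split=> // k Kk dk; have kK := leq_trans KK0 Kk.
have q0 := cf_denomR_gt0 alpha_irr k; have d0 := cf_dist_gt0 alpha_irr (index_gt0 kK).
have := hK k Kk; rewrite divr1 => h.
have := cf_dist_gt alpha_irr (index_gt0 kK) => h2.
rewrite -(ler_pM2l d0).
have h3 : q k * psi (Y k) <= q k * psi (q k) by rewrite ler_pM2l// psi_le// fast_Y_ge.
by rewrite -(YE kK) -(ler_pM2l C0) in h3; lra.
Qed.

(** psi (Y_k') <= psi (q_{k+1}) is negligible against 1/q_{k+1} < 2 d_k. So the radius at a relevant
    index is far below the spacing at any earlier large index. *)
Lemma fast_psi_next (C : R) : 0 < C -> exists K, (K0 <= K)%N /\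
  forall k k', (K <= k)%N -> (k < k')%N -> d k' < psi (q k') ->
    C * psi (Y k') <= d k.
Proof.
move=> C0; have [K [KK0 hK]] := fast_large (2 * C) ltr01.
exists K; split=> // k k' Kk kk' dk'.
have kK := leq_trans KK0 Kk; have kK' : (K0 <= k')%N by apply: leq_trans kK (ltnW kk').
have q0 := cf_denomR_gt0 alpha_irr k.+1; have d0 := cf_dist_gt0 alpha_irr (index_gt0 kK).
have := hK k.+1 (leqW Kk); rewrite divr1 => h.
have h2 := cf_dist_gt alpha_irr (index_gt0 kK).
have h3 : psi (Y k') <= psi (q k.+1).
  apply: psi_le => //; apply: le_trans (fast_Y_ge kK' dk').
  exact: cf_denomR_le.
rewrite -(ler_pM2l q0); rewrite -(ler_pM2l q0) in h3; rewrite -(ler_pM2l C0) in h3.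
lra.
Qed.

(* Otherwise the remainder r of n modulo q_k would be nonzero, and r alpha closer
   to 0 than d_(k-1). *)
Lemma return_multiple j (n : int) (e : R) : (1 < j)%N ->
  4 * `|n|%:~R <= q j + q j.+1 -> dist_int (n%:~R * alpha) <= e ->
  16 * (q j * e) <= 1 ->
  exists2 m : int, n = m * cf_denom alpha j & `|m|%:~R * d j <= e.
Proof.
case: j => [//|j] j1; set k := j.+1 => nq ne qe.
have k0 : (0 < k)%N by [].
have q0 := cf_denomR_gt0 alpha_irr k; have q1 := cf_denomR_gt0 alpha_irr k.+1.
have d0 := cf_dist_gt0 alpha_irr k0; have dq := cf_dist_lt alpha_irr k0.
have qq := cf_denomR_le alpha_irr (leqnSn k).
have e0 : 0 <= e.
  by apply: le_trans ne; have [m ->] := dist_int_attained (n%:~R * alpha).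
have [n0|n0] := eqVneq n 0.
  by exists 0; rewrite ?mul0r// n0 normr0 mul0r.
have de : d k <= e.
  apply: le_trans ne; apply: cf_best => //.
  rewrite -(ltr_int R); lra.
have [m nm] := centered_rem n (cf_denom_gt0 alpha_irr k).
set r := n - _ in nm.
have nE : n = m * cf_denom alpha k + r by rewrite /r addrC subrK.
clearbody r.
have rR : 2 * `|r|%:~R <= q k :> R by rewrite -[2]/(2%:~R) -intrM ler_int.
have mq : `|m|%:~R * q k <= `|n|%:~R + `|r|%:~R :> R.
  rewrite -intrM -intrD ler_int -{1}(gtr0_norm (cf_denom_gt0 alpha_irr k)) -normrM.
  by rewrite (_ : m * _ = n - r); [exact: ler_normB|rewrite nE addrK].
have dq2 : d k * q k <= 1 / 16.
  have : d k * q k <= e * q k by rewrite ler_pM2r.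
  lra.
have md : 4 * (`|m|%:~R * d k * q k) <= 1 + 3 * (d k * q k).
  rewrite -(ler_pM2r d0) in mq; rewrite -(ler_pM2r d0) in rR.
  rewrite -(ler_pM2r d0) in nq; lra.
pose t := q k * alpha - (cf_num alpha k)%:~R.
have td : `|t| = d k by exact: cf_offset.
have mt : `|m%:~R * t| = `|m|%:~R * d k by rewrite normrM td intr_norm.
have q2 : 1 <= q k by exact: cf_denomR_ge1.
have r0 : r = 0.
  apply/eqP; apply: contraT => rn0.
  have rq : `|r| < cf_denom alpha j.+1.
    by rewrite -(ltr_int R); lra.
  have h1 := cf_best alpha_irr (k := j) j1 rn0 rq.
  have [m' nm'] := dist_int_attained (n%:~R * alpha).
  have h2 : dist_int (r%:~R * alpha) <= e + `|m|%:~R * d k.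
    apply: (le_trans (dist_int_le _ (m' - m * cf_num alpha k))).
    rewrite -mt; move: ne; rewrite nm' => ne.
    rewrite (_ : _ - _ = (n%:~R * alpha - m'%:~R) - m%:~R * t).
      by apply: (le_trans (ler_normB _ _)); rewrite lerD2r.
    by rewrite /t nE intrB intrD !intrM; ring.
  (* Multiplied by q_k, with d_(k-1) q_k > 1/2 on the left, the inequality would give 1/2 < 1/16 +
     (1 + 3/16)/4; this is what the constants 4 and 16 are for. *)
  have dp := cf_dist_gt alpha_irr (k := j) j1; have h3 := le_trans h1 h2.
  by rewrite -(ler_pM2r q0) in h3; lra.
exists m; first by rewrite nE r0 addr0.
have m2 : `|m|%:~R * d k <= 1 / 2.
  have : `|m|%:~R * d k * 1 <= `|m|%:~R * d k * q k.
    by rewrite ler_wpM2l// mulr_ge0 ?(ltW d0)// ler0z.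
  lra.
rewrite -mt; apply: le_trans ne.
rewrite (_ : n%:~R * alpha = m%:~R * t + (m * cf_num alpha k)%:~R).
  by rewrite dist_int_intD (@dist_int_small _ _ 0) subr0// mt.
by rewrite nE r0 addr0 /t !intrM; ring.
Qed.

(** The points are sums of m_k d_k over relevant k, with m_k d_k at most a fixed multiple of psi
    (Y_k). By [YE], m_k q_k is at most the same multiple of Y_k, so the partial sum up to k may be
    used for all T >= Y_k. The remainder is at most c psi (Y_k') for the next relevant k', so it may
    be used until T = Y_k'. *)
Lemma fast_dim_ge (k0 N2 : nat) (kappa : nat -> nat) (c s s2 : R) :
  0 < c -> c <= 1 -> 0 < s -> s <= 1 -> s < s2 -> (K0 <= k0)%N ->
  increasing_enumeration [set k | (k0 <= k)%N /\ d k < psi (q k)] kappa ->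
  (forall n, (N2 <= n)%N -> psi (Y (kappa n)) `^ (- s2) <=
     \prod_(j < n) (psi (Y (kappa j)) / d (kappa j))) ->
  (s%:E <= hausdorff_dim (approx_set alpha (scaled c)))%E.
Proof.
move=> c0 c1 s0 s1 ss2 k0K kS big.
have f4 : 0 < 4 :> R by [].
have [Ka [_ hKa]] := fast_Y_le f4.
have [Kb [_ hKb]] := fast_psi_next f4.
(* Dropping the first M relevant indices separates consecutive scales by a factor 4. The successor
   leaves one large relevant index before [kap 0], which forces ps 0 <= 1. *)
pose M := (maxn N2 (maxn Ka Kb)).+1.
have MP : [/\ (N2 <= M)%N, (Ka <= M)%N & (Kb <= M.-1)%N].
  have : (maxn N2 (maxn Ka Kb) <= M.-1)%N by [].
  by rewrite !geq_max => /andP[? /andP[? ?]]; split=> //; exact: leqW.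
case: MP => MN2 MKa MKb.
pose kap n := kappa (M + n)%N.
have kin n : (k0 <= kappa n)%N /\ d (kappa n) < psi (q (kappa n)) := enum_in kS n.
have kK n : (K0 <= kappa n)%N by have [h _] := kin n; exact: (leq_trans k0K h).
have kge n : (n <= kappa n)%N := enum_ge kS n.
have kapS n : (kap n < kap n.+1)%N.
  by apply: (enum_lt kS); rewrite ltn_add2l.
have q0 k : 0 < q k := cf_denomR_gt0 alpha_irr k.
pose ps n := psi (Y (kap n)); pose dd n := d (kap n).
have kapK n : (K0 <= kap n)%N := kK (M + n)%N.
have kapP n : d (kap n) < psi (q (kap n)) := (kin (M + n)%N).2.
have Y0 n : 0 < Y (kap n) := Y_gt0 (kapK n).
have ps0 n : 0 < ps n := psi_gt0 (Y0 n).
have dd0 n : 0 < dd n := cf_dist_gt0 alpha_irr (index_gt0 (kapK n)).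
have psd n : dd n <= ps n := fast_psiY_ge (kapK n) (kapP n).
have MKn n : (Kb <= kappa (M + n)%N)%N.
  by apply: leq_trans (kge _); apply: leq_trans (leq_addr _ _); apply: leq_trans MKb (leq_pred _).
have psn n : 4 * ps n.+1 <= dd n.
  exact: hKb (MKn n) (kapS n) (kapP n.+1).
have Yn n : 4 * Y (kap n) <= Y (kap n.+1).
  apply: (@le_trans _ _ (q (kap n).+1)).
    apply: hKa (kapP n).
    exact: leq_trans MKa (leq_trans (leq_addr _ _) (kge _)).
  apply: (@le_trans _ _ (q (kap n.+1))); first exact: cf_denomR_le.
  exact: fast_Y_ge (kapK _) (kapP _).
have ps1 : ps 0%N <= 1.
  have h : 4 * ps 0%N <= d (kappa M.-1).
    apply: hKb (leq_trans MKb (kge _)) _ (kapP 0%N).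
    by rewrite /kap addn0; exact: (enum_lt kS).
  have k0' := index_gt0 (kK M.-1).
  have d1 := cf_dist_lt alpha_irr k0'; have d0 := cf_dist_gt0 alpha_irr k0'.
  have : d (kappa M.-1) * 1 <= d (kappa M.-1) * q (kappa M.-1).+1.
    by rewrite ler_pM2l//; exact: cf_denomR_ge1.
  have := ps0 0%N; lra.
have psdec n : ps n.+1 <= ps n / 2 by have := psn n; have := psd n; have := ps0 n.+1; lra.
(* A quarter of c keeps the remainder 2 h n below c psi (Y), and cc <= 1/4 keeps the sum of the
   multipliers below Y. *)
pose cc := c / 4; have cc0 : 0 < cc by rewrite /cc; lra.
have cc4 : cc <= 1 / 4 by rewrite /cc; lra.
pose m n := `|Num.floor (cc * ps n / dd n)|.+1.
have x0 n : 0 <= cc * ps n / dd n by rewrite divr_ge0 ?mulr_ge0// ltW.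
have mE n : (m n)%:R = (Num.floor (cc * ps n / dd n))%:~R + 1 :> R.
  rewrite /m -natr1 -[`|_|%:R]/((`|_|%N%:Z)%:~R) gez0_abs// floor_ge_int; exact: x0.
have m_le n : ((m n)%:R - 1) * dd n <= cc * ps n.
  by rewrite mE addrK -ler_pdivlMr//; exact: floor_le.
have m_ge n : cc * ps n / dd n <= (m n)%:R.
  by rewrite mE; have := floorD1_gt (cc * ps n / dd n); rewrite intrD => /ltW.
have m0 n : (0 < m n)%N by [].
clearbody m.
pose F (n : nat) (x : R) := x; pose h n := cc * ps n.
have F_le n (x : R) : F n x + ((m n)%:R - 1) * dd n <= x + h n by rewrite lerD2l.
have h_half n : h n.+1 <= h n / 2 by rewrite /h -mulrA ler_pM2l.
have h_gap n : 4 * h n.+1 <= dd n.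
  have := psn n; have := ps0 n.+1; rewrite /h => p0.
  have : cc * ps n.+1 <= 1 * ps n.+1 by rewrite ler_pM2r//; lra.
  lra.
have sparse : forall C : R, exists N, forall n, (N <= n)%N -> C * ps n.+1 <= ps n.
  move=> C; have C0 : 0 < Num.max C 1 by rewrite lt_max ltr01 orbT.
  have [K' [_ hK']] := fast_psi_next C0; exists K' => n' Kn'.
  apply: (@le_trans _ _ (Num.max C 1 * ps n'.+1)).
    by rewrite ler_pM2r// le_max lexx.
  apply: (le_trans _ (psd n')); apply: hK' (kapS n') (kapP n'.+1).
  by apply: leq_trans Kn' _; apply: leq_trans (leq_addl _ _) (kge _).
(* The difference s2 - s pays for the factor cc^n lost in the numbers of digits. *)
have [e e0 he] : exists2 e : R, 0 < e & forall n, e <= cc ^+ n * (ps n `^ (s2 - s))^-1.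
  have eta0 : 0 < s2 - s by rewrite subr_gt0.
  have cV : 0 < cc^-1 by rewrite invr_gt0.
  have [M' hM'] := geometric_slack ps0 cV eta0 ltr01 sparse.
  apply: (@positive_lower_bound _ _ M') => [n|n Mn].
    by rewrite mulr_gt0 ?exprn_gt0 ?invr_gt0 ?powR_gt0.
  left; rewrite ler_pdivlMr ?powR_gt0// mul1r.
  by have := hM' n.+1 (leqW Mn); rewrite exprVn ler_pdivrMl ?exprn_gt0// mulr1.
pose P0 := \prod_(j < M) (psi (Y (kappa j)) / d (kappa j)).
have P00 : 0 < P0.
  apply: prodr_gt0 => j _; rewrite divr_gt0//; first exact: psi_gt0 (Y_gt0 (kK j)).
  exact: (cf_dist_gt0 alpha_irr (index_gt0 (kK j))).
pose P n := \prod_(j < n) (ps j / dd j).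
have Pbig n : ps n `^ (- s2) <= P0 * P n.
  have := big (M + n)%N (leq_trans MN2 (leq_addr _ _)).
  by rewrite big_split_ord.
have W n : cc ^+ n * P n <= (scheme_count m n)%:R.
  rewrite /scheme_count natr_prod /P -prod_scale; apply: ler_prod => j _.
  by rewrite mulrA m_ge andbT -mulrA mulr_ge0 ?divr_ge0// ltW.
pose C := P0 / (e * cc `^ s).
have C0 : 0 < C by rewrite divr_gt0// mulr_gt0// powR_gt0.
apply: (@scheme_dim _ F dd h m m0 dd0 _ F_le h_half h_gap s C s0 s1 C0) => //.
- move=> e' e'0; have e'2 : 0 < e' / 2 by rewrite divr_gt0.
  have [M' hM'] := half_cvg0 (N := 0) e'2 (fun n _ => psdec n).
  exists M'; have := hM' M' (leqnn _); have := m_le M'; have := psd M'; have := ps0 M' => a1 a2 a3 a4.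
  have : cc * ps M' <= 1 * ps M' by rewrite ler_pM2r//; lra.
  lra.
- move=> n.
  have a1 : cc `^ s * ps n `^ s <= ((m n)%:R * dd n) `^ s.
    rewrite -powRM ?(ltW cc0) ?(ltW (ps0 n))//; apply: ge0_ler_powR; rewrite ?nnegrE.
    + exact: ltW.
    + by rewrite mulr_ge0// ltW.
    + by rewrite mulr_ge0// ltW.
    + by rewrite -ler_pdivrMr.
  have a2 : 1 <= C * ((cc ^+ n * P n) * (cc `^ s * ps n `^ s)).
    have E : ps n `^ (- s2) * ps n `^ s = (ps n `^ (s2 - s))^-1.
      by rewrite -powRN opprB addrC powRD//; apply/implyP => _; rewrite gt_eqF.
    have b1 : (ps n `^ (s2 - s))^-1 <= P0 * P n * ps n `^ s.
      by rewrite -E ler_pM2r ?powR_gt0.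
    have b2 : e <= cc ^+ n * (P0 * P n * ps n `^ s).
      by apply: (le_trans (he n)); rewrite ler_pM2l ?exprn_gt0.
    rewrite [leRHS](_ : _ = (cc ^+ n * (P0 * P n * ps n `^ s)) / e).
      by rewrite ler_pdivlMr// mul1r.
    by rewrite /C; field; rewrite !gt_eqF ?powR_gt0.
  apply: (le_trans a2); rewrite ler_pM2l//; apply: ler_pM => //.
  + by rewrite mulr_ge0 ?exprn_ge0 ?(ltW cc0)// prodr_ge0// => j _; rewrite divr_ge0// ltW.
  + by rewrite mulr_ge0 ?powR_ge0.
- have : cc * ps 0%N <= cc * 1 by rewrite ler_pM2l.
  by rewrite /h; lra.
- move=> dg dgP x xb.
  have claim n : exists U V : int, scheme_point F dd dg n.+1 = U%:~R * alpha - V%:~R /\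
      `|U|%:~R <= Y (kap n).
    (* The scheme moves to the right only, whereas q_k alpha - p_k may be negative; then the digit
       multiplies -q_k. *)
    pose sgn k : int := if 0 <= q k * alpha - (cf_num alpha k)%:~R then 1 else -1.
    have sgnE k : (0 < k)%N -> d k = (sgn k)%:~R * (q k * alpha - (cf_num alpha k)%:~R).
      move=> k0'; rewrite -(cf_offset alpha_irr k0') /sgn; case: ifPn => h0.
        by rewrite mul1r ger0_norm.
      by rewrite ltr0_norm ?ltNge// mulN1r.
    have dgq k : `|dg k * cf_denom alpha (kap k)|%:~R <= cc * Y (kap k).
      have /andP[g0 gm] := dgP k.
      have gr : (dg k)%:~R <= (m k)%:R - 1 :> R.
        have : (dg k + 1)%:~R <= (m k)%:Z%:~R :> R by rewrite ler_int; lia.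
        by rewrite intrD -[(m k)%:Z%:~R]/((m k)%:R); lra.
      rewrite ger0_norm; last by rewrite mulr_ge0// ltW// cf_denom_gt0.
      rewrite intrM -(ler_pM2r (dd0 k)).
      have := m_le k => ml; have E := YE (kapK k).
      have h1 : (dg k)%:~R * dd k <= cc * ps k.
        by apply: le_trans ml; rewrite ler_pM2r.
      rewrite -(ler_pM2r (q0 (kap k))) in h1.
      rewrite -[cc * Y _ * _]mulrA /dd E -/(ps k) -/(dd k); lra.
    elim: n => [|n [U [V [UV Ub]]]].
      exists (sgn (kap 0%N) * (dg 0%N * cf_denom alpha (kap 0%N))).
      exists (sgn (kap 0%N) * dg 0%N * cf_num alpha (kap 0%N)); split.
        rewrite /= /F add0r /dd (sgnE _ (index_gt0 (kapK _))).
        by rewrite !intrM; ring.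
      rewrite normrM (_ : `|sgn _| = 1); last by rewrite /sgn; case: ifP.
      rewrite mul1r; apply: (le_trans (dgq 0%N)).
      by rewrite ler_piMl ?(ltW (Y0 _))//; lra.
    exists (U + sgn (kap n.+1) * (dg n.+1 * cf_denom alpha (kap n.+1))).
    exists (V + sgn (kap n.+1) * dg n.+1 * cf_num alpha (kap n.+1)); split.
      rewrite [LHS]/= -/(scheme_point F dd dg n.+1) /F UV /dd (sgnE _ (index_gt0 (kapK _))).
      by rewrite !intrD !intrM; ring.
    apply: (@le_trans _ _ (`|U|%:~R + cc * Y (kap n.+1))).
      apply: (@le_trans _ _ (`|U|%:~R + `|dg n.+1 * cf_denom alpha (kap n.+1)|%:~R)).
        rewrite -intrD ler_int; apply: (le_trans (ler_normD _ _)).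
        rewrite lerD2l normrM (_ : `|sgn _| = 1) ?mul1r//.
        by rewrite /sgn; case: ifP.
      by rewrite lerD2l.
    have : cc * Y (kap n.+1) <= 1 / 4 * Y (kap n.+1) by rewrite ler_pM2r.
    have := Yn n; have := Y0 n.+1; lra.
  exists (Y (kap 0%N)); split; first exact: num_real.
  move=> T /ltW T0.
  have [n [nT Tn]] : exists n, Y (kap n) <= T /\ T <= Y (kap n.+1).
    apply: (@seq_between _ (fun n => Y (kap n))) => //.
    have [N hN] := cf_denomR_unbounded alpha_irr (T + 1); exists N.
    have := hN (kap N) (leq_trans (leq_addl _ _) (kge _)).
    have := fast_Y_ge (kapK N) (kapP N).
    lra.
  have [U [V [UV Ub]]] := claim n; exists U; split; first exact: le_trans nT.
  apply: (le_trans (circle_norm_shift U V x)); rewrite -UV.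
  have /andP[x1 x2] := xb n.+1.
  rewrite distrC ger0_norm ?subr_ge0//.
  apply: (@le_trans _ _ (2 * h n.+1)); first by rewrite lerBlDl.
  have Tp : 0 < T by apply: lt_le_trans nT.
  have : c * ps n.+1 <= c * psi T by rewrite ler_pM2l//; exact: psi_le.
  have : 0 < c * ps n.+1 by rewrite mulr_gt0.
  rewrite /h /cc; lra.
Qed.

(** Up to constants, the number of possible m in a step by m q_k. The value 1 at irrelevant indices
    lets its product run over all of them. *)
Definition branching (k : nat) : R :=
  if d k < psi (q k) then psi (Y k) / d k else 1.

Lemma branching_ge1 k : (K0 <= k)%N -> 1 <= branching k.
Proof.
move=> kK; rewrite /branching; case: ifPn => // dk.
rewrite ler_pdivlMr ?mul1r; last exact: (cf_dist_gt0 alpha_irr (index_gt0 kK)).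
exact: fast_psiY_ge.
Qed.

(** A constant factor at every index would be too expensive, since irrelevant indices may be
    frequent. The power of q_{k+1}/q_k replaces it, and its products telescope. *)
Lemma fast_transitions (c eta : R) : 0 < c -> 0 < eta -> exists K, (K0 <= K)%N /\
  forall k, (K <= k)%N -> exists L : seq int,
    (size L)%:R <= (q k.+1 / q k) `^ eta * branching k /\
    forall m : int, `|m|%:~R * d k <= 2 * c * psi (q k / 4) ->
      (d k < psi (q k) -> `|m|%:~R * d k <= (2 + 2 * c) * psi (Y k)) -> m \in L.
Proof.
move=> c0 eta0; have [C1 [T1 [C10 hT1]]] := psi_quarter.
have [K1 hK1] := cf_denomR_unbounded alpha_irr T1.
have cC : 0 < c * C1 by rewrite mulr_gt0.
pose B := 5 + 4 * c + 4 * (c * C1); have B0 : 0 < B by rewrite /B; lra.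
pose X := B `^ eta^-1; have X0 : 0 < X by rewrite powR_gt0.
have f4 : 0 < 4 :> R by [].
have [K2 [K2K hK2]] := fast_large (2 * X * (2 * c + 1)) f4.
exists (maxn K1 K2); split; first by rewrite leq_max K2K orbT.
move=> k; rewrite geq_max => /andP[kK1 kK2]; have kK := leq_trans K2K kK2.
have q0 := cf_denomR_gt0 alpha_irr k; have q1 := cf_denomR_gt0 alpha_irr k.+1.
have d0 := cf_dist_gt0 alpha_irr (index_gt0 kK).
have qq : 1 <= q k.+1 / q k by rewrite ler_pdivlMr// mul1r; exact: cf_denomR_le.
have p4 : 0 < psi (q k / 4) by apply: psi_gt0; rewrite divr_gt0.
(* If d_k is larger than this then m = 0; otherwise q_(k+1)/q_k is large and absorbs the
   constant B. *)
have crit : d k <= (2 * c + 1) * psi (q k / 4) -> B <= (q k.+1 / q k) `^ eta.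
  move=> dk; have -> : B = X `^ eta.
    by rewrite /X -powRrM mulVf ?powRr1 ?(ltW B0)// gt_eqF.
  apply: ge0_ler_powR; rewrite ?nnegrE ?(ltW eta0) ?(ltW X0)//.
    by rewrite divr_ge0 ?(ltW q0) ?(ltW q1).
  rewrite ler_pdivlMr//; have h1 := hK2 k kK2.
  have h2 := cf_dist_gt alpha_irr (index_gt0 kK).
  have h3 : d k * q k.+1 <= (2 * c + 1) * psi (q k / 4) * q k.+1 by rewrite ler_pM2r.
  have w0 : 0 < (2 * c + 1) * psi (q k / 4) by rewrite mulr_gt0//; lra.
  rewrite -(ler_pM2r w0); lra.
have [kS|kS] := boolP (d k < psi (q k)).
  have py := fast_psiY_ge kK kS; have bk : 1 <= psi (Y k) / d k by rewrite ler_pdivlMr ?mul1r.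
  have [L [Ls Lm]] := @near_ints R 0 ((2 + 2 * c) * (psi (Y k) / d k)) ltac:(apply: mulr_ge0; lra).
  exists L; split.
    rewrite /branching kS; apply: (le_trans Ls); apply: (@le_trans _ _ (B * (psi (Y k) / d k))).
      have : 0 <= c * C1 * (psi (Y k) / d k) by rewrite mulr_ge0 ?(ltW cC)//; lra.
      by rewrite /B; lra.
    rewrite ler_pM2r; last by lra.
    apply: crit; apply: (le_trans (ltW kS)); apply: (@le_trans _ _ (psi (q k / 4))).
      by apply: psi_le; lra.
    by rewrite ler_peMl ?(ltW p4)//; lra.
  move=> m _ /(_ isT) h; apply: Lm; rewrite subr0 -intr_norm mulrA ler_pdivlMr//.
have dk : psi (q k) <= d k by rewrite leNgt.
rewrite /branching (negPf kS) mulr1.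
(* At an irrelevant index psi (q_k / 4) <= C1 psi (q_k) <= C1 d_k, so m is bounded by 2 c C1; if d_k
   exceeds 2 c psi (q_k / 4), only m = 0 is left. *)
have [dc|dc] := leP (d k) (2 * c * psi (q k / 4)).
  have [L [Ls Lm]] := @near_ints R 0 (2 * c * C1) ltac:(lra).
  exists L; split.
    apply: (le_trans Ls); apply: (@le_trans _ _ B); first by rewrite /B; lra.
    by apply: crit; lra.
  move=> m h _; apply: Lm; rewrite subr0 -intr_norm -(ler_pM2r d0); apply: (le_trans h).
  have := hT1 (q k) (hK1 k kK1) => h1.
  have : 2 * c * psi (q k / 4) <= 2 * c * (C1 * d k).
    rewrite ler_pM2l; last by lra.
    by apply: (le_trans h1); rewrite ler_pM2l.
  lra.
exists [:: 0]; split.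
  by have := ler_powR qq (ltW eta0); rewrite powRr0.
move=> m h _; rewrite inE; apply: contraT => m0.
have : 1 <= `|m|%:~R :> R by rewrite ler1z -gtz0_ge1 normr_gt0.
rewrite -(ler_pM2r d0) mul1r => h1; have := le_lt_trans (le_trans h1 h) dc.
by rewrite ltxx.
Qed.

(** With the threshold q_N / 4 the times T = q_k / 4, k >= N, are available. Approximants at two
    consecutive ones differ by at most (q_k + q_{k+1}) / 4, as [return_multiple] requires. *)
Definition approx_tail (c : R) (N : nat) : set (circle R) :=
  [set b | forall T : R, q N / 4 <= T -> exists u : int,
     `|u|%:~R <= T /\ circle_norm (to_circle (u%:~R * alpha) - b) <= c * psi T].

Lemma approx_set_tails (c : R) :
  approx_set alpha (scaled c) `<=` \bigcup_N approx_tail c N.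
Proof.
move=> b [T0 [_ hT]]; have [N hN] := cf_denomR_unbounded alpha_irr ((T0 + 1) * 4).
exists N => // T NT; apply: hT; have := hN N (leqnn _); lra.
Qed.

Lemma dist_int_return (n m : int) (b : circle R) (e e' : R) :
  circle_norm (to_circle (n%:~R * alpha) - b) <= e ->
  circle_norm (to_circle (m%:~R * alpha) - b) <= e' ->
  dist_int ((m - n)%:~R * alpha) <= e + e'.
Proof.
move=> hn hm; rewrite -circle_norm_pi intrB mulrBl to_circleB.
rewrite (_ : _ - _ = - (to_circle (n%:~R * alpha) - b) + (to_circle (m%:~R * alpha) - b)).
  by apply: (le_trans (circle_normD _ _)); rewrite circle_normN lerD.
by rewrite opprB [RHS]addrC addrA subrK.
Qed.

(** Compare u with an approximant w at T = Y_k: w - u = m q_k by [return_multiple], and |w - u| <= 2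
    Y_k. Then [YE] gives |m| d_k <= 2 psi (Y_k), so u is almost as good as w. *)
Lemma fast_center (c : R) : 0 < c -> exists K, (K0 <= K)%N /\
  forall N k b (u : int), (K <= k)%N -> (N <= k)%N -> approx_tail c N b ->
    d k < psi (q k) -> `|u|%:~R <= q k / 4 ->
    circle_norm (to_circle (u%:~R * alpha) - b) <= c * psi (q k / 4) ->
    circle_norm (to_circle (u%:~R * alpha) - b) <= (2 + c) * psi (Y k).
Proof.
move=> c0; have f4 : 0 < 4 :> R by [].
have [K1 [K1K hK1]] := fast_large (16 * (2 * c)) f4.
have [K2 [K2K hK2]] := fast_Y_le f4.
exists (maxn 2 (maxn K1 K2)); split; first by rewrite !leq_max K1K orbT.
move=> N k b u; rewrite !geq_max => /andP[k2 /andP[kK1 kK2]] Nk Ab kS uq ub.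
have kK := leq_trans K1K kK1; have q0 := cf_denomR_gt0 alpha_irr k.
have d0 := cf_dist_gt0 alpha_irr (index_gt0 kK).
have qY := fast_Y_ge kK kS; have Yq := hK2 k kK2 kS.
have qN := cf_denomR_le alpha_irr Nk.
have [w [wY wb]] := Ab (Y k) ltac:(lra).
have pY : psi (Y k) <= psi (q k / 4) by apply: psi_le; lra.
have p0 : 0 < psi (Y k) by apply: psi_gt0; exact: Y_gt0.
have cpY : c * psi (Y k) <= c * psi (q k / 4) by rewrite ler_pM2l.
have nb := dist_int_return ub wb.
have nR : `|w - u|%:~R <= Y k + q k / 4 :> R.
  apply: (@le_trans _ _ (`|w|%:~R + `|u|%:~R)); last by rewrite lerD.
  by rewrite -intrD ler_int; exact: ler_normB.
have [m nm _] : exists2 m : int, w - u = m * cf_denom alpha k & `|m|%:~R * d k <= 2 * c * psi (q k / 4).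
  apply: return_multiple => //; [lra|lra|].
  have := hK1 k kK1; lra.
have md : `|m|%:~R * d k <= 2 * psi (Y k).
  have mq : `|m|%:~R * q k <= 2 * Y k.
    have -> : `|m|%:~R * q k = `|w - u|%:~R.
      by rewrite nm normrM (gtr0_norm (cf_denom_gt0 alpha_irr k)) intrM.
    lra.
  have E := YE kK; rewrite -(ler_pM2r q0).
  rewrite -(ler_pM2r d0) in mq; lra.
have := dist_int_le ((w - u)%:~R * alpha) (m * cf_num alpha k) => nle.
have nd : dist_int ((w - u)%:~R * alpha) <= `|m|%:~R * d k.
  apply: (le_trans nle); rewrite -(cf_offset alpha_irr (index_gt0 kK)) intr_norm -normrM.
  by rewrite nm !intrM (_ : _ - _ = m%:~R * (q k * alpha - (cf_num alpha k)%:~R)) //; ring.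
rewrite (_ : to_circle _ - b = (to_circle (w%:~R * alpha) - b) - to_circle ((w - u)%:~R * alpha)).
  apply: (le_trans (circle_normD _ _)); rewrite circle_normN circle_norm_pi; lra.
by rewrite intrB mulrBl to_circleB opprB [RHS]addrC addrA subrK.
Qed.

(** The branches of the tree are the sequences of approximants of b at the times q_k / 4;
    consecutive ones differ by a multiple of q_k from the list of [fast_transitions]. The sizes
    telescope, and A accounts for the start of the tree at M. *)
Lemma fast_cover (c eta : R) (k0 : nat) : 0 < c -> 0 < eta -> (K0 <= k0)%N ->
  exists K, (k0 <= K)%N /\ forall N, exists2 A : R, 0 < A &
  forall k, (K <= k)%N -> (N <= k)%N -> exists L : seq int,
    (size L)%:R <= A * (q k `^ eta * \prod_(k0 <= j < k) branching j) /\
    forall b, approx_tail c N b -> exists2 u, u \in L &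
      circle_norm (to_circle (u%:~R * alpha) - b) <= c * psi (q k / 4) /\
      (d k < psi (q k) ->
       circle_norm (to_circle (u%:~R * alpha) - b) <= (2 + c) * psi (Y k)).
Proof.
move=> c0 eta0 k0K; have f4 : 0 < 4 :> R by [].
have [K1 [K1K hK1]] := fast_transitions c0 eta0.
have [K2 [K2K hK2]] := fast_center c0.
have [K3 [K3K hK3]] := fast_large (16 * (2 * c)) f4.
have [K4 [K4K hK4]] := fast_Y_le f4.
pose K := maxn (maxn k0 2) (maxn (maxn K1 K2) (maxn K3 K4)).
have KP k : (K <= k)%N -> [/\ (k0 <= k)%N, (1 < k)%N & [/\ (K1 <= k)%N, (K2 <= k)%N, (K3 <= k)%N & (K4 <= k)%N]].
  by rewrite /K !geq_max => /andP[/andP[? ?] /andP[/andP[? ?] /andP[? ?]]].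
exists K; split; first by have [] := KP K (leqnn _).
move=> N; pose M := maxn N K.
pose W k := q k `^ eta * \prod_(k0 <= j < k) branching j.
have q0 k : 0 < q k := cf_denomR_gt0 alpha_irr k.
have br0 k : (k0 <= k)%N -> 0 < branching k.
  by move=> kk; apply: lt_le_trans (branching_ge1 (leq_trans k0K kk)).
have W0 k : 0 < W k.
  rewrite mulr_gt0 ?powR_gt0// big_nat; apply: prodr_gt0 => j /andP[jk _]; exact: br0.
have MiK i : (K <= M + i)%N by apply: leq_trans (leq_addr _ _); rewrite leq_maxr.
have MiN i : (N <= M + i)%N by apply: leq_trans (leq_addr _ _); rewrite leq_maxl.
have WS k : (K <= k)%N -> W k.+1 / W k = (q k.+1 / q k) `^ eta * branching k.
  move=> Kk; have [k0k _ _] := KP k Kk.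
  rewrite /W big_nat_recr//=.
  have -> : (q k.+1 / q k) `^ eta = q k.+1 `^ eta / q k `^ eta.
    rewrite powRM ?invr_ge0 ?(ltW (q0 _))//; congr (_ * _).
    by rewrite -powR_inv1 ?(ltW (q0 _))// powRAC powR_inv1// powR_ge0.
  have := W0 k; rewrite /W pmulr_rgt0 ?powR_gt0// => P0.
  by field; rewrite !gt_eqF// powR_gt0.
have WT i : \prod_(j < i) (W (M + j).+1 / W (M + j)%N) = W (M + i)%N / W M.
  elim: i => [|i IH]; first by rewrite big_ord0 addn0 divff// gt_eqF.
  by rewrite big_ord_recr /= IH addnS mulrC mulrA mulfVK// gt_eqF.
have [L0 [_ L0m]] := @near_ints R 0 (q M / 4) (divr_ge0 (ltW (q0 M)) (ler0n _ _)).
have /choice[Lm LmP] : forall i, exists L : seq int,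
    (size L)%:R <= (q (M + i).+1 / q (M + i)%N) `^ eta * branching (M + i)%N /\
    forall m : int, `|m|%:~R * d (M + i)%N <= 2 * c * psi (q (M + i)%N / 4) ->
      (d (M + i)%N < psi (q (M + i)%N) ->
       `|m|%:~R * d (M + i)%N <= (2 + 2 * c) * psi (Y (M + i)%N)) -> m \in L.
  by move=> i; apply: hK1; have [_ _ []] := KP _ (MiK i).
pose ch i (u : int) := [seq u + m * cf_denom alpha (M + i)%N | m <- Lm i].
exists ((size L0)%:R / W M + 1); first by rewrite ltr_wpDl// divr_ge0// ltW.
move=> k Kk Nk; have Mk : (M <= k)%N by rewrite geq_max Nk Kk.
exists (tree ch L0 (k - M)); split.
  apply: (@le_trans _ _ ((size L0)%:R / W M * W k)); last by rewrite ler_pM2r// lerDl.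
  rewrite -{2}(subnKC Mk) -mulrA -[_^-1 * _]mulrC -WT.
  apply: (@size_tree _ ch L0 (fun j => W (M + j).+1 / W (M + j)%N)) => j u.
  by rewrite size_map WS//; have [] := LmP j.
move=> b Ab.
have /choice[v vP] : forall i, exists u : int, `|u|%:~R <= q (M + i)%N / 4 /\
    circle_norm (to_circle (u%:~R * alpha) - b) <= c * psi (q (M + i)%N / 4).
  move=> i; apply: Ab; rewrite ler_pM2r ?invr_gt0//; exact: cf_denomR_le.
exists (v (k - M)%N).
  apply: mem_tree.
    by apply: L0m; rewrite subr0 -intr_norm; have [+ _] := vP 0%N; rewrite addn0.
  move=> i; have [Ki0 Ki1 [Ki2 Ki3 Ki4 Ki5]] := KP _ (MiK i).
  set k' := (M + i)%N in Ki0 Ki1 Ki2 Ki3 Ki4 Ki5.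
  have kK : (K0 <= k')%N by exact: (leq_trans k0K).
  have [vq vb] := vP i; have [v'q v'b] := vP i.+1.
  rewrite addnS -/k' in v'q v'b; rewrite -/k' in vq vb.
  have qq : q k' <= q k'.+1 by exact: cf_denomR_le.
  have p1 : psi (q k'.+1 / 4) <= psi (q k' / 4).
    by apply: psi_le; [rewrite divr_gt0|rewrite ler_pM2r ?invr_gt0].
  have cp1 : c * psi (q k'.+1 / 4) <= c * psi (q k' / 4) by rewrite ler_pM2l.
  have nb := dist_int_return vb v'b.
  have nR : `|v i.+1 - v i|%:~R <= q k'.+1 / 4 + q k' / 4 :> R.
    apply: (@le_trans _ _ (`|v i.+1|%:~R + `|v i|%:~R)); last by rewrite lerD.
    by rewrite -intrD ler_int; exact: ler_normB.
  have [m nm md] : exists2 m : int, v i.+1 - v i = m * cf_denom alpha k' &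
      `|m|%:~R * d k' <= dist_int ((v i.+1 - v i)%:~R * alpha).
    apply: return_multiple => //; first by lra.
    have h1 := hK3 k' Ki4; have q0' := q0 k'.
    have h2 : q k' * dist_int ((v i.+1 - v i)%:~R * alpha) <= q k' * (2 * c * psi (q k' / 4)).
      by rewrite ler_pM2l//; lra.
    lra.
  apply/mapP; exists m; last by rewrite -/k' -nm addrC subrK.
  have [_ Lmi] := LmP i; apply: Lmi => [|kS].
    by rewrite -/k'; lra.
  rewrite -/k' in kS *.
  have vc := hK2 N k' b (v i) Ki3 (MiN i) Ab kS vq vb.
  have nc := dist_int_return vc v'b.
  (* Since 4 Y_k' <= q_{k'+1}, the next radius is at most c psi (Y_k'); added to the bound of
     [fast_center] it gives the constant 2 + 2 c. *)
  have pp : c * psi (q k'.+1 / 4) <= c * psi (Y k').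
    rewrite ler_pM2l//; apply: psi_le; first exact: Y_gt0.
    have := hK4 k' Ki5 kS; lra.
  lra.
have [vq vb] := vP (k - M)%N; rewrite subnKC// in vq vb.
split=> // kS; have [_ _ [_ kK2 _ _]] := KP k Kk.
exact: (hK2 N k b).
Qed.

Lemma fast_dim_le (k0 : nat) (kappa : nat -> nat) (c s s1 : R) :
  0 < c -> s1 < s -> 0 < s -> (K0 <= k0)%N -> (forall k, (k0 <= k)%N -> q k * psi (q k) <= 1) ->
  increasing_enumeration [set k | (k0 <= k)%N /\ d k < psi (q k)] kappa ->
  (forall N, exists n, (N <= n)%N /\
     \prod_(j < n) (psi (Y (kappa j)) / d (kappa j)) <= psi (Y (kappa n)) `^ (- s1)) ->
  (hausdorff_dim (approx_set alpha (scaled c)) <= s%:E)%E.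
Proof.
move=> c0 s1s s0 k0K large kS small.
have kin n : (k0 <= kappa n)%N /\ d (kappa n) < psi (q (kappa n)) := enum_in kS n.
have kK n : (K0 <= kappa n)%N := leq_trans k0K (kin n).1.
have kge n : (n <= kappa n)%N := enum_ge kS n.
have q0 k : 0 < q k := cf_denomR_gt0 alpha_irr k.
pose ps n := psi (Y (kappa n)).
have ps0 n : 0 < ps n := psi_gt0 (Y_gt0 (kK n)).
have c2 : 0 < 2 + c by lra.
have sparse : forall C : R, exists N, forall n, (N <= n)%N -> C * ps n.+1 <= ps n.
  move=> C; have C0 : 0 < Num.max C 1 by rewrite lt_max ltr01 orbT.
  have [K' [_ hK']] := fast_psi_next C0; exists K' => n Kn.
  apply: (@le_trans _ _ (Num.max C 1 * ps n.+1)); first by rewrite ler_pM2r// le_max lexx.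
  apply: le_trans (fast_psiY_ge (kK n) (kin n).2).
  apply: hK' (kin n.+1).2; first exact: leq_trans Kn (kge n).
  exact: (enum_lt kS).
(* Half of the difference pays for q_k^eta, as q_k psi (Y_k) <= 1, and the other half for the
   constant B. *)
pose eta := (s - s1) / 2; have eta0 : 0 < eta by rewrite /eta; lra.
have [K [k0k hK]] := fast_cover c0 eta0 k0K.
apply: (le_trans (hausdorff_dim_mono (@approx_set_tails c))).
apply: (hausdorff_dim_bigcup_le (to_circle 0)) => // N e e0.
have [A A0 hA] := hK N.
pose B := A * (2 * (2 + c)) `^ s.
have B0 : 0 < B by rewrite mulr_gt0// powR_gt0// mulr_gt0.
have [M1 hM1] := geometric_slack ps0 ltr01 eta0 (divr_gt0 e0 B0) sparse.
have [M2 hM2] := geometric_slack ps0 ltr01 ltr01 (divr_gt0 e0 c2) sparse.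
have [n [+ hn]] := small (maxn (maxn N K) (maxn M1 M2)).
rewrite !geq_max => /andP[/andP[Nn Kn] /andP[M1n M2n]].
have [L [Ls Lb]] := hA (kappa n) (leq_trans Kn (kge n)) (leq_trans Nn (kge n)).
have h1 := hM1 n M1n; rewrite expr1n mul1r in h1.
have h2 := hM2 n M2n; rewrite expr1n mul1r powRr1 ?(ltW (ps0 n))// in h2.
exists [seq to_circle (u%:~R * alpha) | u <- L], ((2 + c) * ps n); split.
- by rewrite mulr_ge0 ?(ltW c2) ?(ltW (ps0 n))//= mulrC -ler_pdivlMr.
- rewrite size_map mulrA powRM ?(ltW (ps0 n))//; last by lra.
  have PE : \prod_(k0 <= j < kappa n) branching j = \prod_(j < n) (psi (Y (kappa j)) / d (kappa j)).
    rewrite -(@enum_prod _ _ kS _ branching); last 2 first.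
    + by move=> k [].
    + by move=> k k0k' /= nk; rewrite /branching; case: ifPn => // dk; case: nk.
    by apply: eq_bigr => j _; rewrite /branching (kin j).2.
  have P0 : 0 <= \prod_(k0 <= j < kappa n) branching j.
    rewrite big_nat; apply: prodr_ge0 => j /andP[jk _].
    exact: le_trans (branching_ge1 (leq_trans k0K jk)).
  have qp : q (kappa n) `^ eta <= ps n `^ (- eta).
    have -> : ps n `^ (- eta) = (ps n)^-1 `^ eta.
      by rewrite -powR_inv1 ?(ltW (ps0 n))// -powRrM mulN1r.
    apply: ge0_ler_powR; rewrite ?nnegrE ?invr_ge0 ?(ltW eta0) ?(ltW (ps0 n)) ?(ltW (q0 _))//.
    rewrite -[leRHS]mul1r ler_pdivlMr//; apply: le_trans (large _ (kin n).1).
    rewrite ler_pM2l//; apply: psi_le => //; exact: fast_Y_ge (kK n) (kin n).2.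
  rewrite PE in Ls P0.
  set V := ps n `^ s; have V0 : 0 < V by exact: powR_gt0.
  have E : ps n `^ (- eta) * ps n `^ (- s1) * V = ps n `^ eta.
    rewrite /V -!powRD; try by apply/implyP => _; rewrite gt_eqF.
    by congr (_ `^ _); rewrite /eta; field.
  apply: (@le_trans _ _ (A * (ps n `^ (- eta) * ps n `^ (- s1)) * ((2 * (2 + c)) `^ s * V))).
    rewrite ler_pM2r; last by rewrite mulr_gt0// powR_gt0// mulr_gt0.
    apply: (le_trans Ls); rewrite ler_pM2l//; apply: ler_pM => //; exact: powR_ge0.
  rewrite (_ : _ * _ = (ps n `^ (- eta) * ps n `^ (- s1) * V) * B); last by rewrite /B; ring.
  by rewrite E -ler_pdivlMr.
- move=> b Ab; have [u uL [_ /(_ (kin n).2) ub]] := Lb b Ab.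
  exists (to_circle (u%:~R * alpha)); first by apply: (map_f (fun u : int => to_circle (u%:~R * alpha))).
  by rewrite metric_sym circle_mdistE.
Qed.

(** Past K1 the branching is 1, so a constant times q_k^(s/2) balls suffice, of radius at most 1/(2
    q_k); the cost is of order q_k^(-s/2). *)
Lemma fast_dim_finite (k0 K1 : nat) (c s : R) :
  0 < c -> 0 < s -> (K0 <= k0)%N ->
  (forall k, (K1 <= k)%N -> psi (q k) <= d k) ->
  (hausdorff_dim (approx_set alpha (scaled c)) <= s%:E)%E.
Proof.
move=> c0 s0 k0K fin; have q0 k : 0 < q k := cf_denomR_gt0 alpha_irr k.
pose eta := s / 2; have eta0 : 0 < eta by rewrite /eta; lra.
have f4 : 0 < 4 :> R by [].
have [K [k0k hK]] := fast_cover c0 eta0 k0K.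
have [K2 [_ hK2]] := fast_large (2 * c) f4.
pose P := \prod_(k0 <= j < maxn k0 K1) branching j.
have br0 k : (k0 <= k)%N -> 0 < branching k.
  by move=> kk; apply: lt_le_trans (branching_ge1 (leq_trans k0K kk)).
have P0 : 0 < P by rewrite /P big_nat; apply: prodr_gt0 => j /andP[jk _]; exact: br0.
apply: (le_trans (hausdorff_dim_mono (@approx_set_tails c))).
apply: (hausdorff_dim_bigcup_le (to_circle 0)) => // N e e0.
have [A A0 hA] := hK N.
pose X := (A * P / e) `^ eta^-1.
have [K3 hK3] := cf_denomR_unbounded alpha_irr (Num.max X e^-1).
pose k := maxn (maxn (maxn N K) (maxn k0 K1)) (maxn K2 K3).
have : (k <= k)%N by [].
rewrite {1}/k geq_max => /andP[+ +]; rewrite geq_max => /andP[+ k01k].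
rewrite !geq_max => /andP[Nk Kk] /andP[K2k K3k].
have [L [Ls Lb]] := hA k Kk Nk.
have /andP[qX qe] : (X <= q k) && (e^-1 <= q k) by rewrite -ge_max hK3.
have h2 := hK2 k K2k.
have p4 : 0 < psi (q k / 4) by apply: psi_gt0; rewrite divr_gt0.
have rq : 2 * (c * psi (q k / 4)) <= (q k)^-1.
  by rewrite -[leRHS]mul1r ler_pdivlMr//; lra.
have r0 : 0 < c * psi (q k / 4) by rewrite mulr_gt0.
have PE : \prod_(k0 <= j < k) branching j = P.
  rewrite (@big_cat_nat _ _ _ (maxn k0 K1)) ?leq_maxl//= [X in _ * X](_ : _ = 1) ?mulr1//.
  rewrite big_nat big1// => j /andP[+ _]; rewrite geq_max => /andP[_ /fin jd].
  by rewrite /branching ltNge jd.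
rewrite PE in Ls.
exists [seq to_circle (u%:~R * alpha) | u <- L], (c * psi (q k / 4)); split.
- rewrite (ltW r0) /=; have : (q k)^-1 <= e.
    by rewrite -[e]invrK lef_pV2 ?posrE ?invr_gt0.
  lra.
- rewrite size_map.
  have qs : (2 * (c * psi (q k / 4))) `^ s <= (q k)^-1 `^ s.
    apply: ge0_ler_powR; rewrite ?nnegrE ?(ltW s0) ?invr_ge0 ?(ltW (q0 _))//.
    by rewrite mulr_ge0// ltW.
  have XE : A * P / e = X `^ eta.
    rewrite /X -powRrM mulVf ?powRr1 ?gt_eqF// divr_ge0 ?(ltW e0)// mulr_ge0 ?(ltW A0) ?(ltW P0)//.
  have qX' : A * P / e <= q k `^ eta.
    by rewrite XE; apply: ge0_ler_powR; rewrite ?nnegrE ?powR_ge0 ?(ltW eta0) ?(ltW (q0 _)).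
  have qE : (q k)^-1 `^ s * q k `^ eta = (q k `^ eta)^-1.
    rewrite -powR_inv1 ?(ltW (q0 _))// -powRrM -powRN -powRD.
      by congr (_ `^ _); rewrite /eta; field.
    by apply/implyP => _; rewrite gt_eqF.
  apply: (@le_trans _ _ (A * (q k `^ eta * P) * (q k)^-1 `^ s)).
    by apply: ler_pM => //; exact: powR_ge0.
  rewrite (_ : _ * _ = A * P * ((q k)^-1 `^ s * q k `^ eta)); last by ring.
  by rewrite qE ler_pdivrMr ?powR_gt0// [leRHS]mulrC -ler_pdivrMr.
- move=> b Ab; have [u uL [ub _]] := Lb b Ab.
  exists (to_circle (u%:~R * alpha)); first by apply: (map_f (fun u : int => to_circle (u%:~R * alpha))).
  by rewrite metric_sym circle_mdistE.
Qed.

End Fast.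


End Dimension.

(** * The dimension formulas *)

Section LimitInferior.
Context {R : realType}.
Local Open Scope ereal_scope.

Lemma limf_einf_gt {T : choiceType} {X : filteredType T} (f : X -> \bar R)
    (F : set_system X) (a : R) :
  Filter F -> a%:E < limf_einf f F -> \forall x \near F, a%:E < f x.
Proof.
move=> FF; rewrite limf_einfE => /ereal_sup_gt[_ [V FV <-] aV].
by apply: filterS FV => x Vx; apply: (lt_le_trans aV); apply: ereal_inf_lbound; exists x.
Qed.

Lemma limn_einf_gt (u : nat -> R) (a : R) : a%:E < limn_einf (fun n => (u n)%:E) ->
  exists N, forall n, (N <= n)%N -> (a < u n)%R.
Proof. by move/limf_einf_gt => [N _ hN]; exists N => n Nn; have := hN n Nn; rewrite lte_fin. Qed.

Lemma limn_einf_ge (u : nat -> R) (a : R) N :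
  (forall n, (N <= n)%N -> (a <= u n)%R) -> a%:E <= limn_einf (fun n => (u n)%:E).
Proof.
move=> h; rewrite -[limn_einf _]/(limf_einf _ _) limf_einfE.
apply: (@le_trans _ _ (ereal_inf ((fun n => (u n)%:E) @` [set n | (N <= n)%N]))).
  by apply: le_ereal_inf_tmp => _ [n Nn <-]; rewrite lee_fin h.
by apply: ereal_sup_ubound; exists [set n | (N <= n)%N] => //; exists N.
Qed.

Lemma limn_einf_lt (u : nat -> R) (a : R) : limn_einf (fun n => (u n)%:E) < a%:E ->
  forall N, exists n, (N <= n)%N /\ (u n < a)%R.
Proof.
move=> h N; apply: contrapT => nex; move: h; rewrite ltNge => /negP; apply.
apply: (@limn_einf_ge _ _ N) => n Nn; rewrite leNgt; apply/negP => un.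
by apply: nex; exists n.
Qed.

Lemma limn_einf_le (u : nat -> R) (a : R) :
  (forall n, (u n <= a)%R) -> limn_einf (fun n => (u n)%:E) <= a%:E.
Proof.
move=> h; rewrite leNgt; apply/negP => /limn_einf_gt[N /(_ N (leqnn _))].
by rewrite ltNge h.
Qed.

(** Lower bounds are asked for positive s only, as the Hoelder criterion works with a positive
    exponent. *)
Lemma ereal_between (x : \bar R) (l : R) : (0 <= l)%R -> 0 <= x ->
  (forall s, (l < s)%R -> x <= s%:E) -> (forall s, (0 < s)%R -> (s < l)%R -> s%:E <= x) ->
  x = l%:E.
Proof.
move=> l0 x0 xl lx; apply/eqP; rewrite eq_le; apply/andP; split.
  by apply/lee_addgt0Pr => e e0; apply: xl; rewrite ltrDl.
apply/lee_subgt0Pr => e e0; have [le|el] := leP l e.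
  by apply: le_trans x0; rewrite -EFinB lee_fin subr_le0.
by apply: lx; rewrite ?subr_gt0// ltrBlDr ltrDl.
Qed.

End LimitInferior.

Section LogRatio.
Context {R : realType}.

Lemma log_ratio_ge (x p s : R) : (0 < x) -> (0 < p < 1) ->
  (s <= ln x / ln p^-1) = (p `^ (- s) <= x).
Proof.
move=> x0 /andP[p0 p1].
have l0 : (0 < ln p^-1) by rewrite ln_gt0// invf_gt1.
have p_s : (0 < p `^ (- s)) by exact: powR_gt0.
by rewrite ler_pdivlMr// -(ler_ln (x := p `^ (- s)))// ln_powR lnV ?posrE// mulrN mulNr.
Qed.

Lemma log_ratio_le (x p s : R) : (0 < x) -> (0 < p < 1) ->
  (ln x / ln p^-1 <= s) = (x <= p `^ (- s)).
Proof.
move=> x0 /andP[p0 p1].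
have l0 : (0 < ln p^-1) by rewrite ln_gt0// invf_gt1.
have p_s : (0 < p `^ (- s)) by exact: powR_gt0.
by rewrite ler_pdivrMr// -(ler_ln (y := p `^ (- s)))// ln_powR lnV ?posrE// mulrN mulNr.
Qed.

End LogRatio.

(** * From the logarithmic order of psi to the behaviour of T psi T *)

Section OrderOfDecay.
Context {R : realType} (psi : R -> R).
Hypothesis psi_gt0 : forall T : R, 0 < T -> 0 < psi T.

Lemma log_mul_psi (T : R) : 1 < T -> ln (T * psi T) = (1 - ln (psi T)^-1 / ln T) * ln T.
Proof.
move=> T1; have T0 : 0 < T by lra.
have l0 : 0 < ln T by exact: ln_gt0.
have p0 := psi_gt0 T0.
by rewrite lnM ?posrE// lnV ?posrE//; field; rewrite gt_eqF.
Qed.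

(** ln (T psi T) = (1 - a(T)) ln T, where the order a(T) stays below some a < 1 for large T. *)
Lemma slow_of_order : (limf_esup (log_order psi) (pinfty_nbhs R) < 1)%E ->
  forall C : R, exists T1 : R, 0 < T1 /\ forall T : R, T1 <= T -> C <= T * psi T.
Proof.
move=> h C.
(* The liminf of the opposite function is a supremum over the sets of the filter, which yields V. An
   infimum +oo over V is excluded below because V is nonempty. *)
have : (- 1%:E < limf_einf (\- log_order psi)%E (pinfty_nbhs R))%E by rewrite limf_einfN lteN2.
rewrite -EFinN limf_einfE => /ereal_sup_gt[m [V FV <-] aV].
have [a a1 aP] : exists2 a : R, a < 1 & forall T, V T -> ln (psi T)^-1 / ln T <= a.
  have le T : V T -> (ereal_inf [set (\- log_order psi)%E x | x in V] <= (- (ln (psi T)^-1 / ln T))%:E)%E.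
    by move=> VT; apply: ereal_inf_lbound; exists T.
  move: aV le; case: ereal_inf => [r||] //.
    rewrite lte_fin => r1 le; exists (- r); first by lra.
    by move=> T /le; rewrite lee_fin; lra.
  move=> _ le; have [T VT] := filter_ex FV.
  by have := le T VT; rewrite leNgt ltry.
case: FV => M [_ MV].
exists (Num.max (M + 1) (Num.max 2 (expR (ln (Num.max C 1) / (1 - a))))); split.
  by rewrite !lt_max ltr0n !orbT.
move=> T; rewrite !ge_max => /andP[MT /andP[T2 TE]].
have T1 : 1 < T by lra.
have T0 : 0 < T by lra.
have l0 : 0 < ln T by exact: ln_gt0.
have C1 : 0 < Num.max C 1 by rewrite lt_max ltr01 orbT.
apply: (@le_trans _ _ (Num.max C 1)); first by rewrite le_max lexx.
rewrite -ler_ln ?posrE ?mulr_gt0 ?psi_gt0// log_mul_psi//.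
have aT : ln (psi T)^-1 / ln T <= a by apply: aP; apply: MV; lra.
have : ln (Num.max C 1) <= (1 - a) * ln T.
  rewrite -ler_pdivrMl ?subr_gt0// mulrC -[leLHS]expRK ler_ln ?posrE ?expR_gt0//.
by move=> /le_trans; apply; rewrite ler_pM2r//; lra.
Qed.

Lemma fast_of_order : (1 < limf_einf (log_order psi) (pinfty_nbhs R))%E ->
  forall C : R, exists T1 : R, 0 < T1 /\ forall T : R, T1 <= T -> C * (T * psi T) <= 1.
Proof.
move=> h C; move: h; rewrite limf_einfE => /ereal_sup_gt[m [V FV <-] aV].
have [a a1 aP] : exists2 a : R, 1 < a & forall T, V T -> a <= ln (psi T)^-1 / ln T.
  have le T : V T -> (ereal_inf [set log_order psi x | x in V] <= (ln (psi T)^-1 / ln T)%:E)%E.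
    by move=> VT; apply: ereal_inf_lbound; exists T.
  move: aV le; case: ereal_inf => [r||] //.
    by rewrite lte_fin => r1 le; exists r => // T /le; rewrite lee_fin.
  move=> _ le; have [T VT] := filter_ex FV.
  by have := le T VT; rewrite leNgt ltry.
case: FV => M [_ MV].
exists (Num.max (M + 1) (Num.max 2 (expR (ln (Num.max C 1) / (a - 1))))); split.
  by rewrite !lt_max ltr0n !orbT.
move=> T; rewrite !ge_max => /andP[MT /andP[T2 TE]].
have T1 : 1 < T by lra.
have T0 : 0 < T by lra.
have l0 : 0 < ln T by exact: ln_gt0.
have C1 : 0 < Num.max C 1 by rewrite lt_max ltr01 orbT.
have p0 := psi_gt0 T0.
apply: (@le_trans _ _ (Num.max C 1 * (T * psi T))).
  by rewrite ler_pM2r ?mulr_gt0// le_max lexx.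
rewrite mulrC -ler_pdivlMr// mul1r -ler_ln ?posrE ?mulr_gt0 ?invr_gt0// log_mul_psi// [leRHS]lnV ?posrE//.
have aT : a <= ln (psi T)^-1 / ln T by apply: aP; apply: MV; lra.
have : ln (Num.max C 1) <= (a - 1) * ln T.
  rewrite -ler_pdivrMl ?subr_gt0// mulrC -[leLHS]expRK ler_ln ?posrE ?expR_gt0//.
move=> h; have : (a - 1) * ln T <= (ln (psi T)^-1 / ln T - 1) * ln T by rewrite ler_pM2r//; lra.
lra.
Qed.

(** With r = max a R0, psi (T/a) <= r^tau psi (r T/a) <= r^tau psi T, because r T/a >= T. *)
Lemma lqm_dilation (a : R) :
  (forall S T : R, 0 < S -> S < T -> psi T < psi S) ->
  lower_quasimultiplicative psi -> 0 < a -> exists C1 T1 : R, 0 < C1 /\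
  forall T : R, T1 <= T -> psi (T / a) <= C1 * psi T.
Proof.
move=> psi_decr [tau [R0 [tau0 R01 [M [_ hM]]]]] a0.
have r0 : 0 < Num.max a R0 by rewrite lt_max a0.
exists (Num.max a R0 `^ tau), (Num.max ((M + 1) * a) 1); split; first exact: powR_gt0.
move=> T; rewrite ge_max => /andP[MT T1]; have T0 : 0 < T by lra.
have := hM (T / a); rewrite ltr_pdivlMr// => h.
have /h {}h : M * a < T by lra.
have := h (Num.max a R0); rewrite le_max lexx orbT => /(_ isT).
rewrite powRN ler_pdivrMl ?powR_gt0// => /le_trans; apply.
rewrite ler_pM2l ?powR_gt0//.
have TT : T <= Num.max a R0 * (T / a).
  by rewrite mulrCA -[leLHS]mulr1 ler_pM2l// ler_pdivlMr// mul1r le_max lexx.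
by move: TT; rewrite le_eqVlt => /predU1P[<-//|/(psi_decr _ _ T0)/ltW].
Qed.

End OrderOfDecay.

Lemma approx_set_mono (R : realType) (alpha : R) (f g : R -> R) :
  (exists T1 : R, forall T, T1 <= T -> f T <= g T) ->
  approx_set alpha f `<=` approx_set alpha g.
Proof.
move=> [T1 fg] b [M [_ hM]]; exists (Num.max T1 M); split; first exact: num_real.
move=> T; rewrite gt_max => /andP[T1T MT]; have [u [uT ub]] := hM T MT.
by exists u; split=> //; apply: (le_trans ub); apply: fg; exact: ltW.
Qed.

(** * The formulas for all multiples c psi *)

Section Formulas.
Context {R : realType} (alpha : R) (psi : R -> R) (Y : nat -> R) (K0 : nat).
Hypothesis alpha_irr : irrational alpha.
Hypothesis psi_gt0 : forall T : R, 0 < T -> 0 < psi T.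
Hypothesis psi_decr : forall S T : R, 0 < S -> S < T -> psi T < psi S.

Local Notation q k := ((cf_denom alpha k)%:~R : R).
Local Notation d k := (dist_int (q k * alpha)).
Local Notation D c := (approx_set alpha (fun T : R => (c * psi T)%R)).

Hypothesis K0_gt0 : (0 < K0)%N.
Hypothesis YP : forall k, (K0 <= k)%N -> 0 < Y k /\ Y k / psi (Y k) = q k / d k.

(** K may depend on c. Beyond it every starting index k0 gives the same dimension, although the
    enumeration and the products change with k0. *)
Lemma slow_dimension (c : R) : 0 < c ->
  (forall C : R, exists T1 : R, 0 < T1 /\ forall T : R, T1 <= T -> C <= T * psi T) ->
  exists K, forall k0, (K <= k0)%N ->
    let S := [set k | (k0 <= k)%N /\ psi (d k)^-1 < (q k)^-1] in
    (finite_set S -> hausdorff_dim (D c) = 1%E) /\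
    (forall kappa, increasing_enumeration S kappa -> hausdorff_dim (D c) =
       limn_einf (fun i => (ln (q (kappa i) *
         \prod_(j < i) (q (kappa j) * psi (Y (kappa j)))) / ln (psi (Y (kappa i)))^-1)%:E)).
Proof.
move=> c0 slow.
have [K [KK0 hK]] := slow_large alpha_irr psi_gt0 psi_decr K0_gt0 YP slow 2.
exists K => k0 Kk0 S; have k0K : (K0 <= k0)%N by exact: (leq_trans KK0).
have q0 k : 0 < q k := cf_denomR_gt0 alpha_irr k.
(* The lower bound is available for constants at most 1; monotonicity carries it over to c. *)
pose c' := Num.min c 1.
have c'0 : 0 < c' by rewrite lt_min c0 ltr01.
have c'1 : c' <= 1 by rewrite ge_min lexx orbT.
have Dc' : D c' `<=` D c.
  apply: approx_set_mono; exists 1 => T T1; rewrite ler_pM2r ?ge_min ?lexx//.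
  by apply: psi_gt0; lra.
have lower s s2 K2 : 0 < s -> s < s2 -> s2 <= 1 -> (forall k, (K2 <= k)%N -> psi (Y k) < (q k)^-1 ->
     psi (Y k) `^ (- s2) <= q k * \prod_(k0 <= j < k) Num.min 1 (q j * psi (Y j))) ->
     (s%:E <= hausdorff_dim (D c))%E.
  move=> s0 ss2 s21 big; apply: le_trans (hausdorff_dim_mono Dc').
  exact: (slow_dim_ge alpha_irr psi_gt0 psi_decr K0_gt0 YP slow c'0 c'1 s0 ss2 s21 k0K big).
have SE k : (k0 <= k)%N -> psi (Y k) < (q k)^-1 -> S k.
  move=> kk; rewrite -(index_equiv alpha_irr psi_gt0 psi_decr K0_gt0 YP (leq_trans k0K kk)).
  by [].
split=> [/finite_nat_bounded[N hN]|kappa kS].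
  apply: ereal_between => // [|s s1|s s0 s1].
  - exact: hausdorff_dim_ge0.
  - by apply: (le_trans (hausdorff_dim_le1 _)); rewrite lee_fin ltW.
  (* Beyond N no index is relevant, so the condition on the products is vacuous and s2 = 1 is
     allowed. *)
  - apply: (lower s 1 (maxn k0 N)) => // k; rewrite geq_max => /andP[kk Nk] /(SE k kk) /hN.
    by rewrite ltnNge Nk.
have kin n : (k0 <= kappa n)%N /\ psi (d (kappa n))^-1 < (q (kappa n))^-1 := enum_in kS n.
have kK n : (K0 <= kappa n)%N := leq_trans k0K (kin n).1.
pose ps n := psi (Y (kappa n)).
pose X n := q (kappa n) * \prod_(j < n) (q (kappa j) * ps j).
have ps0 n : 0 < ps n := psi_gt0 (Y_gt0 YP (kK n)).
have psq n : ps n < (q (kappa n))^-1.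
  by have := (kin n).2; rewrite (index_equiv alpha_irr psi_gt0 psi_decr K0_gt0 YP (kK n)).
have psd n : 2 * d (kappa n) <= ps n.
  by have [_ h _] := hK (kappa n) (leq_trans Kk0 (kin n).1).
have psQ := level_ge1 alpha_irr (fun n => enum_lt kS (ltnSn n)) (fun n => index_gt0 K0_gt0 (kK n)) psd.
have ps1 n : 0 < ps n < 1.
  rewrite ps0 (lt_le_trans (psq n))// invf_le1//; exact: cf_denomR_ge1.
have X1 n : 1 <= X n.
  elim: n => [|n IH]; first by rewrite /X big_ord0 mulr1 cf_denomR_ge1.
  have -> : X n.+1 = X n * (ps n * q (kappa n.+1)) by rewrite /X big_ord_recr /=; ring.
  by rewrite -[leLHS]mulr1; apply: ler_pM.
have X0 n : 0 < X n by exact: lt_le_trans (X1 n).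
have Xps n : X n * ps n <= 1.
  have -> : X n * ps n = \prod_(j < n.+1) (q (kappa j) * ps j) by rewrite /X big_ord_recr /=; ring.
  apply: prodr_ile1 => j _; rewrite mulr_ge0 ?(ltW (q0 _)) ?(ltW (ps0 _))//=.
  by rewrite mulrC -ler_pdivlMr// mul1r ltW.
pose u n := ln (X n) / ln (ps n)^-1.
(* The bounds 0 and 1 make the liminf a real number l, and (l + s) / 2 then serves as an exponent
   strictly between l and s. *)
have u0 n : 0 <= u n by rewrite log_ratio_ge// oppr0 powRr0.
have u1 n : u n <= 1 by rewrite log_ratio_le// powR_inv1 ?(ltW (ps0 n))// -[leRHS]mul1r ler_pdivlMr.
rewrite -[limn_einf _]/(limn_einf (fun n => (u n)%:E)).
have L0 := limn_einf_ge (N := 0) (fun n _ => u0 n).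
have L1 := limn_einf_le u1.
have Lgt := @limn_einf_gt _ u; have Llt := @limn_einf_lt _ u.
case: (limn_einf _) L0 L1 Lgt Llt => [l||] //; rewrite !lee_fin => l0 l1 Lgt Llt.
apply: ereal_between => // [|s ls|s s0 sl]; first exact: hausdorff_dim_ge0.
  have h1 : l < (l + s) / 2 by lra.
  have h2 : (l + s) / 2 < s by lra.
  apply: (slow_dim_le alpha_irr psi_gt0 psi_decr K0_gt0 YP slow c0 h2 _ kS k0K).
  - by lra.
  - by move=> k kk; have [? ? _] := hK k (leq_trans Kk0 kk).
  - move=> N; have [|n [Nn un]] := Llt ((l + s) / 2) _ N; first by rewrite lte_fin.
    by exists n; split=> //; rewrite -(log_ratio_le _ (X0 n) (ps1 n)); exact: ltW.
have h1 : s < (l + s) / 2 by lra.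
have [|N hN] := Lgt ((l + s) / 2); first by rewrite lte_fin; lra.
apply: (lower s ((l + s) / 2) (maxn k0 (kappa N))) => //; first by lra.
move=> k; rewrite geq_max => /andP[kk Nk] /(SE k kk) Sk.
have [n nk] := enum_surj kS Sk; rewrite -nk in Nk *.
have Nn : (N <= n)%N by rewrite leqNgt; apply/negP => /(enum_lt kS); rewrite ltnNge Nk.
have := hN n Nn => /ltW; rewrite /u log_ratio_ge// => /le_trans; apply.
rewrite /X (_ : \prod_(j < n) _ = \prod_(k0 <= j < kappa n) Num.min 1 (q j * psi (Y j)))//.
rewrite -(@enum_prod _ _ kS _ (fun j => Num.min 1 (q j * psi (Y j)))).
- apply: eq_bigr => j _; apply/esym/min_idPr.
  by rewrite mulrC -ler_pdivlMr// mul1r; exact: ltW (psq j).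
- by move=> j [].
- move=> j kj Sj; apply/min_idPl; rewrite -ler_pdivrMl// mulr1 leNgt.
  by apply/negP => /(SE j kj).
Qed.

Lemma fast_dimension (c : R) : 0 < c ->
  (forall C : R, exists T1 : R, 0 < T1 /\ forall T : R, T1 <= T -> C * (T * psi T) <= 1) ->
  (exists C1 T1 : R, 0 < C1 /\ forall T : R, T1 <= T -> psi (T / 4) <= C1 * psi T) ->
  exists K, forall k0, (K <= k0)%N ->
    let S := [set k | (k0 <= k)%N /\ d k < psi (q k)] in
    (finite_set S -> hausdorff_dim (D c) = 0%E) /\
    (forall kappa, increasing_enumeration S kappa -> hausdorff_dim (D c) =
       limn_einf (fun i => (ln (\prod_(j < i) (psi (Y (kappa j)) / d (kappa j)))
          / ln (psi (Y (kappa i)))^-1)%:E)).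
Proof.
move=> c0 fast quarter.
have [K1 [K1K hK1]] := fast_large K0 alpha_irr fast 2 (@ltr01 R).
have [K2 [K2K hK2]] := fast_psi_next alpha_irr psi_gt0 psi_decr K0_gt0 YP fast (@ltr01 R).
exists (maxn K1 K2) => k0; rewrite geq_max => /andP[K1k0 K2k0] S.
have k0K : (K0 <= k0)%N by exact: (leq_trans K1K).
have q0 k : 0 < q k := cf_denomR_gt0 alpha_irr k.
have large k : (k0 <= k)%N -> 2 * (q k * psi (q k)) <= 1.
  by move=> kk; have := hK1 k (leq_trans K1k0 kk); rewrite divr1.
split=> [/finite_nat_bounded[N hN]|kappa kS].
  apply: ereal_between => // [|s s0|s s0 s1].
  - exact: hausdorff_dim_ge0.
  - apply: (fast_dim_finite (K1 := maxn k0 N) alpha_irr psi_gt0 psi_decr K0_gt0 YP fast quarter c0 s0 k0K).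
    move=> k; rewrite geq_max => /andP[kk Nk]; rewrite leNgt; apply/negP => dk.
    by have /hN : S k by []; rewrite ltnNge Nk.
  - by have := lt_trans s0 s1; rewrite ltxx.
pose c' := Num.min c 1.
have c'0 : 0 < c' by rewrite lt_min c0 ltr01.
have c'1 : c' <= 1 by rewrite ge_min lexx orbT.
have Dc' : D c' `<=` D c.
  apply: approx_set_mono; exists 1 => T T1; rewrite ler_pM2r ?ge_min ?lexx//.
  by apply: psi_gt0; lra.
have kin n : (k0 <= kappa n)%N /\ d (kappa n) < psi (q (kappa n)) := enum_in kS n.
have kK n : (K0 <= kappa n)%N := leq_trans k0K (kin n).1.
pose ps n := psi (Y (kappa n)); pose dd n := d (kappa n).
have ps0 n : 0 < ps n := psi_gt0 (Y_gt0 YP (kK n)).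
have dd0 n : 0 < dd n := cf_dist_gt0 alpha_irr (index_gt0 K0_gt0 (kK n)).
have psd n : dd n <= ps n := fast_psiY_ge alpha_irr psi_gt0 psi_decr K0_gt0 YP (kK n) (kin n).2.
have psn n : ps n.+1 <= dd n.
  have := hK2 (kappa n) (kappa n.+1) (leq_trans K2k0 (kin n).1) (enum_lt kS (ltnSn n)) (kin n.+1).2.
  by rewrite mul1r.
have ps1 n : 0 < ps n < 1.
  rewrite ps0 /=.
  have : ps n <= psi (q (kappa n)).
    apply: psi_le => //.
    exact: (fast_Y_ge alpha_irr psi_gt0 psi_decr K0_gt0 YP (kK n) (kin n).2).
  have := large _ (kin n).1; have := psi_gt0 (q0 (kappa n)).
  have := cf_denomR_ge1 alpha_irr (kappa n); move: (q _) (psi _) => a b h1 h2 h3 h4.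
  have : 1 * b <= a * b by rewrite ler_pM2r.
  lra.
pose X n := \prod_(j < n) (ps j / dd j).
have XS n : X n.+1 = X n * (ps n / dd n) by rewrite /X big_ord_recr.
have X1 n : 1 <= X n.
  elim: n => [|n IH]; first by rewrite /X big_ord0.
  by rewrite XS -[leLHS]mulr1; apply: ler_pM => //; rewrite ler_pdivlMr// mul1r.
have X0 n : 0 < X n by exact: lt_le_trans (X1 n).
(* This product does not increase with n, because psi at the next relevant scale is at most the
   present d_k. *)
have Xps n : X n * ps n <= 1.
  elim: n => [|n IH]; first by rewrite /X big_ord0 mul1r; have /andP[_ /ltW] := ps1 0%N.
  rewrite XS; apply: le_trans IH; rewrite -mulrA ler_pM2l// mulrAC ler_pdivrMr//.
  by rewrite ler_pM2l.
pose u n := ln (X n) / ln (ps n)^-1.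
have u0 n : 0 <= u n by rewrite log_ratio_ge// oppr0 powRr0.
have u1 n : u n <= 1 by rewrite log_ratio_le// powR_inv1 ?(ltW (ps0 n))// -[leRHS]mul1r ler_pdivlMr.
rewrite -[limn_einf _]/(limn_einf (fun n => (u n)%:E)).
have L0 := limn_einf_ge (N := 0) (fun n _ => u0 n).
have L1 := limn_einf_le u1.
have Lgt := @limn_einf_gt _ u; have Llt := @limn_einf_lt _ u.
case: (limn_einf _) L0 L1 Lgt Llt => [l||] //; rewrite !lee_fin => l0 l1 Lgt Llt.
apply: ereal_between => // [|s ls|s s0 sl]; first exact: hausdorff_dim_ge0.
  have h1 : l < (l + s) / 2 by lra.
  have h2 : (l + s) / 2 < s by lra.
  apply: (fast_dim_le alpha_irr psi_gt0 psi_decr K0_gt0 YP fast quarter c0 h2 _ k0K _ kS).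
  - by lra.
  - move=> k /large; have : 0 < q k * psi (q k) by rewrite mulr_gt0// psi_gt0.
    lra.
  - move=> N; have [|n [Nn un]] := Llt ((l + s) / 2) _ N; first by rewrite lte_fin.
    by exists n; split=> //; rewrite -(log_ratio_le _ (X0 n) (ps1 n)); exact: ltW.
have h1 : s < (l + s) / 2 by lra.
have [|N hN] := Lgt ((l + s) / 2); first by rewrite lte_fin; lra.
apply: le_trans (hausdorff_dim_mono Dc').
apply: (fast_dim_ge (N2 := N) alpha_irr psi_gt0 psi_decr K0_gt0 YP fast c'0 c'1 s0 _ h1 k0K kS).
- by lra.
- by move=> n Nn; have := hN n Nn => /ltW; rewrite /u log_ratio_ge.
Qed.

End Formulas.

Unset Implicit Arguments.

Theorem theorem2p2 (R : realType) (alpha : R) (psi : R -> R)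
  (alpha_irr : irrational alpha)
  (psi_gt0 : forall T : R, 0 < T -> 0 < psi T)
  (psi_cont : forall T : R, 0 < T -> {for T, continuous psi})
  (psi_decr : forall S T : R, 0 < S -> S < T -> psi T < psi S)
  (psi_cvg0 : psi T @[T --> +oo] --> 0)
  (psi_lqm : lower_quasimultiplicative psi)
  (psi_norm : psi T @[T --> 0^'+] --> +oo)
  (q : nat -> R) (q_def : forall k, q k = (cf_denom alpha k)%:~R)
  (d : nat -> R) (d_def : forall k, d k = dist_int (q k * alpha))
  (Y : nat -> R)
  (Y_def : \forall k \near \oo, 0 < Y k /\ Y k / psi (Y k) = q k / d k) :
  [/\ (limf_esup (log_order psi) (pinfty_nbhs R) < 1)%E ->
      \forall k0 \near \oo,
      let S := [set k | (k0 <= k)%N /\ psi (d k)^-1 < (q k)^-1] in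
      (finite_set S -> hausdorff_dim (approx_set alpha psi) = 1%E) /\
      (forall kappa : nat -> nat, increasing_enumeration S kappa ->
         hausdorff_dim (approx_set alpha psi) =
         limn_einf (fun i =>
           (ln (q (kappa i) *
                \prod_(j < i) (q (kappa j) * psi (Y (kappa j))))
            / ln (psi (Y (kappa i)))^-1)%:E)),
      (1 < limf_einf (log_order psi) (pinfty_nbhs R))%E ->
      \forall k0 \near \oo,
      let S := [set k | (k0 <= k)%N /\ d k < psi (q k)] in
      (finite_set S -> hausdorff_dim (approx_set alpha psi) = 0%E) /\
      (forall kappa : nat -> nat, increasing_enumeration S kappa ->
         hausdorff_dim (approx_set alpha psi) =
         limn_einf (fun i =>
           (ln (\prod_(j < i) (psi (Y (kappa j)) / d (kappa j)))
            / ln (psi (Y (kappa i)))^-1)%:E))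
    & (limf_esup (log_order psi) (pinfty_nbhs R) < 1)%E \/
      (1 < limf_einf (log_order psi) (pinfty_nbhs R))%E ->
      forall c : R, 0 < c ->
      hausdorff_dim (approx_set alpha (fun T => c * psi T)) =
        hausdorff_dim (approx_set alpha (rescale c psi)) /\
      hausdorff_dim (approx_set alpha (rescale c psi)) =
        hausdorff_dim (approx_set alpha psi)].
Proof.
case: Y_def => K _ hK.
have {}q_def : q = (fun k => (cf_denom alpha k)%:~R) by apply/funext.
subst q.
have {}d_def : d = (fun k => dist_int ((cf_denom alpha k)%:~R * alpha)).
  by apply/funext.
subst d.
(* The successor excludes index 0, where the distance to the integers may differ from the error of
   the convergent. *)
have YP k : (K.+1 <= k)%N -> 0 < Y k /\ Y k / psi (Y k) =
    ((cf_denom alpha k)%:~R : R) / dist_int ((cf_denom alpha k)%:~R * alpha).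
  by move=> /ltnW /hK.
have psi1 : (fun T => 1 * psi T) = psi by apply/funext => T; rewrite mul1r.
have quarter := lqm_dilation psi_decr psi_lqm (ltr0Sn R 3).
have dimS c c0 := @slow_dimension _ _ _ _ _ alpha_irr psi_gt0 psi_decr (ltn0Sn K) YP c c0.
have dimF c c0 := @fast_dimension _ _ _ _ _ alpha_irr psi_gt0 psi_decr (ltn0Sn K) YP c c0.
split=> [/(slow_of_order psi_gt0) slow|/(fast_of_order psi_gt0) fast|reg c c0].
- have [K1 hK1] := dimS 1 ltr01 slow.
  by exists K1 => // k0 /= /hK1; rewrite psi1.
- have [K1 hK1] := dimF 1 ltr01 fast quarter.
  by exists K1 => // k0 /= /hK1; rewrite psi1.
have dim_cst a : 0 < a ->
    hausdorff_dim (approx_set alpha (fun T => a * psi T)) = hausdorff_dim (approx_set alpha psi).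
  move=> a0; case: reg => [/(slow_of_order psi_gt0) slow|/(fast_of_order psi_gt0) fast].
    have [K1 hK1] := dimS a a0 slow; have [K2 hK2] := dimS 1 ltr01 slow.
    (* With a common k0 the formulas for a psi and for psi concern the same set of indices, and
       their right-hand sides coincide. *)
    have [fin1 inf1] := hK1 (maxn K1 K2) (leq_maxl _ _).
    have [] := hK2 (maxn K1 K2) (leq_maxr _ _); rewrite psi1 => fin2 inf2.
    have [Sfin|Sinf] := pselect (finite_set [set k | (maxn K1 K2 <= k)%N /\
        psi (dist_int ((cf_denom alpha k)%:~R * alpha))^-1 < ((cf_denom alpha k)%:~R)^-1]).
      by rewrite fin1// fin2.
    have [kappa kS] := increasing_enumeration_exists (infinite_nat_unbounded Sinf).
    by rewrite (inf1 kappa kS) (inf2 kappa kS).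
  have [K1 hK1] := dimF a a0 fast quarter; have [K2 hK2] := dimF 1 ltr01 fast quarter.
  have [fin1 inf1] := hK1 (maxn K1 K2) (leq_maxl _ _).
  have [] := hK2 (maxn K1 K2) (leq_maxr _ _); rewrite psi1 => fin2 inf2.
  have [Sfin|Sinf] := pselect (finite_set [set k | (maxn K1 K2 <= k)%N /\
      dist_int ((cf_denom alpha k)%:~R * alpha) < psi (cf_denom alpha k)%:~R]).
    by rewrite fin1// fin2.
  have [kappa kS] := increasing_enumeration_exists (infinite_nat_unbounded Sinf).
  by rewrite (inf1 kappa kS) (inf2 kappa kS).
suff E : hausdorff_dim (approx_set alpha (rescale c psi)) = hausdorff_dim (approx_set alpha psi).
  by rewrite E dim_cst.
(* For large T, (c / C2) psi T <= c psi (T / c) <= c C1 psi T, and the outer functions are multiples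
   of psi. *)
have [C1 [T1 [C10 hT1]]] := lqm_dilation psi_decr psi_lqm c0.
have cV0 : 0 < c^-1 by rewrite invr_gt0.
have [C2 [T2 [C20 hT2]]] := lqm_dilation psi_decr psi_lqm cV0.
apply/eqP; rewrite eq_le; apply/andP; split.
  rewrite -(dim_cst (c * C1)) ?mulr_gt0//; apply: hausdorff_dim_mono.
  apply: approx_set_mono; exists T1 => T /hT1 h.
  by rewrite /rescale -mulrA ler_pM2l.
rewrite -(dim_cst (c / C2)) ?divr_gt0//; apply: hausdorff_dim_mono.
apply: approx_set_mono; exists (T2 * c) => T; rewrite -ler_pdivlMr// => /hT2.
rewrite invrK divfK ?gt_eqF// => h.
by rewrite /rescale -mulrA ler_pM2l// ler_pdivrMl.
Qed.
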